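(* For any integers $n>k\ge1$ there exists a bundle $\pi_{n,k}:\mathrm{sh}^{(n)}\to\mathrm{sh}^{(k)}$ with fiber $\mathrm{sh}^{(n-k)}$.
   Context: Fusion products. Let $e,h,f$ be the standard basis of $\mathfrak{sl}_2(\mathbb C)$ and write $x_j=x\otimes t^j$. For positive integers $A=(a_1,\ldots,a_n)$ choose pairwise distinct $z_1,\ldots,z_n\in\mathbb C$, let $\mathbb C^{a}$ be the $a$-dimensional irreducible $\mathfrak{sl}_2$-module, and $\mathbb C^{a_i}(z_i)$ the $\mathfrak{sl}_2\otimes\mathbb C[t]$-module on which $x_j$ acts as $z_i^jx$. Let $\overline{v_A}\in\bigotimes_i\mathbb C^{a_i}(z_i)$ be the tensor product of lowest weight vectors and $F_s$ the span of all $x^{(1)}_{i_1}\cdots x^{(k)}_{i_k}\overline{v_A}$ with $x^{(j)}\in\mathfrak{sl}_2$, $i_1+\cdots+i_k\le s$. The fusion product is the associated graded $\mathfrak{sl}_2\otimes\mathbb C[t]$-module $M^A=\bigoplus_sF_s/F_{s-1}$, with $v_A$ the image of $\overline{v_A}$. Known facts: up to isomorphism $M^A$ is independent of the $z_i$ and of the order of the $a_i$; $\mathfrak{sl}_2\otimes t^j$ acts by $0$ for $j\ge n$; $M^A=\mathbb C[e_0,\ldots,e_{n-1}]v_A\simeq\mathbb C[e_0,\ldots,e_{n-1}]/I_A$ with $I_A$ generated by $\sum_{i_1+\cdots+i_k=s}e_{n-1-i_1}\cdots e_{n-1-i_k}$ for $k\ge1$, $s<\sum_{j=1}^n\max(k+1-a_j,0)$;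 $\dim M^A=\prod a_i$. Schubert variety. $\mathrm G=SL_2(\mathbb C[t]/t^n)$ acts on $M^A$ and on $\mathbb P(M^A)$; $[v]$ denotes the line $\mathbb Cv$; $\mathrm{sh}_A=\overline{\mathrm G\cdot[v_A]}\subset\mathbb P(M^A)$. For $2\le a_1<\cdots<a_n$ the variety $\mathrm{sh}_A$ depends, up to isomorphism, only on $n$; it is denoted $\mathrm{sh}^{(n)}$ (one may take $A=(2,3,\ldots,n+1)$). ''Bundle'' means locally trivial fibration of algebraic varieties. *)

(* Defs.v *)
From mathcomp Require Import all_boot all_order all_algebra.
From mathcomp Require Import mpoly.
From mathcomp Require Import boolp classical_sets reals.
From mathcomp Require Import complex.

Set Implicit Arguments.
Unset Strict Implicit.
Unset Printing Implicit Defensive.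

Import Order.TTheory GRing.Theory Num.Theory.
Local Open Scope ring_scope.
Local Open Scope classical_set_scope.

(* Points of P(W) are the lines of W, i.e. the L : {vspace W} with
   \dim L = 1; the point [v] is <[v]>%VS.  Subvarieties of P(W) are sets of
   such lines.  Polynomial functions on W are polynomials in the coordinates
   of a fixed basis; homogeneity does not depend on this basis. *)
Section Projective.
Variable K : numClosedFieldType.

Definition peval (W : vectType K) (p : {mpoly K[\dim {:W}]}) (v : W) : K :=
  p.@[fun i => coord (vbasis {:W}) i v].

Definition pmap (W W' : vectType K)
    (g : 'I_(\dim {:W'}) -> {mpoly K[\dim {:W}]}) (v : W) : W' :=
  \sum_i peval (g i) v *: (vbasis {:W'})`_i.

Definition proj_space (W : vectType K) : set {vspace W} :=
  [set L | \dim L = 1%N].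

Definition zclosed (W : vectType K) (Z : set {vspace W}) : Prop :=
  exists2 S : set {mpoly K[\dim {:W}]},
    (forall p, S p -> exists d : nat, p \is d.-homog) &
    Z = [set L | proj_space L /\
                 forall p v, S p -> v \in L -> peval p v = 0].

Definition zclosure (W : vectType K) (X : set {vspace W}) : set {vspace W} :=
  smallest (@zclosed W) X.

Definition zopen_in (W : vectType K) (X U : set {vspace W}) : Prop :=
  exists2 Z, zclosed Z & U = X `\` Z.

Definition morphism (W W' : vectType K) (X : set {vspace W})
    (Y : set {vspace W'}) (f : {vspace W} -> {vspace W'}) : Prop :=
  (forall L, X L -> Y (f L)) /\
  (forall L, X L -> exists U, [/\ zopen_in X U, U L &
     exists (d : nat) (g : 'I_(\dim {:W'}) -> {mpoly K[\dim {:W}]}),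
       (forall i, g i \is d.-homog) /\
       (forall L' v, U L' -> v \in L' -> v != 0 ->
          pmap g v != 0 /\ f L' = <[pmap g v]>%VS)]).

Definition isomorphism (W W' : vectType K) (X : set {vspace W})
    (Y : set {vspace W'}) (f : {vspace W} -> {vspace W'}) : Prop :=
  morphism X Y f /\
  exists g, [/\ morphism Y X g, (forall L, X L -> g (f L) = L) &
                (forall L, Y L -> f (g L) = L)].

(* Products are formed through the Segre embedding of P(W1) x P(W2) into
   P(W1 (x) W2), where W1 (x) W2 is the space of coordinate matrices. *)
Definition segre (W1 W2 : vectType K) (L1 : {vspace W1}) (L2 : {vspace W2}) :
    {vspace 'M[K]_(\dim {:W1}, \dim {:W2})} :=
  <[\matrix_(i, j) (coord (vbasis {:W1}) i (vpick L1) *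
                    coord (vbasis {:W2}) j (vpick L2))]>%VS.

Definition pprod (W1 W2 : vectType K) (X : set {vspace W1})
    (Y : set {vspace W2}) : set {vspace 'M[K]_(\dim {:W1}, \dim {:W2})} :=
  [set segre L.1 L.2 | L in X `*` Y].

Definition is_bundle (W W1 W2 : vectType K) (E : set {vspace W})
    (B : set {vspace W1}) (F : set {vspace W2})
    (pi : {vspace W} -> {vspace W1}) : Prop :=
  morphism E B pi /\
  forall b, B b -> exists U, [/\ zopen_in B U, U b &
    exists phi,
      isomorphism (E `&` pi @^-1` U) (pprod U F) phi /\
      forall L, E L -> U (pi L) -> exists2 y, F y & phi L = segre (pi L) y].

End Projective.

Section Fusion.
Variable K : numClosedFieldType.

Definition vspan (V : vectType K) (S : set V) : {vspace V} :=
  xget fullv [set U : {vspace V} | (forall v, S v -> v \in U) /\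
    forall U' : {vspace V}, (forall v, S v -> v \in U') -> (U <= U')%VS].

Lemma vspanP (V : vectType K) (S : set V) :
  (forall v, S v -> v \in vspan S) /\
  forall U' : {vspace V}, (forall v, S v -> v \in U') -> (vspan S <= U')%VS.
Proof.
apply: (@xgetPex _ fullv [set U : {vspace V} | (forall v, S v -> v \in U) /\
    forall U' : {vspace V}, (forall v, S v -> v \in U') -> (U <= U')%VS]).
have: exists U : {vspace V}, forall v, S v -> v \in U.
  by exists fullv => v _; rewrite memvf.
case=> U; have [d] := ubnP (\dim U); elim: d U => // d IH U dU SU.
have [?|] := pselect (forall U' : {vspace V}, (forall v, S v -> v \in U') ->
  (U <= U')%VS); first by exists U.
move=> /existsNP[U' /not_implyP[SU' nUU']].
apply: (IH (U :&: U')%VS) => [|v Sv]; last by rewrite memv_cap SU // SU'.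
apply: (@leq_trans (\dim U)); last by rewrite -ltnS.
have := dimv_leqif_sup (capvSl U U').
rewrite subv_cap subvv /= => h; rewrite ltn_neqAle h.1 andbT.
by rewrite h.2; apply/negP.
Qed.

(* Matrix of x = [[p, q], [r, -p]] in sl_2 on C^a, acting on column vectors,
   in the basis u_0, ..., u_{a-1} with u_0 of lowest weight and
   e u_j = u_{j+1},  h u_j = (2j - (a-1)) u_j,  f u_j = j (a-j) u_{j-1}. *)
Definition irrep (a : nat) (x : 'M[K]_2) : 'M[K]_a :=
  \matrix_(i, j)
    (  x 0 0 *+ (i == j :> nat) * (j.*2%:R - a.-1%:R)
     + x 0 1 *+ (i == j.+1 :> nat)
     + x 1 0 *+ (i.+1 == j :> nat) * (j * (a - j))%:R).

Variables (n : nat) (a : 'I_n -> nat) (z : 'I_n -> K).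

(* The tensor product of the C^{a_i}; phi m is the coordinate of phi on
   u_{m_0} (x) ... (x) u_{m_{n-1}}. *)
Definition midx : finType := {dffun forall i : 'I_n, 'I_(a i)}.

Definition tens : vectType K := {ffun midx -> K^o}.

Definition tact (x : 'M[K]_2) (j : nat) (phi : tens) : tens :=
  [ffun m : midx => \sum_(i < n) z i ^+ j *
     \sum_(q < a i) irrep (a i) x (m i) q * phi [ffun l => dfwith m q l]].

Definition lowest : tens := [ffun m : midx => [forall i, m i == 0%N :> nat]%:R].

Inductive word : nat -> tens -> Prop :=
| word_nil : word 0 lowest
| word_cons x j d v : \tr x = 0 -> word d v -> word (j + d) (tact x j v).

Definition Fil (s : nat) : {vspace tens} :=
  vspan [set v | exists2 d, (d <= s)%N & word d v].

Definition Fil_pred (s : nat) : {vspace tens} :=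
  if s is s'.+1 then Fil s' else 0%VS.

(* F_s / F_{s-1} is realized as a complement of F_{s-1} in F_s, and cls s is
   the quotient map, that is the projection of F_s onto this complement along
   F_{s-1}. *)
Definition gr (s : nat) : {vspace tens} := (Fil s :\: Fil_pred s)%VS.

Definition cls (s : nat) : 'End(tens) := addv_pi1 (Fil s) (Fil_pred s).

(* Since M^A = C[e_0, ..., e_{n-1}] v_A, and by weights at most
   \sum_i (a_i - 1) factors act nontrivially, the degrees occurring in M^A
   are strictly below this bound. *)
Definition degbound : nat := (n.-1 * \sum_(i < n) (a i).-1).+1.

(* M^A = \bigoplus_s F_s / F_{s-1} is the subspace fusion of gtens, the s-th
   coordinate being the component in F_s / F_{s-1}. *)
Definition gtens : vectType K := {ffun 'I_degbound -> tens}.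

Definition fusion : set gtens :=
  [set m : gtens | forall s : 'I_degbound, m s \in gr s].

Definition gact (x : 'M[K]_2) (j : nat) (m : gtens) : gtens :=
  [ffun s' : 'I_degbound =>
     \sum_(s < degbound | (j + s)%N == s') cls s' (tact x j (m s))].

Definition v_A : gtens :=
  [ffun s : 'I_degbound => if s == 0%N :> nat then cls 0 lowest else 0].

(* The exponential of a nilpotent operator. *)
Definition nilexp (T : gtens -> gtens) (m : gtens) : gtens :=
  \sum_(k < (\dim {:gtens}).+1) (k`!%:R)^-1 *: iter k T m.

(* gact_currents x p is the action on M^A of x (x) p, for p in C[t]/t^n. *)
Definition gact_currents (x : 'M[K]_2) (p : {poly %/ ('X^n : {poly K})})
    (m : gtens) : gtens :=
  \sum_(j < n) p`_j *: gact x j m.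

Definition one_plus (x : 'M[K]_2) (p : {poly %/ ('X^n : {poly K})}) :
    'M[{poly %/ ('X^n : {poly K})}]_2 :=
  1%:M + \matrix_(i, j) (x i j *: p).

(* g acts on M^A as T.  When x *m x = 0, the element 1 + x (x) p of G is the
   exponential of x (x) p, hence acts as the exponential of its action; these
   elements include the elementary matrices, so they generate the group
   SL_2(C[t]/t^n) of the local ring C[t]/t^n. *)
Inductive acts_as :
    'M[{poly %/ ('X^n : {poly K})}]_2 -> (gtens -> gtens) -> Prop :=
| acts_one : acts_as 1%:M id
| acts_exp x p g T : x *m x = 0 -> acts_as g T ->
    acts_as (one_plus x p *m g) (fun m => nilexp (gact_currents x p) (T m)).

Definition orbit_A : set {vspace gtens} :=
  [set L | exists g T, [/\ \det g = 1, acts_as g T & L = <[T v_A]>%VS]].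

(* P(M^A) is the set of lines contained in fusion, a linear subspace of
   P(gtens), so the closure in P(M^A) is the trace of that in P(gtens). *)
Definition sh : set {vspace gtens} :=
  [set L : {vspace gtens} | (forall m, m \in L -> fusion m) /\ zclosure orbit_A L].

End Fusion.

Arguments sh {K n} a z _.

Definition admissible (n : nat) (a : 'I_n -> nat) : Prop :=
  (forall i, (2 <= a i)%N) /\ (forall i j : 'I_n, (i < j)%N -> (a i < a j)%N).

(* Main.v *)
(* A point of sh^(n) is a chain of lattices C[t]^2 = L_0 > L_1 > ... > L_n with
   t L_j contained in L_{j+1} and L_j / L_{j+1} a line, so that each step is the
   choice of a point of a projective line.  The bundle map forgets the steps
   after L_k, and its fibre consists of the chains of n - k steps in L_k, which
   is isomorphic to C[t]^2.

   A list l of points of the two standard charts of P^1 describes such a chain.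
   Replacing t by t - s z_i in the successive steps gives a chain over C[s]
   which, for s <> 0, is the same as a point w_i(s) of P^1 for each i.  The
   tensor product of the (a_i - 1)-st powers of the w_i(s) lies in the Rees
   module of the filtration F, and its class at s = 0 is the vector pt l of the
   fusion product.  Currents move pt l as they move the chain l, because an
   isomorphism of chains lifts to the local ring C[s]/s^N; in particular the
   orbit of [v_A] is the set of the [pt l] in one orbit of chains, which is
   dense.  The closure consists of all [pt l] by properness: a place of the
   function field of the orbit extends to one at which the coordinates in some
   chart are finite.

   Conversely the chain is recovered from [pt l]: since a is strictly
   increasing, products of determinants in the w_i give, for each j, linear
   forms on the fusion product whose ratio on the chart is the j-th coordinate,
   as a function of the previous ones.  Hence the charts have inverses given by
   homogeneous polynomials, for any admissible a, and over a chart of the first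
   k steps a chain is the pair of its first k and of its last n - k steps. *)

Require Import Defs.
From HB Require Import structures.
From mathcomp Require Import all_boot all_order all_algebra.
From mathcomp Require Import mpoly.
From mathcomp Require Import boolp classical_sets reals.
From mathcomp Require Import complex.
From mathcomp Require Import perm ring zify.
Set Implicit Arguments.
Unset Strict Implicit.
Unset Printing Implicit Defensive.
Import Order.TTheory GRing.Theory Num.Theory.
Local Open Scope ring_scope.

(** * Chains of lattices *)

(** The filtration [F] is given by spans of words, so it is reached through linear forms. A form
    with coefficients in [K[s]] whose values on the standard chart are divisible by [s^d] stays
    divisible on every chart and under the transposed currents, hence on every [F_k s^k]; its
    coefficient of [s^d] is then a form on the fusion product. Applied to forms separating a vector
    from [F_k], the same transfer puts the vectors of all charts into the Rees module. The standard
    chart itself is accessible because its points are exponentials of [e] times a polynomial [P]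
    applied to the lowest vector, where [P] has the coordinates as Newton coefficients at the nodes
    [s z_i]. Two charts of one chain are compared through the lowest coefficient in [s] only: the
    lifted transition exists over a truncation of the power series, and its unit factor enters
    through its residue. The places used for properness are rings with an ideal of residue field
    [K], enlarged once per step of the chain, so finitely many extensions suffice. *)

Lemma unzip_zip (T : Type) n (eps : seq bool) (q : seq T) : size eps = n -> size q = n ->
  [/\ map fst (zip eps q) = eps, map snd (zip eps q) = q & size (zip eps q) = n].
Proof.
move=> se sq; rewrite -/unzip1 -/unzip2 unzip1_zip ?unzip2_zip ?size_zip ?se ?sq //.
by rewrite minnn.
Qed.

Section TwoByTwo.
Variable R : comNzRingType.

Lemma ord2P (P : 'I_2 -> Prop) : P 0 -> P 1 -> forall i, P i.
Proof.
by move=> P0 P1 [[|[|//]] h]; [have -> : Ordinal h = 0 by exact: val_inj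
  | have -> : Ordinal h = 1 by exact: val_inj].
Qed.

Lemma mulmx2E k (A : 'M[R]_2) (B : 'M[R]_(2, k)) i j :
  (A *m B) i j = A i 0 * B 0 j + A i 1 * B 1 j.
Proof.
rewrite mxE !big_ord_recl big_ord0 addr0; congr (_ + A i _ * B _ j); exact: val_inj.
Qed.

Lemma det2E (A : 'M[R]_2) : \det A = A 0 0 * A 1 1 - A 0 1 * A 1 0.
Proof.
rewrite (expand_det_row A 0) !big_ord_recl big_ord0 addr0 /cofactor !det_mx11.
rewrite !mxE /= expr0 expr1 mul1r mulN1r mulrN.
by congr (_ * A _ _ - A _ _ * A _ _); exact: val_inj.
Qed.

Lemma mx2P k (A B : 'M[R]_(2, k)) :
  (forall j, A 0 j = B 0 j) -> (forall j, A 1 j = B 1 j) -> A = B.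
Proof. by move=> h0 h1; apply/matrixP; apply: ord2P. Qed.

Lemma scalemxE m k c (A : 'M[R]_(m, k)) i j : (c *: A) i j = c * A i j.
Proof. by rewrite mxE. Qed.

Definition wedge (u v : 'cV[R]_2) : R := u 0 0 * v 1 0 - u 1 0 * v 0 0.

Lemma wedge_mul (A : 'M[R]_2) u v : wedge (A *m u) (A *m v) = \det A * wedge u v.
Proof. by rewrite /wedge !mulmx2E det2E; ring. Qed.

(* The two charts of the projective line: (false, q) stands for the line of
   (q, 1) and (true, q) for the line of (1, q). *)
Definition base (x : bool * R) : 'cV[R]_2 :=
  \col_i (if (i == 0) (+) x.1 then x.2 else 1).

(* For t = 'X - c, the columns of gm x t generate the lattice of all f in
   R['X]^2 such that f(c) lies on the line of base x. *)
Definition gm (x : bool * R) (t : R) : 'M[R]_2 :=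
  \matrix_(i, j) (if (j == 0) == x.1 then base x i 0
                  else if i == j then t else 0).

Lemma base0E x : base x 0 0 = if x.1 then 1 else x.2.
Proof. by rewrite mxE /=; case: x.1. Qed.

Lemma base1E x : base x 1 0 = if x.1 then x.2 else 1.
Proof. by rewrite mxE /=; case: x.1. Qed.

Lemma gmE x t :
  [/\ gm x t 0 0 = if x.1 then 1 else t, gm x t 0 1 = if x.1 then 0 else x.2,
      gm x t 1 0 = if x.1 then x.2 else 0 & gm x t 1 1 = if x.1 then t else 1].
Proof. by split; rewrite !mxE /=; case: x.1. Qed.

Lemma det_gm x t : \det (gm x t) = t.
Proof. by rewrite det2E; case: (gmE x t) => -> -> -> ->; case: x.1; ring. Qed.

(* The list l describes a chain of lattices, the (j+1)-st being of colength 1 in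
   the j-th and containing its product with 'X - zt j; the fibre of the j-th
   lattice at zt j maps to the fibre of R['X]^2, and wv l zt j is the image of
   the line that defines the next lattice. *)
Fixpoint wv (l : seq (bool * R)) (zt : nat -> R) (j : nat) : 'cV[R]_2 :=
  match l, j with
  | [::], _ => 0
  | x :: _, 0 => base x
  | x :: l', j'.+1 => gm x (zt j - zt 0) *m wv l' (zt \o S) j'
  end.

End TwoByTwo.

Section PolyTwoByTwo.
Variable R : comNzRingType.

Definition ev (c : R) (H : 'M[{poly R}]_2) : 'M[R]_2 := map_mx (horner_eval c) H.

Definition gX (x : bool * R) (c : R) : 'M[{poly R}]_2 :=
  gm (x.1, x.2%:P) ('X - c%:P).

Lemma evM c H H' : ev c (H *m H') = ev c H *m ev c H'.
Proof. by rewrite /ev map_mxM. Qed.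

Lemma ev1 c : ev c 1%:M = 1%:M.
Proof. by rewrite /ev map_mx1. Qed.

Lemma det_ev c H : \det (ev c H) = (\det H).[c].
Proof. by rewrite /ev det_map_mx. Qed.

Lemma ev_gX x c d : ev d (gX x c) = gm x (d - c).
Proof.
apply: mx2P; apply: ord2P; rewrite !mxE /=; case: x.1; rewrite /horner_eval ?hornerE /=; reflexivity.
Qed.

Lemma det_gX x c : \det (gX x c) = 'X - c%:P.
Proof. exact: det_gm. Qed.

(* The columns of H * gX x zt at t = zt are multiples of base x', hence lie in
   the lattice spanned by the columns of gX x' zt. *)
Lemma gX_divide (H : 'M[{poly R}]_2) x x' c zt :
  ev zt H *m base x = c *: base x' ->
  exists H', H *m gX x zt = gX x' zt *m H'.
Proof.
move=> e; set A := H *m gX x zt.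
have Aev i j : (A i j).[zt] = if (j == 0) == x.1 then c * base x' i 0 else 0.
  have -> : (A i j).[zt] = ev zt A i j by rewrite [RHS]mxE.
  rewrite /A evM ev_gX subrr mulmx2E ; case: ifP => hj.
    have := congr1 (fun M : 'cV_2 => M i 0) e; rewrite mulmx2E [RHS]mxE => <-.
    by rewrite ![gm _ _ _ _]mxE hj.
  by rewrite ![gm _ _ _ _]mxE hj !if_same !mulr0 addr0.
clearbody A.
pose k : 'I_2 := if x'.1 then 0 else 1; pose k' : 'I_2 := if x'.1 then 1 else 0.
have root_j j : exists q, A k' j - x'.2%:P * A k j = q * ('X - zt%:P).
  apply/factor_theorem/eqP; rewrite !hornerE !Aev /k /k'.
  case: ifP => _; last by rewrite mulr0 subrr.
  by case: x'.1 (base0E x') (base1E x') => -> ->; ring.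
have [f fE] : exists f : 'I_2 -> {poly R}, forall j,
    A k' j - x'.2%:P * A k j = f j * ('X - zt%:P).
  have [q0 e0] := root_j 0; have [q1 e1] := root_j 1.
  by exists (fun j => if j == 0 then q0 else q1); apply: ord2P.
exists (\matrix_(i, j) if i == k then A k j else f j).
have [g00 g01 g10 g11] := gmE (x'.1, x'.2%:P) ('X - zt%:P).
apply: mx2P => j; rewrite mulmx2E ?g00 ?g01 ?g10 ?g11 !mxE /=;
  by have := fE j; rewrite /k /k'; case: x'.1 => /= fj;
  rewrite ?(mulrC ('X - _)) -?fj ?mul0r ?mul1r ?addr0 ?add0r ?(addrC (_ * _)) ?subrK.
Qed.

(** [R] may have zero divisors; the adjugate of [gX] reduces cancellation to the regularity of the
    monic polynomial ['X - zt]. *)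
Lemma gX_lreg x zt (H H' : 'M[{poly R}]_2) : gX x zt *m H = gX x zt *m H' -> H = H'.
Proof.
move=> e; have := congr1 (mulmx (\adj (gX x zt))) e.
rewrite !mulmxA mul_adj_mx det_gX !mul_scalar_mx => /matrixP e'.
apply/matrixP => i j; have := e' i j; rewrite ![(_ *: (_ : matrix _ _ _)) i j]mxE.
exact: (monic_lreg (monicXsubC zt)).
Qed.

(** Keeps the transition matrices of determinant 1 from one step of the chain to the next. *)
Lemma det_gX_cancel x x' zt (H H' : 'M[{poly R}]_2) :
  H *m gX x zt = gX x' zt *m H' -> \det H' = \det H.
Proof.
move=> /(congr1 determinant); rewrite !det_mulmx !det_gX mulrC.
by move/(monic_lreg (monicXsubC zt)).
Qed.

End PolyTwoByTwo.

(** * Equivalence of chains given in different charts *)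

Section Equivalence.
Variable F : fieldType.
Implicit Types (h : 'M[{poly F}]_2) (x : bool * F) (l : seq (bool * F)).

(* eqv h l l': the transformation h maps the chain of lattices with charts and
   coordinates l to the one with charts and coordinates l'. *)
Inductive eqv : 'M[{poly F}]_2 -> seq (bool * F) -> seq (bool * F) -> Prop :=
| eqv_nil h : eqv h [::] [::]
| eqv_cons h h' c x x' l l' :
    ev 0 h *m base x = c *: base x' ->
    h *m gX x 0 = gX x' 0 *m h' ->
    eqv h' l l' -> eqv h (x :: l) (x' :: l').

Lemma eqv_size h l l' : eqv h l l' -> size l = size l'.
Proof. by elim=> //= *; congr _.+1. Qed.

Lemma base_neq0 x : base x != 0.
Proof.
apply/eqP => /matrixP e; have := e 0 0; have := e 1 0.
rewrite base0E base1E !mxE; case: x.1 => [_ /eqP|/eqP]; by rewrite oner_eq0.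
Qed.

Lemma ev_base_neq0 h x : \det h = 1 -> ev 0 h *m base x != 0.
Proof.
move=> d1; have u : ev 0 h \in unitmx.
  by rewrite unitmxE det_ev d1 hornerE unitr1.
apply/eqP => e; have := base_neq0 x.
by rewrite -[base x](mulKmx u) e mulmx0 eqxx.
Qed.

Lemma col2_eq0 (v : 'cV[F]_2) : v 0 0 = 0 -> v 1 0 = 0 -> v = 0.
Proof. by move=> e0 e1; apply: mx2P; move=> j; rewrite [j]ord1 mxE. Qed.

Lemma col2_base (v : 'cV[F]_2) (eps : bool) :
  v (if eps then 0 else 1) 0 != 0 ->
  v = v (if eps then 0 else 1) 0 *:
      base (eps, v (if eps then 1 else 0) 0 / v (if eps then 0 else 1) 0).
Proof.
move=> v0; apply: mx2P => j; rewrite [j]ord1 mxE ?base0E ?base1E /=; case: eps v0 => /= v0;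
  by rewrite ?mulr1 // mulrC divfK.
Qed.

Lemma eqv_step h x l x' c : \det h = 1 ->
    ev 0 h *m base x = c *: base x' ->
  exists2 h', \det h' = 1 & forall l l', eqv h' l l' -> eqv h (x :: l) (x' :: l').
Proof.
move=> d1 e; have [h' eh] := gX_divide e.
exists h'; first by rewrite (det_gX_cancel eh).
by move=> l0 l1 e1; exact: eqv_cons e eh e1.
Qed.

Lemma eqv_exists h l : \det h = 1 -> exists l', eqv h l l'.
Proof.
elim: l h => [|x l IH] h d1; first by exists [::]; exact: eqv_nil.
have [eps v0] : exists eps : bool, (ev 0 h *m base x) (if eps then 0 else 1) 0 != 0.
  have [v0|v0] := eqVneq ((ev 0 h *m base x) 0 0) 0; last by exists true.
  exists false; apply/negP => /eqP v1; have := ev_base_neq0 x d1.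
  by rewrite (col2_eq0 v0 v1) eqxx.
have [h' d' hl] := eqv_step l d1 (col2_base v0).
by have [l' el] := IH _ d'; eexists; apply: hl el.
Qed.

Lemma eqv_refl_prefix l0 l l' : eqv 1%:M l l' -> eqv 1%:M (l0 ++ l) (l0 ++ l').
Proof.
move=> e; elim: l0 => //= x l0 IH; apply: (@eqv_cons _ 1%:M 1) IH.
  by rewrite ev1 mul1mx scale1r.
by rewrite mul1mx mulmx1.
Qed.

Lemma eqv_refl l : eqv 1%:M l l.
Proof. by have := eqv_refl_prefix l (eqv_nil 1%:M); rewrite cats0. Qed.

Lemma eqv_take k h l l' : eqv h l l' -> eqv h (take k l) (take k l').
Proof.
move=> e; elim: e k => [h0|h0 h' c x x' l0 l0' e1 e2 e3 IH] [|k] /=; try exact: eqv_nil.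
exact: eqv_cons e1 e2 (IH k).
Qed.

Lemma base_inj c x x' : x.1 = x'.1 -> base x = c *: base x' -> c = 1 /\ x = x'.
Proof.
case: x x' => [eps q] [_ q'] /= <- /matrixP e; have := e 0 0; have := e 1 0.
rewrite ![(_ *: (_ : matrix _ _ _)) _ _]mxE !base0E !base1E /=; case: eps {e} => /=.
  by rewrite mulr1 => eq ec; rewrite eq -ec mul1r.
by rewrite mulr1 => ec ->; rewrite -ec mul1r.
Qed.

(** Within one chart the coordinate of a step is unique, and then [gX_lreg] forces the next
    transition matrix to be the identity again. This makes the trivialization of the bundle well
    defined: once the charts of the first steps are fixed, the remaining chain is determined up to
    equivalence. *)
Lemma eqv_chart_inj l0 l0' l l' : map fst l0 = map fst l0' ->
  eqv 1%:M (l0 ++ l) (l0' ++ l') -> l0 = l0' /\ eqv 1%:M l l'.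
Proof.
elim: l0 l0' => [|x l0 IH] [|x' l0'] //= [ex /IH {}IH] e.
inversion e as [|h h' c y y' m m' e1 e2 e3]; subst.
move: e1; rewrite ev1 mul1mx => /(base_inj ex)[_ exx]; subst x'.
move: e2; rewrite mul1mx -[LHS]mulmx1 => /gX_lreg eh; subst h'.
by have [-> e4] := IH e3.
Qed.

Lemma eqv_extend k h l l1 : \det h = 1 -> eqv h (take k l) l1 ->
  exists l2, eqv h l (l1 ++ l2).
Proof.
elim: k l l1 h => [|k IH] [|x l] l1 h d1 /= e; inversion e as [|h0 h' c y y' m m' e1 e2 e3]; subst.
- by exists [::]; exact: eqv_nil.
- by have [l' el] := eqv_exists (x :: l) d1; exists l'.
- by exists [::]; exact: eqv_nil.
have d' : \det h' = 1 by rewrite (det_gX_cancel e2).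
by have [l2 el] := IH _ _ _ d' e3; exists l2; exact: eqv_cons e1 e2 el.
Qed.

(* C holds for generic arguments, chosen one after the other: each avoids a
   finite set that may depend on the previous ones. *)
Fixpoint generic (n : nat) (C : seq F -> Prop) : Prop :=
  if n is n'.+1 then
    exists bad : seq F, forall q, q \notin bad -> generic n' (fun qs => C (q :: qs))
  else C [::].

Lemma generic_sub n (C C' : seq F -> Prop) :
  (forall qs, size qs = n -> C qs -> C' qs) -> generic n C -> generic n C'.
Proof.
elim: n C C' => [|n IH] C C' sub /=; first exact: sub.
move=> [bad h]; exists bad => q /h; apply: IH => qs sz; by apply: sub; rewrite /= sz.
Qed.

(** The image of the line of [(e, q)] misses the chart [e'] only where an affine function [A q + B]
    vanishes. Its coefficients form a row of an invertible matrix, so at most one [q] is excluded,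
    depending on the earlier choices through [h]. *)
Lemma eqv_generic n h (eps eps' : seq bool) : \det h = 1 ->
    size eps = n -> size eps' = n ->
  generic n (fun qs => exists qs', size qs' = n /\ eqv h (zip eps qs) (zip eps' qs')).
Proof.
elim: n h eps eps' => [|n IH] h [|e eps] [|e' eps'] //= d1.
  by move=> _ _; exists [::]; split=> //; exact: eqv_nil.
move=> [sz] [sz'].
pose r : 'I_2 := if e' then 0 else 1.
pose A := ev 0 h r (if e then 1 else 0); pose B := ev 0 h r (if e then 0 else 1).
have vE q : (ev 0 h *m base (e, q)) r 0 = A * q + B.
  by rewrite mulmx2E base0E base1E /A /B /=; case: (e); rewrite ?mulr1 // addrC.
have nz : (A != 0) || (B != 0).
  rewrite -negb_and; apply/negP => /andP[/eqP A0 /eqP B0].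
  have : \det (ev 0 h) = 0.
    by rewrite det2E; move: A0 B0; rewrite /A /B /r; case: (e); case: (e') => -> ->; ring.
  by rewrite det_ev d1 hornerE => /eqP; rewrite oner_eq0.
(* For [A = 0] the list contains only [0]; no value is bad then, since [B != 0]. *)
exists [:: - B / A] => q; rewrite inE => qbad.
have v0 : (ev 0 h *m base (e, q)) (if e' then 0 else 1) 0 != 0.
  rewrite -/r vE; have [A0|A0] := eqVneq A 0.
    by rewrite A0 mul0r add0r; move: nz; rewrite A0 eqxx.
  apply: contra qbad; rewrite addr_eq0 => /eqP eB.
  by rewrite -eB mulrC mulKf.
have [h' d' hl] := eqv_step [::] d1 (col2_base v0).
have := IH h' eps eps' d' sz sz'; apply: generic_sub => qs _ [qs' [s' el]].
by eexists (_ :: qs'); split; [rewrite /= s' | apply: hl el].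
Qed.

End Equivalence.

(** * Base change, and lifting to a local ring *)

Definition mapx (A B : Type) (f : A -> B) (x : bool * A) := (x.1, f x.2).

Section Naturality.
Variables (R R' : comNzRingType) (f : {rmorphism R -> R'}).

Lemma map_base x : map_mx f (base x) = base (mapx f x).
Proof.
by apply: mx2P => j; rewrite [j]ord1 !mxE /=; case: x.1; rewrite //= rmorph1.
Qed.

Lemma map_gm x t : map_mx f (gm x t) = gm (mapx f x) (f t).
Proof.
by apply: mx2P; apply: ord2P; rewrite !mxE /=; case: x.1; rewrite //= ?rmorph1 ?rmorph0.
Qed.

Lemma map_wv l zt j : map_mx f (wv l zt j) = wv (map (mapx f) l) (f \o zt) j.
Proof.
elim: l zt j => [|x l IH] zt [|j] /=; rewrite ?map_mx0 ?map_base //.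
by rewrite map_mxM map_gm IH rmorphB.
Qed.

Lemma map_ev c H : map_mx f (ev c H) = ev (f c) (map_mx (map_poly f) H).
Proof. by apply/matrixP => i j; rewrite !mxE /horner_eval horner_map. Qed.

Lemma wv_ext (l : seq (bool * R)) zt zt' j : zt =1 zt' -> wv l zt j = wv l zt' j.
Proof.
elim: l zt zt' j => [|x l IH] zt zt' [|j] //= e.
by rewrite !e (IH _ (zt' \o S)) // => i /=; rewrite e.
Qed.

End Naturality.

Lemma map_gX (R R' : comNzRingType) (f : {rmorphism R -> R'}) x c : map_mx (map_poly f) (gX x c) = gX (mapx f x) (f c).
Proof.
by rewrite /gX (map_gm (map_poly f)) rmorphB /= map_polyX map_polyC /mapx /= map_polyC.
Qed.

Section Lift.
Variables (O : comUnitRingType) (F : fieldType) (res : {rmorphism O -> F}).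
Hypothesis res_unit : forall x, res x != 0 -> x \is a GRing.unit.

(* Equivalences of charts at the special fibre, where all the points zt
   collide, deform over the local ring O. *)
Lemma eqv_lift h l l' : eqv h l l' -> forall H zt (L : seq (bool * O)),
  map_mx (map_poly res) H = h -> \det H = 1 -> (forall j, res (zt j) = 0) ->
  map (mapx res) L = l ->
  exists2 L', map (mapx res) L' = l' & exists c : nat -> O,
    (forall j, res (c j) != 0) /\
    forall j, (j < size l)%N -> ev (zt j) H *m wv L zt j = c j *: wv L' zt j.
Proof.
elim=> {h l l'} [h|h h1 c x x' l l' e1 e2 e3 IH] H zt L eH dH zt0 eL.
  exists [::] => //; exists (fun _ => 1); split=> // j; by rewrite rmorph1 oner_neq0.
case: L eL => [//|X L] [eX eL].
have dh : \det h = 1 by rewrite -eH det_map_mx dH rmorph1.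
have c0 : c != 0.
  apply/eqP => c0; have := ev_base_neq0 x dh.
  by rewrite e1 c0 scale0r eqxx.
set v := ev (zt 0) H *m base X.
have resv : map_mx res v = c *: base x'.
  by rewrite /v map_mxM map_ev zt0 eH map_base eX.
pose r : 'I_2 := if x'.1 then 0 else 1; pose r' : 'I_2 := if x'.1 then 1 else 0.
have resr : res (v r 0) = c.
  have := congr1 (fun M : 'cV_2 => M r 0) resv; rewrite mxE => ->.
  by rewrite scalemxE /r; case: x'.1 (base0E x') (base1E x') => e01 e11; rewrite ?e01 ?e11 mulr1.
have resr' : res (v r' 0) = c * x'.2.
  have := congr1 (fun M : 'cV_2 => M r' 0) resv; rewrite mxE => ->.
  by rewrite scalemxE /r'; case: x'.1 (base0E x') (base1E x') => e01 e11; rewrite ?e01 ?e11.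
(* The entry that the chart of [x'] normalizes to 1 has residue [c != 0], so it is invertible in [O]
   and the lifted line stays in that chart. *)
have ur : v r 0 \is a GRing.unit by apply: res_unit; rewrite resr.
pose X' := (x'.1, v r' 0 / v r 0).
have resX' : mapx res X' = x'.
  rewrite /mapx /= rmorphM rmorphV // resr resr' mulrC mulKf //.
  by case: (x').
have ev0 : v = v r 0 *: base X'.
  apply: mx2P => j; rewrite [j]ord1 [RHS]mxE ?base0E ?base1E /= /r /r' /X' /=.
    by move: ur; rewrite /r /r'; case: x'.1 => ur; rewrite ?mulr1 // mulrC divrK.
  by move: ur; rewrite /r /r'; case: x'.1 => ur; rewrite ?mulr1 // mulrC divrK.
have [H1 eH1] := gX_divide ev0.
(* The reduction of [H1] solves the equation that determines [h1], so the induction hypothesis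
   applies to it. *)
have resH1 : map_mx (map_poly res) H1 = h1.
  apply: (@gX_lreg _ x' 0); rewrite -e2 -[in LHS]resX' -(zt0 0) -map_gX -map_mxM -eH1.
  by rewrite map_mxM eH map_gX zt0 eX.
have dH1 : \det H1 = 1 by rewrite (det_gX_cancel eH1).
have [L' eL' [cs [cs0 csE]]] := IH H1 (zt \o S) L resH1 dH1 (fun j => zt0 j.+1) eL.
exists (X' :: L'); first by rewrite /= resX' eL'.
exists (fun j => if j is j'.+1 then cs j' else v r 0); split=> [[|j]|[|j]] //=.
  by rewrite resr.
rewrite ltnS => jl.
have := congr1 (ev (zt j.+1)) eH1; rewrite !evM !ev_gX mulmxA => ->.
by rewrite -mulmxA (csE _ jl) -scalemxAr.
Qed.

End Lift.

Section Truncated.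
Variables (F : fieldType) (N : nat).

(** A truncation of the power series in [s = 'X]: elements with nonzero constant term are units, and
    coefficients of degree below [N.+2] are still visible. *)
Definition trunc : comUnitRingType := {poly %/ ('X^(N.+2) : {poly F})}.
Definition to_trunc : {rmorphism {poly F} -> trunc} := in_qpoly ('X^(N.+2) : {poly F}).
Definition tcoef (x : trunc) (i : nat) : F := (x : {poly F})`_i.

Lemma mk_monic_trunc : mk_monic ('X^(N.+2) : {poly F}) = 'X^(N.+2).
Proof. by rewrite mk_monic_Xn. Qed.

Lemma tcoef_to_trunc p i : (i < N.+2)%N -> tcoef (to_trunc p) i = p`_i.
Proof.
by move=> iN; rewrite /tcoef /= mk_monic_trunc -Pdiv.RingMonic.take_poly_rmodp coef_take_poly iN.
Qed.

Lemma to_trunc_surj (x : trunc) : to_trunc (x : {poly F}) = x.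
Proof. by apply: val_inj; apply: in_qpoly_small; exact: size_mk_monic. Qed.

Definition tres (x : trunc) : F := tcoef x 0.

Lemma tcoefXM d (x : trunc) i : (i < N.+2)%N ->
  tcoef (to_trunc 'X^d * x) i = if (i < d)%N then 0 else tcoef x (i - d).
Proof.
move=> iN; rewrite -{1}(to_trunc_surj x) -rmorphM tcoef_to_trunc //.
by rewrite coefXnM.
Qed.

Lemma tres_is_zmod_morphism : zmod_morphism tres.
Proof. by move=> x y; rewrite /tres /tcoef /= coefB. Qed.

Lemma tres_is_monoid_morphism : monoid_morphism tres.
Proof.
split=> [|x y]; first by rewrite /tres -(rmorph1 to_trunc) tcoef_to_trunc // coef1.
by rewrite /tres -(to_trunc_surj x) -(to_trunc_surj y) -rmorphM !tcoef_to_trunc // coef0M.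
Qed.

HB.instance Definition _ := GRing.isZmodMorphism.Build trunc F tres tres_is_zmod_morphism.
HB.instance Definition _ := GRing.isMonoidMorphism.Build trunc F tres tres_is_monoid_morphism.

Lemma tres_to_trunc p : tres (to_trunc p) = p`_0.
Proof. exact: tcoef_to_trunc. Qed.

Lemma tres_unit x : tres x != 0 -> x \is a GRing.unit.
Proof.
have cop (p : {poly F}) : p`_0 != 0 -> coprimep 'X^(N.+2) p.
  move=> p0; apply: coprimep_expl.
  by rewrite coprimep_sym -(subr0 'X) -polyC0 coprimep_XsubC rootE horner_coef0.
move=> x0; rewrite /trunc qualifE /=; have := cop _ x0.
by rewrite -{1}mk_monic_trunc.
Qed.

End Truncated.

(** * Polynomials vanishing at generic points *)

Section MPoly.
Variable K : numFieldType.

Definition sv (R : pzRingType) n (qs : seq R) : 'I_n -> R := fun i => nth 0 qs i.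

Lemma poly_cofinite0 (p : {poly K}) (bad : seq K) :
  (forall x, x \notin bad -> p.[x] = 0) -> p = 0.
Proof.
move=> h; apply/eqP; rewrite -[_ == _]negbK; apply/negP => p0.
pose rs := [seq x <- [seq i%:R | i <- iota 0 (size p + size bad)] | x \notin bad].
have us : uniq [seq i%:R : K | i <- iota 0 (size p + size bad)].
  by rewrite map_inj_uniq ?iota_uniq // => i j /eqP; rewrite eqr_nat => /eqP.
have : (size rs < size p)%N.
  apply: max_poly_roots p0 _ _; last exact: filter_uniq.
  by apply/allP => x; rewrite mem_filter => /andP[xb _]; apply/eqP/h.
rewrite size_filter.
have := count_predC (mem bad) [seq i%:R : K | i <- iota 0 (size p + size bad)].
rewrite size_map size_iota.
have : (count (mem bad) [seq i%:R : K | i <- iota 0 (size p + size bad)] <= size bad)%N.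
  rewrite -size_filter; apply: uniq_leq_size; first exact: filter_uniq.
  by move=> x; rewrite mem_filter => /andP[].
rewrite (@eq_count _ (predC (mem bad)) (fun x => x \notin bad)) //.
set A := count _ _; set B := count _ _; lia.
Qed.

Lemma poly_infinite0 (p : {poly K}) : (forall x, p.[x] = 0) -> p = 0.
Proof. by move=> h; apply: (@poly_cofinite0 _ [::]). Qed.

Lemma mpoly_vanish n (p : {mpoly K[n]}) : (forall v, p.@[v] = 0) -> p = 0.
Proof.
elim: n p => [|n IH] p h.
  apply/mpolyP => m; rewrite mcoeff0; have := h (fun _ => 0).
  have -> : p = (p@_0)%:MP.
    by apply/mpolyP => m'; rewrite mcoeffC; (have -> : m' = 0%MM by apply/mnmP; case); rewrite eqxx mulr1.
  by rewrite mevalC => ->; rewrite mcoeffC mul0r.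
(* [muni] views [p] as a polynomial in the last variable; the others are evaluated at [v']. *)
have evE v' x : (map_poly (meval v') (muni p)).[x]
    = p.@[fun i => oapp v' x (unlift ord_max i)].
  rewrite muniE mevalE rmorph_sum horner_sum /=; apply: eq_bigr => m _.
  rewrite linearZ_LR /= map_polyXn /= hornerZ hornerXn mevalZ mevalX.
  rewrite big_ord_recr /= unlift_none /= mulrA; congr (_ * _ * _).
  apply: eq_bigr => i _; rewrite mnmE.
  have -> : widen_ord (leqnSn n) i = lift ord_max i.
    by apply: val_inj; rewrite /= /bump leqNgt ltn_ord.
  by rewrite liftK.
have mu0 : muni p = 0.
  apply/polyP => i; rewrite coef0; apply: IH => v'.
  rewrite -[LHS](coef_map (meval v')).
  have -> : map_poly (meval v') (muni p) = 0 by apply: poly_infinite0 => x; rewrite evE.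
  by rewrite coef0.
apply/mpolyP => m; rewrite mcoeff0.
have : ((muni p)`_(m ord_max))@_[multinom m (widen_ord (leqnSn n) i) | i < n] = 0.
  by rewrite mu0 coef0 mcoeff0.
rewrite muniE coef_sum raddf_sum /=.
have E (m' : 'X_{1..n.+1}) : ((p@_m' *: 'X_[[multinom m' (widen_ord (leqnSn n) i) | i < n]] *: 'X^(m' ord_max) :
   {poly {mpoly K[n]}})`_(m ord_max))@_[multinom m (widen_ord (leqnSn n) i) | i < n]
   = if m' == m then p@_m else 0.
  rewrite coefZ coefXn; case: (eqVneq m' m) => [->|ne].
    by rewrite eqxx mulr1 mcoeffZ mcoeffX eqxx mulr1.
  case: eqVneq => [e|_]; last by rewrite mulr0 mcoeff0.
  rewrite mulr1 mcoeffZ mcoeffX; case: eqVneq => [e'|_]; last by rewrite mulr0.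
  case/eqP: ne; apply/mnmP => i; have [j ->|->] := unliftP ord_max i; last by [].
  have -> : lift ord_max j = widen_ord (leqnSn n) j.
    by apply: val_inj; rewrite /= /bump leqNgt ltn_ord.
  by have := congr1 (fun M : 'X_{1..n} => M j) e'; rewrite !mnmE.
rewrite (eq_bigr _ (fun m' _ => E m')).
case: (boolP (m \in msupp p)) => mp; last by rewrite (memN_msupp_eq0 mp).
rewrite (bigD1_seq m) //= ?eqxx ?msupp_uniq // big1 ?addr0 // => i im.
by rewrite (negPf im).
Qed.

Lemma meval_set_nth n (p : {mpoly K[n]}) (qs : seq K) i :
  exists P : {poly K}, forall x, P.[x] = p.@[sv (set_nth 0 qs i x)].
Proof.
exists (mmap (@polyC K) (fun j : 'I_n => if j == i :> nat then 'X else (nth 0 qs j)%:P) p) => x.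
rewrite /mmap /meval /mmap horner_sum; apply: eq_bigr => m _.
rewrite hornerM hornerC /=; congr (_ * _); rewrite /mmap1 horner_prod.
apply: eq_bigr => j _; rewrite horner_exp /sv nth_set_nth /=.
by case: eqP => _; rewrite ?hornerX ?hornerC.
Qed.

(** The exceptional sets of [generic] depend on the earlier variables, so the variables are treated
    one by one: a univariate polynomial with cofinitely many zeros is zero. *)
Lemma generic_vanish n m (p : {mpoly K[m]}) :
  n = m -> generic n (fun qs => p.@[sv qs] = 0) -> p = 0.
Proof.
move=> enm.
(* Polynomiality in each single variable is inherited when the first argument is fixed, as the
   induction requires. *)
pose good (G : seq K -> K) := forall qs i,
  exists P : {poly K}, forall x, P.[x] = G (set_nth 0 qs i x).
have main G : good G -> generic n (fun qs => G qs = 0) -> forall qs, size qs = n -> G qs = 0.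
  elim: n G {enm} => [|n IH] G gG /=; first by move=> ? [].
  move=> [bad h] [//|q qs] [sz].
  have [P PE] := gG (q :: qs) 0.
  have P0 : P = 0.
    apply: (@poly_cofinite0 _ bad) => x /h gx; rewrite PE /=.
    apply: (IH (fun qs => G (x :: qs))) sz => // qs' i.
    by have [P' P'E] := gG (x :: qs') i.+1; exists P' => y; rewrite P'E.
  by have := PE q; rewrite P0 horner0 /= => <-.
move=> g; apply: mpoly_vanish => v.
have /main/(_ g [seq v i | i <- enum 'I_m]) : good (fun qs => p.@[sv qs]).
  by move=> qs i; exact: meval_set_nth.
rewrite size_map size_enum_ord => /(_ (esym enm)) <-.
apply: meval_eq => i; rewrite /sv (nth_map i) ?size_enum_ord //.
by rewrite nth_ord_enum.
Qed.

End MPoly.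

(** * Vectors of the fusion product attached to chains *)

Section Veronese.
Variables (K : numClosedFieldType) (R : comNzRingType) (io : {rmorphism K -> R}).

(* The (a-1)-st power of u in C^a, up to normalization. *)
Definition vec (a : nat) (u : 'cV[R]_2) (k : nat) : R :=
  u 0 0 ^+ k * u 1 0 ^+ (a.-1 - k) * io (k`!%:R^-1).

Lemma vecZ a c u k : (k < a)%N -> vec a (c *: u) k = c ^+ a.-1 * vec a u k.
Proof.
move=> ka; rewrite /vec !scalemxE !exprMn.
have -> : c ^+ a.-1 = c ^+ k * c ^+ (a.-1 - k) by rewrite -exprD subnKC //; lia.
ring.
Qed.

Lemma factS_inv k : io ((k.+1)`!%:R^-1) * k.+1%:R = io (k`!%:R^-1).
Proof.
rewrite -(rmorph_nat io) -rmorphM; congr (io _).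
by rewrite factS natrM invfM mulrAC mulVf ?mul1r // pnatr_eq0.
Qed.

(** Leibniz rule: the right-hand side is the derivative of the entry [vec a u k] in the direction
    [X u]. The factor [1/k!] in [vec] matches the normalization [e u_j = u_{j+1}] of [irrep]. *)
Lemma irrep_vec a (X : 'M[K]_2) (u : 'cV[R]_2) (k : 'I_a) : \tr X = 0 ->
  let Xu := map_mx io X *m u in
  \sum_(q < a) io (irrep a X k q) * vec a u q =
  (Xu 0 0 * u 0 0 ^+ k.-1 *+ k * u 1 0 ^+ (a.-1 - k)
   + u 0 0 ^+ k * (Xu 1 0 * u 1 0 ^+ (a.-1 - k).-1 *+ (a.-1 - k))) * io (k`!%:R^-1).
Proof.
move=> trX Xu.
have X11 : X 1 1 = - X 0 0.
  move: trX; rewrite /mxtrace !big_ord_recl big_ord0 addr0 => /eqP.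
  have -> : lift ord0 ord0 = 1 :> 'I_2 by exact: val_inj.
  by rewrite addrC addr_eq0 => /eqP.
have Xu0 : Xu 0 0 = io (X 0 0) * u 0 0 + io (X 0 1) * u 1 0.
  by rewrite /Xu mulmx2E !mxE.
have Xu1 : Xu 1 0 = io (X 1 0) * u 0 0 - io (X 0 0) * u 1 0.
  by rewrite /Xu mulmx2E !mxE X11 rmorphN mulNr.
have E (q : 'I_a) : io (irrep a X k q) * vec a u q =
  (if q == k then io (X 0 0) * (k.*2%:R - a.-1%:R) * vec a u k else 0)
  + ((if (k == q.+1 :> nat) then io (X 0 1) * vec a u k.-1 else 0)
  + (if (k.+1 == q :> nat) then io (X 1 0) * (k.+1%:R * (a - k.+1)%:R) * vec a u k.+1 else 0)).
  rewrite mxE -[(k == q :> nat)]/(k == q :> 'I_a) [in RHS]eq_sym.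
  rewrite !rmorphD /= !mulrDl addrA; congr (_ + _ + _).
  - case: eqP => [->|_]; last by rewrite mulr0n mul0r rmorph0 mul0r.
    by rewrite mulr1n rmorphM rmorphB !rmorph_nat.
  - case: eqP => [->|_]; last by rewrite rmorph0 mul0r.
    by rewrite mulr1n.
  - case: eqP => [<-|_]; last by rewrite mulr0n mul0r rmorph0 mul0r.
    by rewrite mulr1n rmorphM rmorph_nat natrM.
rewrite (eq_bigr _ (fun q _ => E q)) !big_split /=.
rewrite -big_mkcond /= big_pred1_eq.
have S1 : \sum_(q < a) (if (k == q.+1 :> nat) then io (X 0 1) * vec a u k.-1 else 0)
   = io (X 0 1) * u 0 0 ^+ k.-1 * u 1 0 ^+ (a.-1 - k).+1 * (k%:R * io (k`!%:R^-1)).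
  have [k0|k0] := posnP k.
    by rewrite k0 mul0r mulr0 big1.
  have kl : (k.-1 < a)%N by apply: leq_ltn_trans (ltn_ord k); exact: leq_pred.
  rewrite -big_mkcond /= (big_pred1 (Ordinal kl)); last first.
    by move=> q /=; rewrite -val_eqE /= -{1}(prednK k0) eqSS eq_sym.
  rewrite /vec; have -> : (a.-1 - k.-1 = (a.-1 - k).+1)%N by have := ltn_ord k; lia.
  have <- : io (k`!%:R^-1) * k%:R = io (k.-1`!%:R^-1) by rewrite -{1 2}(prednK k0) factS_inv.
  by move: (io (X 0 1)) (io (k`!%:R^-1)) => x f; rewrite exprS; ring.
have S2 : \sum_(q < a) (if (k.+1 == q :> nat) then io (X 1 0) * (k.+1%:R * (a - k.+1)%:R) * vec a u k.+1 else 0)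
   = io (X 1 0) * u 0 0 ^+ k.+1 * u 1 0 ^+ (a.-1 - k).-1 * ((a.-1 - k)%:R * io (k`!%:R^-1)).
  have [ka|ka] := ltnP k.+1 a; last first.
    rewrite big1 => [|q _]; last by case: eqP => // e; have := ltn_ord q; rewrite -e ltnNge ka.
    have -> : (a.-1 - k = 0)%N by have := ltn_ord k; lia.
    by rewrite mul0r mulr0.
  rewrite -big_mkcond /= (big_pred1 (Ordinal ka)); last first.
    by move=> q /=; rewrite -val_eqE /= eq_sym.
  rewrite /vec; have -> : (a.-1 - k.+1 = (a.-1 - k).-1)%N by lia.
  have -> : (a - k.+1 = a.-1 - k)%N by lia.
  rewrite -(factS_inv k).
  by move: (io (X 1 0)) (io ((k.+1)`!%:R^-1)) => x f; ring.
rewrite S1 S2 /vec Xu0 Xu1.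
move: (io (X 0 0)) (io (X 0 1)) (io (X 1 0)) (io (k`!%:R^-1)) => x00 x01 x10 f.
have -> : a.-1%:R = k%:R + (a.-1 - k)%:R :> R.
  by rewrite -natrD; congr (_%:R); have := ltn_ord k; lia.
rewrite -muln2 natrM; move: (a.-1 - k)%N => b; move: (nat_of_ord k) => j.
move: (u 0 0) (u 1 0) => s t.
case: b => [|b]; case: j => [|j]; rewrite ?expr0 ?expr1 ?exprS /=; ring.
Qed.

End Veronese.

Lemma deriv_prod_seq (R : comNzRingType) (I : eqType) (r : seq I) (F : I -> {poly R}) :
  uniq r ->
  (\prod_(i <- r) F i)^`() = \sum_(i <- r) (F i)^`() * \prod_(j <- r | j != i) F j.
Proof.
elim: r => [|x r IH] /=; first by rewrite !big_nil derivC.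
move=> /andP[xr ur]; rewrite !big_cons derivM eqxx IH //=; congr (_ + _).
  congr (_ * _); rewrite big_seq [RHS]big_seq_cond; apply: eq_bigl => j.
  by case: eqVneq => [->|]; rewrite ?andbT //= ?andbF; apply/negbTE.
rewrite mulr_sumr; apply: eq_big_seq => i ir.
rewrite big_cons; case: eqVneq => [e|_]; first by rewrite e ir in xr.
by rewrite mulrCA.
Qed.

Lemma sqr0_trace0 (K : fieldType) (X : 'M[K]_2) : X *m X = 0 -> \tr X = 0.
Proof.
move=> X2; rewrite /mxtrace !big_ord_recl big_ord0 addr0.
have -> : lift ord0 ord0 = 1 :> 'I_2 by exact: val_inj.
have e i j : X i 0 * X 0 j + X i 1 * X 1 j = 0 by rewrite -mulmx2E X2 mxE.
have [t0|t0] := eqVneq (X 0 0 + X 1 1) 0; first exact: t0.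
have e01 : X 0 1 = 0.
  apply: (mulIf t0); rewrite mul0r -[RHS](e 0 1); ring.
have := e 0 0; have := e 1 1; rewrite e01 !(mul0r, mulr0) addr0 add0r => /eqP.
rewrite mulf_eq0 orbb => /eqP -> /eqP; rewrite mulf_eq0 orbb => /eqP ->.
by rewrite addr0.
Qed.

Section Tensor.
Variables (K : numClosedFieldType) (n : nat) (a : 'I_n -> nat).

Definition upd (m : midx a) (i : 'I_n) (q : 'I_(a i)) : midx a :=
  [ffun l => dfwith m q l].

Lemma upd_in m i (q : 'I_(a i)) : upd m q i = q.
Proof. by rewrite ffunE dfwith_in. Qed.

Lemma upd_out m i (q : 'I_(a i)) j : i != j -> upd m q j = m j.
Proof. by move=> ij; rewrite ffunE dfwith_out. Qed.

Section OverRing.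
Variables (R : comNzRingType) (io : {rmorphism K -> R}).
Implicit Types (u : 'I_n -> 'cV[R]_2) (X : 'M[K]_2) (th : 'I_n -> R) (V : midx a -> R).

Definition vt u (m : midx a) : R := \prod_i vec io (a i) (u i) (m i).

(** The action of a current over [R], where [th i] is the value of its scalar function at the i-th
    point; [th i = zt i ^+ j] is the case of [t^j] with the points moved to [s z_i]. *)
Definition xa X th V (m : midx a) : R :=
  \sum_i th i * \sum_(q < a i) io (irrep (a i) X (m i) q) * V (upd m q).

Lemma vtZ (c : 'I_n -> R) u m :
  vt (fun i => c i *: u i) m = (\prod_i c i ^+ (a i).-1) * vt u m.
Proof. by rewrite /vt -big_split; apply: eq_bigr => i _; rewrite vecZ. Qed.

Lemma xa_iterZ X th V k m (c : R) :
  iter k (xa X (fun i => c * th i)) V m = c ^+ k * iter k (xa X th) V m.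
Proof.
elim: k m => [|k IH] m; first by rewrite expr0 mul1r.
rewrite !iterS {1 3}/xa mulr_sumr; apply: eq_bigr => i _.
rewrite exprS -!mulrA; congr (c * _); rewrite mulrCA; congr (_ * _).
rewrite mulr_sumr; apply: eq_bigr => q _.
by rewrite IH mulrCA.
Qed.

End OverRing.

Lemma map_vec (R R' : comNzRingType) (io : {rmorphism K -> R}) (io' : {rmorphism K -> R'})
    (f : {rmorphism R -> R'}) b u k : (forall x, f (io x) = io' x) ->
  f (vec io b u k) = vec io' b (map_mx f u) k.
Proof. by move=> fio; rewrite /vec !rmorphM !rmorphXn fio !mxE. Qed.

Lemma map_vt (R R' : comNzRingType) (io : {rmorphism K -> R}) (io' : {rmorphism K -> R'})
    (f : {rmorphism R -> R'}) u m : (forall x, f (io x) = io' x) ->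
  f (vt io u m) = vt io' (fun i => map_mx f (u i)) m.
Proof.
by move=> fio; rewrite rmorph_prod; apply: eq_bigr => i _; rewrite (map_vec _ _ _ fio).
Qed.

Section Exponential.
Variables (R : comNzRingType) (io : {rmorphism K -> R}).
Variables (u : 'I_n -> 'cV[R]_2) (X : 'M[K]_2) (th : 'I_n -> R).
Hypothesis X2 : X *m X = 0.

Let iop : {rmorphism K -> {poly R}} := polyC \o io.
(** The variable ['X] is time: since [X *m X = 0], the one-parameter group of the current moves each
    [u i] linearly in time. *)
Let up i : 'cV[{poly R}]_2 :=
  map_mx polyC (u i) + ('X * (th i)%:P) *: map_mx polyC (map_mx io X *m u i).
Let Phi : midx a -> {poly R} := vt iop up.

Let Phi_deriv m : (Phi m)^`() = xa iop X (fun i => (th i)%:P) Phi m.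
Proof.
rewrite /Phi /vt deriv_prod_seq ?index_enum_uniq // /xa; apply: eq_bigr => i _.
have -> : \sum_(q < a i) iop (irrep (a i) X (m i) q) *
    (\prod_j vec iop (a j) (up j) (upd m q j))
  = (\sum_(q < a i) iop (irrep (a i) X (m i) q) * vec iop (a i) (up i) q) *
    \prod_(j | j != i) vec iop (a j) (up j) (m j).
  rewrite mulr_suml; apply: eq_bigr => q _; rewrite (bigD1 i) //= upd_in mulrA.
  by congr (_ * _); apply: eq_bigr => j ji; rewrite upd_out // eq_sym.
rewrite irrep_vec ?sqr0_trace0 // mulrA; congr (_ * _).
have Xup : map_mx iop X *m up i = map_mx polyC (map_mx io X *m u i).
  rewrite /up mulmxDr -scalemxAr /iop map_mx_comp -!map_mxM mulmxA -map_mxM X2.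
  by rewrite map_mx0 mul0mx map_mx0 scaler0 addr0.
have dup j : (up i j 0)^`() = (th i)%:P * (map_mx iop X *m up i) j 0.
  rewrite Xup mxE derivD mxE derivC add0r mxE derivM derivM derivX derivC.
  by rewrite [in X in X^`()]mxE derivC mul1r !mulr0 !addr0.
rewrite /vec derivM derivM !deriv_exp derivC mulr0 addr0 !dup mulrA; congr (_ * _).
move: (up i 0 0) (up i 1 0) ((_ *m up i) 0 0) ((_ *m up i) 1 0) (th i)%:P => A B C D E.
by move: ((a i).-1 - m i)%N => b; ring.
Qed.

Let Phi_coefS m k : (Phi m)`_k.+1 *+ k.+1 = xa io X th (fun m => (Phi m)`_k) m.
Proof.
rewrite -coef_deriv Phi_deriv /xa coef_sum; apply: eq_bigr => i _.
rewrite coefCM coef_sum; congr (_ * _); apply: eq_bigr => q _.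
by rewrite coefCM.
Qed.

Let Phi0 m : (Phi m)`_0 = vt io u m.
Proof.
rewrite -horner_coef0 -[LHS]/(horner_eval 0 _) (map_vt (io' := io)) => [|x]; last first.
  by rewrite /= /horner_eval hornerC.
congr (vt _ _ m); apply: functional_extensionality_dep => i.
by apply/matrixP => j k; rewrite !mxE /= /horner_eval !hornerE.
Qed.

Let iter_Phi k : iter k (xa io X th) (vt io u) = fun m => (Phi m)`_k *+ k`!.
Proof.
apply: functional_extensionality_dep; elim: k => [|k IH] m; first by rewrite Phi0.
rewrite iterS factS mulrnA Phi_coefS (functional_extensionality_dep IH).
rewrite /xa -sumrMnl; apply: eq_bigr => i _; rewrite -mulrnAr -sumrMnl.
by congr (_ * _); apply: eq_bigr => q _; rewrite mulrnAr.
Qed.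

Let size_Phi m : (size (Phi m) <= (\sum_i (a i).-1).+1)%N.
Proof.
have sup i j : (size (up i j 0%R) <= 2)%N.
  rewrite !mxE (leq_trans (size_polyD _ _)) // geq_max.
  rewrite (leq_trans (size_polyC_leq1 _)) //=.
  rewrite -mulrA -polyCM mulrC (leq_trans (size_polyMleq _ _)) // size_polyX.
  by rewrite addn2 /= ltnS size_polyC_leq1.
have sexp i j k : (size (up i j 0%R ^+ k)%R <= k.+1)%N.
  rewrite (leq_trans (size_poly_exp_leq _ _)) // ltnS.
  by rewrite -[leqRHS]mul1n leq_mul2r; apply/orP; right; have := sup i j; case: size.
have svec i : (size (vec iop (a i) (up i) (m i)) <= (a i).-1.+1)%N.
  have leM (p q r : {poly R}) x y : (size p <= x.+1)%N -> (size q <= y.+1)%N ->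
      (size r <= 1)%N -> (size (p * q * r)%R <= (x + y).+1)%N.
    have := size_polyMleq (p * q) r; have := size_polyMleq p q; lia.
  have -> : (a i).-1 = (m i + ((a i).-1 - m i))%N by have := ltn_ord (m i); lia.
  by apply: leM; rewrite ?sexp //= ?size_polyC_leq1 // addKn.
rewrite (leq_trans (size_poly_prod_leq _ _)) //.
have : (\sum_i size (vec iop (a i) (up i) (m i)) <= \sum_(i < n) (a i).-1.+1)%N.
  by apply: leq_sum => i _; exact: svec.
have -> : (\sum_(i < n) (a i).-1.+1 = \sum_(i < n) (a i).-1 + n)%N.
  have -> : (\sum_(i < n) (a i).-1 + n = \sum_(i < n) (a i).-1 + \sum_(i < n) 1)%N.
    by rewrite sum1_card card_ord.
  rewrite -big_split /=.
  by apply: eq_bigr => i _; rewrite addn1.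
move: (\sum_i size _)%N (\sum_i (a i).-1)%N => A B.
by rewrite (@eq_card _ _ 'I_n) // card_ord; lia.
Qed.

(** [Phi] solves the linear differential equation of the current ([Phi_deriv]), so its k-th
    coefficient is the k-th iterate divided by [k!]. Evaluation at time 1 gives the exponential, and
    the degree of [Phi] bounds the number of terms. *)
Lemma vt_exp N m : (\sum_i (a i).-1 < N)%N ->
  vt io (fun i => u i + th i *: (map_mx io X *m u i)) m =
  \sum_(k < N) io (k`!%:R^-1) * iter k (xa io X th) (vt io u) m.
Proof.
move=> hN; transitivity (Phi m).[1].
  rewrite -[RHS]/(horner_eval 1 _) (map_vt (io' := io)) => [|x]; last first.
    by rewrite /= /horner_eval hornerC.
  congr (vt _ _ m); apply: functional_extensionality_dep => i.
  apply/matrixP => j k; rewrite !mxE /= /horner_eval !hornerE; congr (_ + _ * _).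
rewrite (@horner_coef_wide _ N) => [|]; last exact: leq_trans (size_Phi m) hN.
apply: eq_bigr => k _; rewrite expr1n mulr1 iter_Phi.
rewrite mulrnAr -mulrnAl -rmorphMn -mulr_natr mulVf ?rmorph1 ?mul1r //.
by rewrite pnatr_eq0 -lt0n fact_gt0.
Qed.

End Exponential.
End Tensor.

Lemma vspan_sub (K : numClosedFieldType) (V : vectType K) (S : set V) (U : {vspace V}) v :
  (forall w, S w -> w \in U) -> v \in vspan S -> v \in U.
Proof. by move=> SU vS; apply: (subvP ((vspanP S).2 U SU)). Qed.

Lemma mem_vspan (K : numClosedFieldType) (V : vectType K) (S : set V) v :
  S v -> v \in vspan S.
Proof. exact: (vspanP S).1. Qed.

(** * The Rees module and its reduction at s = 0 *)

Section Filtration.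
Variables (K : numClosedFieldType) (n : nat) (a : 'I_n -> nat) (z : 'I_n -> K).
Local Notation tens := (tens K a).
Local Notation gtens := (gtens K a).
Local Notation Fil := (Fil a z).
Local Notation tact := (@tact K n a z).
Local Notation cls := (cls a z).

Lemma tact_is_linear x j : linear (tact x j : tens -> tens).
Proof.
move=> c u v; apply/ffunP => m; rewrite !ffunE scaler_sumr -big_split.
apply: eq_bigr => i _ /=; rewrite -[X in _ = X + _]/(c * _) mulrCA -mulrDr; congr (_ * _).
rewrite mulr_sumr -big_split; apply: eq_bigr => q _ /=.
by rewrite !ffunE -[_ *: _]/(c * _); ring.
Qed.
HB.instance Definition _ x j := GRing.isLinear.Build K tens tens _ (tact x j) (tact_is_linear x j).

Lemma word_Fil d k v : (d <= k)%N -> word z d v -> v \in Fil k.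
Proof. by move=> dk wv; apply: mem_vspan; exists d. Qed.

Lemma Fil_mono d k v : (d <= k)%N -> v \in Fil d -> v \in Fil k.
Proof.
move=> dk; apply: vspan_sub => w [e ed we]; apply: word_Fil we.
exact: leq_trans ed dk.
Qed.

Lemma tact_Fil x j d v : \tr x = 0 -> v \in Fil d -> tact x j v \in Fil (j + d).
Proof.
move=> tx vd.
have : v \in (linfun (tact x j) @^-1: Fil (j + d))%VS.
  apply: vspan_sub vd => w [e ed we]; rewrite -memv_preim lfunE /=.
  apply: word_Fil (word_cons _ tx we); by rewrite leq_add2l.
by rewrite -memv_preim lfunE.
Qed.

Lemma cls_pred d v : v \in Fil_pred a z d -> cls d v = 0.
Proof.
move=> vV; have vUV : v \in (Fil d :\: Fil_pred a z d + Fil_pred a z d)%VS.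
  by apply: subvP vV; exact: addvSr.
have := daddv_pi_add (capv_diff _ _) vUV.
rewrite (@daddv_pi_id _ _ (Fil_pred a z d)) //; last by rewrite capvC capv_diff.
by move=> /(canRL (addrK _)); rewrite subrr.
Qed.

Lemma sub_cls d v : v \in Fil d -> v - cls d v \in Fil_pred a z d.
Proof.
move=> vd; have vUV : v \in (Fil d + Fil_pred a z d)%VS.
  by apply: subvP vd; exact: addvSl.
have e := addv_pi1_pi2 vUV.
have -> : v - cls d v = addv_pi2 (Fil d) (Fil_pred a z d) v.
  by rewrite -[X in X - _]e addrAC subrr add0r.
exact: memv_pi.
Qed.

Lemma Fil_predE d k v : (k < d)%N -> v \in Fil k -> v \in Fil_pred a z d.
Proof. by case: d => // d; rewrite ltnS; exact: Fil_mono. Qed.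

Lemma cls_gr d v : cls d v \in gr a z d.
Proof. exact: memv_pi. Qed.

Definition coefV (V : midx a -> {poly K}) (d : nat) : tens :=
  [ffun m => (V m)`_d].

(* V = \sum_d V_d s^d, with s = 'X, lies in the Rees module \bigoplus_d F_d s^d. *)
Definition rees (V : midx a -> {poly K}) : Prop := forall d, coefV V d \in Fil d.

(** On the Rees module this is reduction modulo [s], with the associated graded space as target. *)
Definition Cls (V : midx a -> {poly K}) : gtens :=
  [ffun d : 'I_(degbound a) => cls d (coefV V d)].

Definition zt (i : 'I_n) : {poly K} := (z i)%:P * 'X.

Lemma coefV_sum (I : Type) (r : seq I) (P : pred I) (V : I -> midx a -> {poly K}) d :
  coefV (fun m => \sum_(i <- r | P i) V i m) d = \sum_(i <- r | P i) coefV (V i) d.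
Proof. by apply/ffunP => m; rewrite sum_ffunE !ffunE coef_sum; apply: eq_bigr => i _; rewrite ffunE. Qed.

Lemma coefVZ c V d : coefV (fun m => c%:P * V m) d = c *: coefV V d.
Proof. by apply/ffunP => m; rewrite !ffunE coefCM. Qed.

Lemma CovV_ztX X j V d :
  coefV (xa polyC X (fun i => zt i ^+ j) V) d =
  if (d < j)%N then 0 else tact X j (coefV V (d - j)).
Proof.
apply/ffunP => m; rewrite ffunE /xa coef_sum.
have E i : (zt i ^+ j * \sum_(q < a i) (irrep (a i) X (m i) q)%:P * V (upd m q))`_d =
   if (d < j)%N then 0 else z i ^+ j * \sum_(q < a i) irrep (a i) X (m i) q * (V (upd m q))`_(d - j).
  rewrite /zt exprMn -polyC_exp -mulrA coefCM coefXnM; case: ifP => _; first by rewrite mulr0.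
  by rewrite coef_sum; congr (_ * _); apply: eq_bigr => q _; rewrite coefCM.
rewrite (eq_bigr _ (fun i _ => E i)); case: ifP => _; first by rewrite big1 // ffunE.
rewrite ffunE; apply: eq_bigr => i _; congr (_ * _); apply: eq_bigr => q _.
by rewrite ffunE.
Qed.

Lemma xa_sum (I : Type) (r : seq I) (P : pred I) X (th : I -> 'I_n -> {poly K}) (V : midx a -> {poly K}) m :
  xa polyC X (fun i => \sum_(j <- r | P j) th j i) V m =
  \sum_(j <- r | P j) xa polyC X (th j) V m.
Proof.
rewrite /xa exchange_big; apply: eq_bigr => i _ /=.
by rewrite mulr_suml.
Qed.

Lemma xa_mulp X (p : {poly K}) th (V : midx a -> {poly K}) m :
  xa polyC X (fun i => p * th i) V m = p * xa polyC X th V m.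
Proof. by rewrite /xa mulr_sumr; apply: eq_bigr => i _; rewrite mulrA. Qed.

Lemma rees_sum (I : Type) (r : seq I) (P : pred I) (V : I -> midx a -> {poly K}) :
  (forall i, P i -> rees (V i)) -> rees (fun m => \sum_(i <- r | P i) V i m).
Proof. by move=> rV d; rewrite coefV_sum; apply: rpred_sum => i /rV. Qed.

Lemma rees_mulp (p : {poly K}) V : rees V -> rees (fun m => p * V m).
Proof.
move=> rV d.
have -> : coefV (fun m => p * V m) d = \sum_(i < d.+1) p`_i *: coefV V (d - i).
  by apply/ffunP => m; rewrite sum_ffunE !ffunE coefM; apply: eq_bigr => i _; rewrite !ffunE.
apply: rpred_sum => i _; apply: rpredZ; apply: Fil_mono (rV _); exact: leq_subr.
Qed.

Lemma rees_zt X j V : \tr X = 0 -> rees V -> rees (xa polyC X (fun i => zt i ^+ j) V).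
Proof.
move=> tX rV d; rewrite CovV_ztX; case: ltnP => jd; first exact: mem0v.
by rewrite -{2}(subnKC jd); exact: tact_Fil.
Qed.

Lemma rees_xa X (P : {poly {poly K}}) V : \tr X = 0 -> rees V ->
  rees (xa polyC X (fun i => P.[zt i]) V).
Proof.
move=> tX rV.
have -> : (fun i => P.[zt i]) = fun i => \sum_(j < size P) P`_j * zt i ^+ j.
  by apply: functional_extensionality_dep => i; rewrite horner_coef.
have -> : xa polyC X (fun i => \sum_(j < size P) P`_j * zt i ^+ j) V
   = fun m => \sum_(j < size P) P`_j * xa polyC X (fun i => zt i ^+ j) V m.
  apply: functional_extensionality_dep => m; rewrite xa_sum; apply: eq_bigr => j _.
  exact: xa_mulp.
by apply: rees_sum => j _; apply/rees_mulp/rees_zt.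
Qed.

Lemma Cls_sum (I : Type) (r : seq I) (P : pred I) (V : I -> midx a -> {poly K}) :
  Cls (fun m => \sum_(i <- r | P i) V i m) = \sum_(i <- r | P i) Cls (V i).
Proof.
apply/ffunP => d; rewrite sum_ffunE !ffunE coefV_sum linear_sum.
by apply: eq_bigr => i _; rewrite ffunE.
Qed.

Lemma ClsZ c V : Cls (fun m => c%:P * V m) = c *: Cls V.
Proof. by apply/ffunP => d; rewrite !ffunE coefVZ linearZ. Qed.

Lemma gact_Cls X j V : \tr X = 0 -> rees V ->
  gact z X j (Cls V) = Cls (xa polyC X (fun i => zt i ^+ j) V).
Proof.
move=> tX rV; apply/ffunP => d; rewrite !ffunE CovV_ztX.
(* The class and the coefficient differ by an element of [F_(s-1)], which [tact X j] sends into
   [F_(d-1)], where [cls d] vanishes. *)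
have E (s : 'I_(degbound a)) : (j + s == d)%N ->
    cls d (tact X j (Cls V s)) = cls d (tact X j (coefV V s)).
  move=> /eqP e; rewrite ffunE; apply/eqP; rewrite -subr_eq0 -opprB oppr_eq0 -!linearB /=.
  apply/eqP/cls_pred; have := sub_cls (rV s).
  case es: (val s) e => [|s'] e /=.
    by rewrite memv0 => /eqP ->; rewrite linear0 mem0v.
  move=> h; apply: (@Fil_predE _ (j + s')); first by rewrite -e addnS.
  by apply: tact_Fil.
rewrite (eq_bigr _ E); case: ltnP => jd.
  rewrite big1 ?linear0 // => s /eqP e; have := leq_addr s j; rewrite e.
  by rewrite leqNgt jd.
have sd : (d - j < degbound a)%N by apply: leq_ltn_trans (ltn_ord d); exact: leq_subr.
rewrite (big_pred1 (Ordinal sd)) // => s /=.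
by rewrite -val_eqE /=; apply/eqP/eqP; lia.
Qed.

Definition curr (p : {poly %/ ('X^n : {poly K})}) (i : 'I_n) : {poly K} :=
  \sum_(j < n) (p`_j)%:P * zt i ^+ j.

Lemma gact_currents_Cls X p V : \tr X = 0 -> rees V ->
  gact_currents z X p (Cls V) = Cls (xa polyC X (curr p) V).
Proof.
move=> tX rV.
have -> : xa polyC X (curr p) V
   = fun m => \sum_(j < n) (p`_j)%:P * xa polyC X (fun i => zt i ^+ j) V m.
  apply: functional_extensionality_dep => m; rewrite /curr xa_sum.
  by apply: eq_bigr => j _; exact: xa_mulp.
rewrite Cls_sum; apply: eq_bigr => j _.
by rewrite ClsZ gact_Cls.
Qed.

Lemma currE p i : curr p i = (\poly_(j < n) (p`_j)%:P).[zt i].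
Proof. by rewrite horner_poly. Qed.

Lemma rees_curr X p V : \tr X = 0 -> rees V -> rees (xa polyC X (curr p) V).
Proof.
move=> tX rV; have -> : curr p = fun i => (\poly_(j < n) (p`_j)%:P).[zt i].
  by apply: functional_extensionality_dep => i; exact: currE.
exact: rees_xa.
Qed.

Lemma iter_gact_Cls X p V k : \tr X = 0 -> rees V ->
  rees (iter k (xa polyC X (curr p)) V) /\
  iter k (gact_currents z X p) (Cls V) = Cls (iter k (xa polyC X (curr p)) V).
Proof.
move=> tX rV; elim: k => [|k [IH1 IH2]] //=; split; first exact: rees_curr.
by rewrite IH2 gact_currents_Cls.
Qed.

Hypothesis a_gt0 : forall i, (0 < a i)%N.

(** Shows that the truncation in [nilexp] keeps every term of the exponential of a nilpotent
    current, by the bound in [vt_exp]. *)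
Lemma dim_gtens : (\sum_i (a i).-1 <= \dim {:gtens})%N.
Proof.
have dT : \dim {:gtens} = (degbound a * #|midx a|)%N.
  by rewrite dimvf /dim /= card_ord /dim /= muln1.
have m0 : (0 < #|midx a|)%N.
  apply/card_gt0P; exists [ffun i => Ordinal (a_gt0 i)]; by [].
(* For [n = 1] the degree bound is 1 and the factor [#|midx a|] gives the estimate; for [n >= 2] the
   factor [degbound a] is large enough. *)
rewrite dT /degbound; case: n a a_gt0 m0 => [|[|k]] a' a0' m0.
- by rewrite big_ord0.
- rewrite big_ord1 mul0n mul1n.
  have -> : #|midx a'| = a' ord0.
    by rewrite card_dep_ffun; rewrite /image_mem enum_ordSl /= enum_ord0 /= muln1 card_ord.
  exact: leq_pred.
rewrite (leq_trans _ (leq_pmulr _ m0)) //=; move: (\sum_i _)%N => A; lia.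
Qed.

Lemma nilexp_Cls X p (u : 'I_n -> 'cV[{poly K}]_2) : X *m X = 0 -> rees (vt polyC u) ->
  nilexp (gact_currents z X p) (Cls (vt polyC u)) =
  Cls (vt polyC (fun i => u i + curr p i *: (map_mx polyC X *m u i))).
Proof.
move=> X2 rV; have tX := sqr0_trace0 X2.
have -> : vt polyC (fun i => u i + curr p i *: (map_mx polyC X *m u i)) =
    fun m : midx a => \sum_(k < (\dim {:gtens}).+1) (k`!%:R^-1)%:P * iter k (xa polyC X (curr p)) (vt polyC u) m.
  apply: functional_extensionality_dep => m.
  by rewrite (@vt_exp _ _ _ _ _ _ _ _ X2 (\dim {:gtens}).+1) // ltnS dim_gtens.
rewrite Cls_sum; apply: eq_bigr => k _.
by rewrite ClsZ (iter_gact_Cls p k tX rV).2.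
Qed.

End Filtration.

Lemma sv_map (R R' : nzRingType) (f : {rmorphism R -> R'}) n (q : seq R) (i : 'I_n) :
  sv (map f q) i = f (sv q i).
Proof.
rewrite /sv; have [iq|iq] := ltnP i (size q); first by rewrite (nth_map 0).
by rewrite !nth_default ?size_map // rmorph0.
Qed.

(** * The universal point of a chart, and transfer between charts *)

Section Universal.
Variables (K : numClosedFieldType) (n : nat) (a : 'I_n -> nat) (z : 'I_n -> K).

(* Step j of the chain corresponds to the tensor factor n-1-j, so that the a_i
   decrease along the chain. *)
Definition zz (j : nat) : K := oapp z 0 (insub (n.-1 - j)%N).

Lemma zz_rev i : zz (rev_ord i) = z i.
Proof.
rewrite /zz; case: insubP => [j _ e|]; last by rewrite /= -ltnNge; have := ltn_ord i; lia.
by congr z; apply: val_inj; rewrite e /=; have := ltn_ord i; lia.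
Qed.

Local Notation U := {poly {mpoly K[n]}}.
Definition iu : {rmorphism K -> U} := polyC \o @mpolyC n K.

Section Chart.
Variables (R : comNzRingType) (io : {rmorphism K -> R}) (s : R).

Definition chartv (l : seq (bool * R)) (i : 'I_n) : 'cV[R]_2 :=
  wv l (fun j => io (zz j) * s) (rev_ord i).

Definition chartV (l : seq (bool * R)) : midx a -> R := vt io (chartv l).

End Chart.

(* The universal point of the chart eps. *)
Definition Vu (eps : seq bool) : midx a -> U :=
  chartV iu 'X (zip eps [seq ('X_j)%:P | j <- enum 'I_n]).

Section Evaluation.
Variables (R : comNzRingType) (io : {rmorphism K -> R}) (s : R).

Definition uev (Q : seq R) : {rmorphism U -> R} :=
  horner_eval s \o map_poly (mmap io (sv Q : 'I_n -> R)).

Lemma uev_C Q p : uev Q p%:P = mmap io (sv Q) p.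
Proof. by rewrite /= map_polyC /horner_eval hornerC. Qed.

Lemma uev_iu Q x : uev Q (iu x) = io x.
Proof. by rewrite uev_C /= mmapC. Qed.

Lemma uev_X Q : uev Q 'X = s.
Proof. by rewrite /= map_polyX /horner_eval hornerX. Qed.

Lemma uev_var Q j : uev Q ('X_j)%:P = sv Q j.
Proof. by rewrite uev_C mmapX mmap1U. Qed.

Lemma map_sv (Q : seq R) : size Q = n -> [seq (sv Q : 'I_n -> R) j | j <- enum 'I_n] = Q.
Proof.
move=> sQ; apply: (@eq_from_nth _ 0); first by rewrite size_map size_enum_ord.
move=> i; rewrite size_map size_enum_ord => iN.
by rewrite (nth_map (Ordinal iN)) ?size_enum_ord // /sv nth_enum_ord.
Qed.

Lemma uev_Vu Q eps m : size Q = n -> uev Q (Vu eps m) = chartV io s (zip eps Q) m.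
Proof.
move=> sQ; rewrite /Vu /chartV (map_vt (io' := io)) => [|x]; last exact: uev_iu.
congr (vt _ _ m); apply: functional_extensionality_dep => i.
rewrite /chartv (map_wv (uev Q)); have -> : map (mapx (uev Q)) (zip eps [seq ('X_j)%:P | j <- enum 'I_n])
   = zip eps Q.
  rewrite -[in RHS](map_sv sQ); elim: eps (enum 'I_n) => [|e eps IH] [|j r] //=.
  by rewrite IH /mapx /= -uev_var.
apply: wv_ext => j /=; rewrite -[LHS]/(uev Q (iu (zz j) * 'X)).
by rewrite rmorphM uev_iu uev_X.
Qed.

Lemma uev_map_mpolyC Q (p : {poly K}) : uev Q (map_poly (@mpolyC n K) p) = (map_poly io p).[s].
Proof.
rewrite /= /horner_eval -map_poly_comp; congr (_.[s]).
by apply: eq_map_poly => x /=; rewrite mmapC.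
Qed.

End Evaluation.

Lemma uev_polyE (q : seq K) (P : U) :
  uev polyC 'X (map polyC q) P = map_poly (meval (sv q)) P.
Proof.
have e p : mmap (@polyC K) (sv (map polyC q) : 'I_n -> _) p = (p.@[sv q])%:P.
  rewrite /meval /mmap rmorph_sum; apply: eq_bigr => m _.
  rewrite rmorphM /=; congr (_ * _); rewrite rmorph_prod; apply: eq_bigr => i _.
  by rewrite (sv_map polyC) rmorphXn.
rewrite /= /horner_eval (eq_map_poly e) (map_poly_comp polyC) -[RHS]comp_polyXr.
by rewrite /comp_poly.
Qed.

(** Once [P] is divisible by ['X^d], the coefficient of degree [d] depends on [c] and [Q] only
    through their residues. Lifted chains, whose coordinates are controlled only modulo [s], thereby
    become comparable. *)
Lemma coef_uev_trunc (F : fieldType) (io : {rmorphism K -> F}) N (Q : seq (trunc F N))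
    (c : trunc F N) (P : U) d :
  (d < N.+2)%N -> (forall r, (r < d)%N -> P`_r = 0) ->
  (forall r, (r < d)%N ->
    tcoef (c * uev (to_trunc F N \o (polyC \o io)) (to_trunc F N 'X) Q P) r = 0) /\
  tcoef (c * uev (to_trunc F N \o (polyC \o io)) (to_trunc F N 'X) Q P) d =
    tres c * mmap io (sv (map (@tres F N) Q)) P`_d.
Proof.
move=> dN P0; set ioO : {rmorphism K -> trunc F N} := to_trunc F N \o (polyC \o io).
have -> : P = drop_poly d P * 'X^d.
  rewrite -{1}(poly_take_drop d P) (_ : take_poly d P = 0) ?add0r //.
  by apply/polyP => i; rewrite coef_take_poly coef0; case: ltnP => // /P0.
set P' := drop_poly d P.
have E r : (r < N.+2)%N -> tcoef (c * uev ioO (to_trunc F N 'X) Q (P' * 'X^d)) r =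
    if (r < d)%N then 0 else tcoef (c * uev ioO (to_trunc F N 'X) Q P') (r - d).
  move=> rN; rewrite -(tcoefXM d _ rN) mulrCA; congr (tcoef (c * _)).
  by rewrite rmorphM rmorphXn uev_X mulrC -rmorphXn.
split=> [r rd|]; first by rewrite E ?rd // (ltn_trans rd).
rewrite E // ltnn subnn -[LHS]/(tres _) rmorphM; congr (_ * _).
rewrite coefMXn ltnn subnn.
have tX : tres (to_trunc F N 'X) = 0 by rewrite tres_to_trunc coefX.
rewrite -[uev _ _ _ _]/((map_poly (mmap ioO (sv Q)) P').[to_trunc F N 'X]).
rewrite -(horner_map (@tres F N)) /= tX.
rewrite horner_coef0 !coef_map /= /mmap rmorph_sum; apply: eq_bigr => m _.
rewrite rmorphM; congr (_ * _); first by rewrite [LHS]tres_to_trunc coefC.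
rewrite rmorph_prod; apply: eq_bigr => i _; rewrite rmorphXn.
by congr (_ ^+ _); rewrite (sv_map (@tres F N)).
Qed.

End Universal.

Section Compare.
Variables (K : numClosedFieldType) (n : nat) (a : 'I_n -> nat) (z : 'I_n -> K).

(** The equivalence lifted to the points [s z_i]. The scalars of [eqv_lift] enter [C] with the
    exponents [a_i - 1], the i-th factor belonging to step [rev_ord i]. *)
Lemma compare (F : fieldType) (io : {rmorphism K -> F}) N h l l' :
  \det h = 1 -> eqv h l l' -> size l = n ->
  let ioO : {rmorphism K -> trunc F N} := to_trunc F N \o (polyC \o io) in
  let s := to_trunc F N 'X in
  let emb : {rmorphism F -> trunc F N} := to_trunc F N \o polyC in
  exists Q' C, [/\ size Q' = n, map (@tres F N) Q' = map snd l', tres C != 0 &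
    forall m : midx a,
      vt ioO (fun i => ev (ioO (z i) * s) (map_mx (map_poly emb) h) *m
                       chartv z ioO s (map (mapx emb) l) i) m
      = C * uev n ioO s Q' (Vu z (map fst l') m)].
Proof.
move=> dh e sl ioO s emb.
have tX : tres s = 0 by rewrite tres_to_trunc coefX.
have temb x : tres (emb x) = x by rewrite [LHS]tres_to_trunc coefC.
pose H := map_mx (map_poly emb) h.
have rH : map_mx (map_poly (@tres F N)) H = h.
  rewrite /H -map_mx_comp; apply/matrixP => i j; rewrite mxE /=.
  by rewrite -map_poly_comp; apply/polyP => k; rewrite coef_map /= [LHS]temb.
have dH : \det H = 1 by rewrite /H det_map_mx dh rmorph1.
have rz j : tres (ioO (zz z j) * s) = 0 by rewrite rmorphM [X in _ * X]tX mulr0.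
have rL : map (mapx (@tres F N)) (map (mapx emb) l) = l.
  rewrite -map_comp -[RHS]map_id; apply: eq_map => -[b x].
  by rewrite /mapx /=; congr (_, _); rewrite [LHS]temb.
have [L' eL' [c [c0 cE]]] := eqv_lift (@tres_unit F N) e rH dH rz rL.
have sL' : size L' = n by rewrite -sl (eqv_size e) -eL' size_map.
exists (map snd L'), (\prod_(i < n) c (rev_ord i) ^+ (a i).-1); split.
- by rewrite size_map.
- by rewrite -eL' -!map_comp.
- by rewrite rmorph_prod prodf_seq_neq0; apply/allP => i _ /=; rewrite rmorphXn expf_neq0.
move=> m; rewrite uev_Vu ?size_map //.
have -> : map fst l' = map fst L' by rewrite -eL' -map_comp.
rewrite zip_unzip /chartV -vtZ; congr (vt _ _ m).
apply: functional_extensionality_dep => i.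
rewrite -(zz_rev z i) cE //.
by rewrite sl ltn_ord.
Qed.

Lemma iu_to_trunc (F : fieldType) (io : {rmorphism K -> F}) N l m :
  size l = n ->
  chartV (a := a) z (to_trunc F N \o (polyC \o io)) (to_trunc F N 'X)
     (map (mapx (to_trunc F N \o polyC)) l) m
  = uev n (to_trunc F N \o (polyC \o io)) (to_trunc F N 'X)
     (map (to_trunc F N \o polyC) (map snd l)) (Vu z (map fst l) m).
Proof.
move=> sl; rewrite uev_Vu ?size_map //; congr (chartV _ _ _ _ m).
by rewrite -[in LHS](zip_unzip l); elim: l {sl} => //= x l ->.
Qed.

End Compare.

Section Transfer.
Variables (K : numClosedFieldType) (n : nat) (a : 'I_n -> nat) (z : 'I_n -> K).
Local Notation U := {poly {mpoly K[n]}}.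
Local Notation midx := (midx a).

(* The chain l transported to the points s z_i, where s = 'X. *)
Definition Vl (l : seq (bool * K)) : midx -> {poly K} :=
  chartV z polyC 'X (map (mapx polyC) l).

Definition lam (c : midx -> {poly K}) (V : midx -> {poly K}) : {poly K} :=
  \sum_m c m * V m.

(** The values of [lam c] on a whole chart at once: the coefficients in [s] are polynomials in the
    chart coordinates. *)
Definition lamu (c : midx -> {poly K}) (eps : seq bool) : U :=
  \sum_m map_poly (@mpolyC n K) (c m) * Vu z eps m.

Lemma zip_lift (l : seq (bool * K)) :
  zip (map fst l) (map polyC (map snd l)) = map (mapx polyC) l.
Proof. by elim: l => //= x l ->. Qed.

Lemma map_polyC_hornerX (p : {poly K}) : (map_poly polyC p).['X] = p.
Proof. exact: comp_polyXr. Qed.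

Lemma lamu_eval c l : size l = n ->
  map_poly (meval (sv (map snd l))) (lamu c (map fst l)) = lam c (Vl l).
Proof.
move=> sl; rewrite -uev_polyE rmorph_sum; apply: eq_bigr => m _.
rewrite rmorphM uev_map_mpolyC map_polyC_hornerX uev_Vu ?size_map //.
by rewrite zip_lift.
Qed.

Lemma lamu_coef c l r : size l = n ->
  ((lamu c (map fst l))`_r).@[sv (map snd l)] = (lam c (Vl l))`_r.
Proof. by move=> sl; rewrite -(lamu_eval _ sl) coef_map. Qed.

Lemma lamu_coef_eq0 c eps r : size eps = n ->
  (forall q, size q = n -> (lam c (Vl (zip eps q)))`_r = 0) -> (lamu c eps)`_r = 0.
Proof.
move=> se h; apply: mpoly_vanish => v.
pose q := [seq v i | i <- enum 'I_n].
have sq : size q = n by rewrite size_map size_enum_ord.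
have := lamu_coef c (l := zip eps q) r.
rewrite -/unzip1 -/unzip2 unzip1_zip ?unzip2_zip ?size_zip ?se ?sq ?minnn // => /(_ erefl).
rewrite h // => <-; apply: meval_eq => i; rewrite /sv (nth_map i) ?size_enum_ord //.
by rewrite nth_ord_enum.
Qed.

(** The matrix [h] over [K[t]] acts on the i-th factor through its value at [t = s z_i]. *)
Definition moved h (l : seq (bool * K)) : midx -> {poly K} :=
  vt polyC (fun i => ev (zt z i) (map_mx (map_poly polyC) h) *m
                     chartv z polyC 'X (map (mapx polyC) l) i).

Lemma moved1 l : moved 1%:M l = Vl l.
Proof.
apply: functional_extensionality_dep => m; rewrite /moved /Vl /chartV.
congr (vt _ _ m); apply: functional_extensionality_dep => i.
by rewrite map_mx1 ev1 mul1mx.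
Qed.

(** [k] is the residue of the unit found by [compare]. It is the same for all [c] and [d], so the
    lowest coefficients yield proportional vectors and not just simultaneous vanishing. *)
Lemma moved_compare N h l l' : \det h = 1 -> eqv h l l' -> size l = n ->
  exists2 k : K, k != 0 & forall c d, (d < N.+2)%N ->
    (forall r, (r < d)%N -> (lamu c (map fst l'))`_r = 0) ->
    (forall r, (r < d)%N -> (lam c (moved h l))`_r = 0) /\
    (lam c (moved h l))`_d = k * (lam c (Vl l'))`_d.
Proof.
move=> dh e sl; have sl' : size l' = n by rewrite -(eqv_size e).
have [Q [C [sQ eQ C0 CE]]] := compare a z (idfun : {rmorphism K -> K}) N dh e sl.
exists (tres C) => // c d dN P0.
set ioO : {rmorphism K -> trunc K N} := to_trunc K N \o (polyC \o idfun) in CE.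
have ioE x : to_trunc K N x%:P = ioO x by [].
have E : to_trunc K N (lam c (moved h l))
       = C * uev n ioO (to_trunc K N 'X) Q (lamu c (map fst l')).
  rewrite rmorph_sum rmorph_sum mulr_sumr; apply: eq_bigr => m _.
  rewrite !rmorphM uev_map_mpolyC mulrCA -CE; congr (_ * _).
    rewrite -[in LHS](map_polyC_hornerX (c m)) -horner_map -map_poly_comp.
    by congr (_.[_]); apply: eq_map_poly.
  rewrite /moved (map_vt _ _ ioE); congr (vt _ _ m).
  apply: functional_extensionality_dep => i; rewrite map_mxM map_ev; congr (ev _ _ *m _).
  - by rewrite /zt rmorphM.
  - apply/matrixP => x y; rewrite !mxE -map_poly_comp; exact: eq_map_poly.
  rewrite /chartv (map_wv (to_trunc K N)) -map_comp.
  by apply: wv_ext => j /=; rewrite rmorphM.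
have [A B] := coef_uev_trunc (idfun : {rmorphism K -> K}) Q C dN P0.
have co r : (r < N.+2)%N -> (lam c (moved h l))`_r =
    tcoef (C * uev n ioO (to_trunc K N 'X) Q (lamu c (map fst l'))) r.
  by move=> rN; rewrite -E tcoef_to_trunc.
split=> [r rd|]; first by rewrite co ?(ltn_trans rd) //; apply: A.
rewrite co // [LHS]B; congr (_ * _); rewrite -lamu_coef // eQ; exact: esym.
Qed.

(* Vanishing of coefficients propagates from one chart to all others: it is a
   polynomial condition, and charts overlap generically. *)
Lemma transfer_u c d eps0 : size eps0 = n ->
  (forall q r, size q = n -> (r < d)%N -> (lam c (Vl (zip eps0 q)))`_r = 0) ->
  forall eps r, size eps = n -> (r < d)%N -> (lamu c eps)`_r = 0.
Proof.
move=> s0 h0 eps r se rd; apply: (generic_vanish (n := n)) => //.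
have := eqv_generic (h := 1%:M : 'M[{poly K}]_2) (det1 _ _) se s0.
apply: generic_sub => q sq [q' [sq' e]].
have [e1 e2 e3] := unzip_zip se sq; have [e1' e2' e3'] := unzip_zip s0 sq'.
have [k _ /(_ c d)] := moved_compare d (det1 _ _) e e3.
rewrite moved1 e1' => /(_ (leqW (ltnSn d)))[r' r'd|/(_ r rd)].
  by apply: lamu_coef_eq0 => // q2 sq2; exact: h0.
by rewrite -lamu_coef // e1 e2.
Qed.

Lemma transfer c d eps0 : size eps0 = n ->
  (forall q r, size q = n -> (r < d)%N -> (lam c (Vl (zip eps0 q)))`_r = 0) ->
  forall l r, size l = n -> (r < d)%N -> (lam c (Vl l))`_r = 0.
Proof.
move=> s0 h0 l r sl rd; rewrite -lamu_coef //.
by rewrite (transfer_u s0 h0) ?size_map // meval0.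
Qed.

End Transfer.

(** * The standard chart and membership in the Rees module *)

(** [q] lists the Newton coefficients of [P] at the nodes [zt]: on the standard chart all lines of
    the chain come from one polynomial. *)
Lemma wv_chart0 (R : comNzRingType) (q : seq R) zt :
  exists P : {poly R}, forall j, (j < size q)%N ->
    wv (zip (nseq (size q) false) q) zt j = base (false, P.[zt j]).
Proof.
elim: q zt => [|x q IH] zt; first by exists 0.
have [P PE] := IH (zt \o S).
exists (x%:P + ('X - (zt 0)%:P) * P) => -[|j] /= jq.
  by rewrite !hornerE subrr mul0r addr0.
rewrite PE //; have [g00 g01 g10 g11] := gmE (false, x) (zt j.+1 - zt 0).
apply: mx2P => k; rewrite [k]ord1 mulmx2E !base0E !base1E ?g00 ?g01 ?g10 ?g11 /= !hornerE.
  by rewrite addrC.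
by [].
Qed.

Lemma size_wv_chart0 (K : numFieldType) (q : seq K) (zt : nat -> {poly K}) j :
  (forall j, size (zt j) <= 2)%N -> (j < size q)%N ->
  (size (wv (zip (nseq (size q) false) (map polyC q)) zt j 0%R 0%R) <= size q)%N.
Proof.
move=> sz; elim: q zt j sz => [|x q IH] zt [|j] sz //= jq.
  by rewrite base0E /= (leq_trans (size_polyC_leq1 _)).
have [g00 g01 g10 g11] := gmE (false, x%:P) (zt j.+1 - zt 0%N).
have [P PE] := wv_chart0 (map polyC q) (zt \o S).
have w1 : wv (zip (nseq (size q) false) (map polyC q)) (zt \o S) j 1%R 0%R = 1.
  by rewrite -[in X in nseq X](size_map polyC q) PE ?size_map // base1E.
rewrite mulmx2E g00 g01 /= w1 mulr1 (leq_trans (size_polyD _ _)) // geq_max.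
rewrite (leq_trans (size_polyC_leq1 _)) // andbT.
have := IH (zt \o S) j (fun j => sz j.+1) jq.
have := size_polyMleq (zt j.+1 - zt 0%N) (wv (zip (nseq (size q) false) (map polyC q)) (zt \o S) j 0 0).
have : (size (zt j.+1 - zt 0%N)%R <= 2)%N.
  by rewrite (leq_trans (size_polyD _ _)) // size_polyN geq_max !sz.
set A := size _; set B := size _; set C := size _; lia.
Qed.

Section Separation.
Variables (K : fieldType) (I : finType).
Local Notation V := {ffun I -> K^o}.

Lemma ffun_functional (f : {linear V -> K^o}) (v : V) :
  f v = \sum_i f [ffun j => (j == i)%:R] * v i.
Proof.
have e : v = \sum_i v i *: ([ffun j => (j == i)%:R] : V).
  apply/ffunP => j; rewrite sum_ffunE (bigD1 j) //= big1 ?addr0 => [|i ij].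
    by rewrite !ffunE eqxx /=; exact: esym (mulr1 _).
  by rewrite !ffunE eq_sym (negPf ij); exact: mulr0.
rewrite {1}e linear_sum; apply: eq_bigr => i _; rewrite linearZ.
exact: mulrC.
Qed.

Lemma separate (W : {vspace V}) (v : V) : v \notin W ->
  exists c : I -> K, (forall x, x \in W -> \sum_i c i * x i = 0) /\ \sum_i c i * v i != 0.
Proof.
move=> vW; pose g (x : V) : V := x - projv W x.
have gv : g v != 0.
  by apply: contra vW; rewrite subr_eq0 => /eqP ->; exact: memv_proj.
have [i gi] : exists i, g v i != 0.
  apply: contrapT => h; case/eqP: gv; apply/ffunP => i; rewrite [RHS]ffunE.
  by apply/eqP; apply: contrapT => /negP gi; apply: h; exists i.
pose f (x : V) : K^o := g x i.
have fl : linear f.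
  move=> k x y; rewrite /f /g linearP !ffunE.
  by rewrite -![_ *: _]/(_ * _) /=; ring.
pose lf := GRing.isLinear.Build K V K^o _ f fl.
pose F : {linear V -> K^o} := HB.pack f lf.
exists (fun j => F [ffun k => (k == j)%:R]); split=> [x xW|].
  rewrite -(ffun_functional F) /= /f /g projv_id //.
  by rewrite subrr ffunE.
by rewrite -(ffun_functional F).
Qed.

End Separation.

Section Charts.
Variables (K : numClosedFieldType) (n : nat) (a : 'I_n -> nat) (z : 'I_n -> K).
Local Notation chart0 q := (zip (nseq n false) q).
Local Notation Vl := (@Vl K n a z).

Lemma lam_coef (c : midx a -> K) (V : midx a -> {poly K}) r :
  (lam (fun m => (c m)%:P) V)`_r = \sum_m c m * coefV V r m.
Proof. by rewrite coef_sum; apply: eq_bigr => m _; rewrite coefCM ffunE. Qed.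

Lemma Vl_chart0 q : size q = n -> exists P : {poly {poly K}},
  Vl (chart0 q) = vt polyC (fun i => base (false, P.[zt z i])).
Proof.
move=> sq; have [P PE] := wv_chart0 (map polyC q) (fun j => (zz z j)%:P * 'X).
exists P; rewrite /Vl /chartV; congr vt; apply: functional_extensionality_dep => i.
rewrite /chartv -zip_lift; have [-> -> _] := unzip_zip (size_nseq n false) sq.
by rewrite -{1}sq -{1}(size_map polyC q) PE ?size_map ?sq ?ltn_ord // zz_rev.
Qed.

Definition nilE : 'M[K]_2 := \matrix_(i, j) ((i == 0) && (j == 1))%:R.

Lemma vt_lowest m : vt polyC (fun _ : 'I_n => base (false, 0 : {poly K})) m = (lowest K a m)%:P.
Proof.
rewrite ffunE /vt.
case: (boolP [forall i, m i == 0%N :> nat]) => [/forallP h|/forallPn[i hi]].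
  rewrite big1 // => i _; rewrite /vec (eqP (h i)) base1E /= expr0 expr1n fact0 invr1.
  by rewrite !mul1r.
by rewrite (bigD1 i) //= /vec base0E /= expr0n (negPf hi) !mul0r.
Qed.

Lemma rees_lowest : rees z (vt polyC (fun _ : 'I_n => base (false, 0 : {poly K})) : midx a -> _).
Proof.
move=> d; have -> : coefV (vt polyC (fun _ : 'I_n => base (false, 0 : {poly K}))) d
   = (d == 0%N)%:R *: lowest K a.
  apply/ffunP => m; rewrite ffunE vt_lowest coefC [RHS]ffunE.
  by case: eqP => _; [rewrite scale1r | rewrite scale0r].
by apply/rpredZ/(@word_Fil _ _ _ _ 0%N) => //; exact: word_nil.
Qed.

Lemma base_exp (p : {poly K}) :
  base (false, p) = base (false, 0) + p *: (map_mx polyC nilE *m base (false, 0)).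
Proof.
by apply: mx2P => k; rewrite [k]ord1 [RHS]mxE scalemxE mulmx2E !base0E !base1E !mxE /=; ring.
Qed.

Lemma nilE2 : nilE *m nilE = 0.
Proof. by apply: mx2P; apply: ord2P; rewrite mulmx2E !mxE /=; ring. Qed.

(** The vectors [(P(s z_i), 1)] arise from [(0, 1)] by the exponential of [e] times [P]
    ([base_exp]). The tensor is therefore an exponential of a current applied to [lowest], and each
    term lies in the Rees module. *)
Lemma rees_chart0 q : size q = n -> rees z (Vl (chart0 q)).
Proof.
move=> sq; have [P ->] := Vl_chart0 sq.
have -> : vt polyC (fun i => base (false, P.[zt z i])) = fun m : midx a =>
    \sum_(k < (\sum_i (a i).-1).+1) (k`!%:R^-1)%:P *
      iter k (xa polyC nilE (fun i => P.[zt z i])) (vt polyC (fun _ : 'I_n => base (false, 0))) m.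
  apply: functional_extensionality_dep => m.
  rewrite -(@vt_exp _ _ _ _ _ _ _ _ nilE2) //; congr (vt _ _ m).
  by apply: functional_extensionality_dep => i; exact: base_exp.
apply: rees_sum => k _; apply: rees_mulp; elim: (val k) => [|j IH]; first exact: rees_lowest.
exact: rees_xa (sqr0_trace0 nilE2) IH.
Qed.

(** If the k-th coefficient were outside [F_k], some form would vanish on [F_k] but not on it. On
    the standard chart the coefficients of degree at most [k] lie in [F_k], so the form kills them
    there, and by [transfer] on all charts. *)
Lemma rees_chart l : size l = n -> rees z (Vl l).
Proof.
move=> sl k; apply: contrapT => /negP /separate[c [c0 /negP]]; apply; apply/eqP.
rewrite -lam_coef; apply: (transfer (d := k.+1) (size_nseq n false)) => // q r sq rk.
by rewrite lam_coef; apply: c0; apply: Fil_mono (rees_chart0 sq r).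
Qed.

Lemma size_Vl_chart0 q m : size q = n -> (size (Vl (chart0 q) m) <= degbound a)%N.
Proof.
move=> sq; rewrite /degbound.
have sw (i : 'I_n) : (size (wv (map (mapx polyC) (chart0 q)) (fun j => ((zz z j)%:P * 'X)%R) (rev_ord i) 0%R 0%R) <= n.-1.+1)%N.
  rewrite -zip_lift; have [-> -> _] := unzip_zip (size_nseq n false) sq.
  have iq : (rev_ord i < size q)%N by rewrite sq.
  have zs j : (size ((zz z j)%:P * 'X : {poly K})%R <= 2)%N.
    by rewrite (leq_trans (size_polyMleq _ _)) // size_polyX addn2 /= ltnS size_polyC_leq1.
  have := size_wv_chart0 zs iq; rewrite sq => h; apply: leq_trans h _; exact: leqSpred.
have w1 (i : 'I_n) : wv (map (mapx polyC) (chart0 q)) (fun j => (zz z j)%:P * 'X) (rev_ord i) 1%R 0%R = 1.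
  have [P PE] := wv_chart0 (map polyC q) (fun j => (zz z j)%:P * 'X).
  rewrite -zip_lift; have [-> -> _] := unzip_zip (size_nseq n false) sq.
  by rewrite -{1}sq -{1}(size_map polyC q) PE ?size_map ?sq ?ltn_ord // base1E.
have sv i : (size (vec polyC (a i) (chartv z polyC 'X (map (mapx polyC) (chart0 q)) i) (m i)) <= (n.-1 * (a i).-1).+1)%N.
  rewrite /vec /chartv w1 expr1n mulr1 mulrC mul_polyC (leq_trans (size_scale_leq _ _)) //.
  rewrite (leq_trans (size_poly_exp_leq _ _)) // ltnS leq_mul //.
    by have := sw i; case: size.
  by have := ltn_ord (m i); lia.
rewrite /Vl /chartV /vt (leq_trans (size_poly_prod_leq _ _)) //.
set S := (\sum_(i < n) size _)%N.
have : (S <= \sum_(i < n) (n.-1 * (a i).-1).+1)%N by apply: leq_sum => i _; exact: sv.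
have -> : (\sum_(i < n) (n.-1 * (a i).-1).+1 = n.-1 * \sum_(i < n) (a i).-1 + n)%N.
  rewrite big_distrr /=.
  have -> : (\sum_(i < n) n.-1 * (a i).-1 + n = \sum_(i < n) n.-1 * (a i).-1 + \sum_(i < n) 1)%N.
    by rewrite sum1_card card_ord.
  by rewrite -big_split /=; apply: eq_bigr => i _; rewrite addn1.
rewrite (@eq_card _ _ 'I_n) // card_ord; move: (n.-1 * _)%N => B. lia.
Qed.

End Charts.

(** * Linear forms that descend to the fusion product *)

Section Forms.
Variables (K : numClosedFieldType) (n : nat) (a : 'I_n -> nat) (z : 'I_n -> K).
Local Notation chart0 q := (zip (nseq n false) q).
Local Notation Vl := (@Vl K n a z).
Local Notation lam := (@lam K n a).
Implicit Types (c : midx a -> {poly K}) (X : 'M[K]_2).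

Lemma irrepD b X Y (i j : 'I_b) : irrep b (X + Y) i j = irrep b X i j + irrep b Y i j.
Proof. by rewrite !mxE !mulrnDl; ring. Qed.

Lemma irrepZ b k X (i j : 'I_b) : irrep b (k *: X) i j = k * irrep b X i j.
Proof. by rewrite !mxE !mulrDr -!mulrnAr !mulrA. Qed.

Lemma xaD X Y th (V : midx a -> {poly K}) m :
  xa polyC (X + Y) th V m = xa polyC X th V m + xa polyC Y th V m.
Proof.
rewrite /xa -big_split; apply: eq_bigr => i _ /=; rewrite -mulrDr -big_split.
by congr (_ * _); apply: eq_bigr => q _ /=; rewrite irrepD rmorphD mulrDl.
Qed.

Lemma xaZ k X th (V : midx a -> {poly K}) m :
  xa polyC (k *: X) th V m = k%:P * xa polyC X th V m.
Proof.
rewrite /xa mulr_sumr; apply: eq_bigr => i _; rewrite [RHS]mulrCA; congr (_ * _).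
by rewrite mulr_sumr; apply: eq_bigr => q _; rewrite irrepZ rmorphM mulrA.
Qed.

(** Divisibility of [lam c] by [s^d] on the standard chart; [lam_form] turns its coefficient of
    [s^d] into a form on the fusion product. *)
Definition vanishing c d : Prop :=
  forall q r, size q = n -> (r < d)%N -> (lam c (Vl (chart0 q)))`_r = 0.

Lemma det_nil X (p : {poly K}) : X *m X = 0 -> \det (1%:M + p *: map_mx polyC X) = 1.
Proof.
move=> X2; have tX := sqr0_trace0 X2.
have X11 : X 1 1 = - X 0 0.
  move: tX; rewrite /mxtrace !big_ord_recl big_ord0 addr0 => /eqP.
  have -> : lift ord0 ord0 = 1 :> 'I_2 by exact: val_inj.
  by rewrite addrC addr_eq0 => /eqP.
have : X 0 0 * X 0 0 + X 0 1 * X 1 0 = 0 by rewrite -mulmx2E X2 mxE.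
move=> /(congr1 polyC); rewrite det2E !mxE /= X11 rmorphN rmorphD !rmorphM rmorph0 => e.
rewrite -[RHS](subr0 1) -(mulr0 (p * p)) -e; ring.
Qed.

Lemma moved_unipotent X p (l : seq (bool * K)) : 
  @moved K n a z (1%:M + p *: map_mx polyC X) l =
  vt polyC (fun i => chartv z polyC 'X (map (mapx polyC) l) i + (map_poly polyC p).[zt z i] *:
      (map_mx polyC X *m chartv z polyC 'X (map (mapx polyC) l) i)).
Proof.
rewrite /moved; congr vt; apply: functional_extensionality_dep => i.
rewrite map_mxD map_mx1 map_mxZ /ev map_mxD map_mx1 map_mxZ mulmxDl mul1mx -scalemxAl.
congr (_ + _ *: (_ *m _)); apply/matrixP => x y.
by rewrite !mxE /= map_polyC /horner_eval hornerC.
Qed.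

Lemma vanishing_moved c d X p l r : vanishing c d -> X *m X = 0 -> size l = n -> (r < d)%N ->
  (lam c (@moved K n a z (1%:M + p *: map_mx polyC X) l))`_r = 0.
Proof.
move=> cv X2 sl rd; have dh := det_nil p X2.
have [l' e] := eqv_exists l dh.
have [k _ /(_ c d (leqW (ltnSn d)))] := moved_compare a z d dh e sl.
move=> /(_ _)[r' r'd|/(_ _ rd)//].
apply: (transfer_u (size_nseq n false)) r'd => //.
by rewrite size_map -(eqv_size e).
Qed.

(** The group element with parameter [t] times [X] and ['X^j] preserves the vanishing for every
    scalar [t]. The result is polynomial in [t], so each coefficient vanishes, and the linear one is
    the action of the current. *)
Lemma vanishing_nil c d X j l r : vanishing c d -> X *m X = 0 -> size l = n -> (r < d)%N ->
  (lam c (xa polyC X (fun i => zt z i ^+ j) (Vl l)))`_r = 0.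
Proof.
move=> cv X2 sl rd; set N := (\sum_i (a i).-1).+2.
pose T k := (lam c (iter k (xa polyC X (fun i => zt z i ^+ j)) (Vl l)))`_r.
have main (t : K) : \sum_(k < N) k`!%:R^-1 * T k * t ^+ k = 0.
  apply: etrans _ (vanishing_moved (t%:P * 'X^j) cv X2 sl rd); rewrite moved_unipotent.
  rewrite /T /lam /Vl /chartV [RHS]coef_sum.
  under [RHS]eq_bigr do rewrite (@vt_exp _ _ _ _ _ _ _ _ X2 N) // mulr_sumr coef_sum.
  rewrite [RHS]exchange_big /=; apply: eq_bigr => k _.
  rewrite coef_sum mulr_sumr mulr_suml; apply: eq_bigr => m _.
  have -> : (fun i => (map_poly polyC (t%:P * 'X^j)).[zt z i]) = fun i => t%:P * zt z i ^+ j.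
    apply: functional_extensionality_dep => i.
    by rewrite rmorphM /= map_polyC map_polyXn !hornerE.
  rewrite xa_iterZ -rmorphXn /= mulrCA coefCM mulrCA coefCM.
  by rewrite -!mulrA; congr (_ * _); rewrite mulrC.
have P0 : \poly_(k < N) (k`!%:R^-1 * T k) = 0.
  by apply: poly_infinite0 => t; rewrite horner_poly main.
have := congr1 (fun p : {poly K} => p`_1) P0.
by rewrite coef_poly coef0 /= invr1 mul1r.
Qed.

Lemma vanishing_xa c d X j l r : vanishing c d -> \tr X = 0 -> size l = n -> (r < d)%N ->
  (lam c (xa polyC X (fun i => zt z i ^+ j) (Vl l)))`_r = 0.
Proof.
move=> cv tX sl rd.
have X11 : X 1 1 = - X 0 0.
  move: tX; rewrite /mxtrace !big_ord_recl big_ord0 addr0 => /eqP.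
  have -> : lift ord0 ord0 = 1 :> 'I_2 by exact: val_inj.
  by rewrite addrC addr_eq0 => /eqP.
pose E : 'M[K]_2 := \matrix_(i, j) ((i == 0) && (j == 1))%:R.
pose F : 'M[K]_2 := \matrix_(i, j) ((i == 1) && (j == 0))%:R.
(* [E], [F] and [G] have square zero and span [sl_2]; [G], with both rows equal to [(1, -1)],
   supplies the diagonal part. *)
pose G : 'M[K]_2 := \matrix_(i, j) (if j == 0 then 1 else -1).
have E2 : E *m E = 0 by apply: mx2P; apply: ord2P; rewrite mulmx2E !mxE /=; ring.
have F2 : F *m F = 0 by apply: mx2P; apply: ord2P; rewrite mulmx2E !mxE /=; ring.
have G2 : G *m G = 0 by apply: mx2P; apply: ord2P; rewrite mulmx2E !mxE /=; ring.
have -> : X = X 0 0 *: G + ((X 0 0 + X 0 1) *: E + (X 1 0 - X 0 0) *: F).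
  by apply: mx2P; apply: ord2P; rewrite !mxE ?X11 /=; ring.
rewrite /lam; under eq_bigr do rewrite !xaD !xaZ !mulrDr !(mulrCA (c _)).
rewrite !big_split /= -!mulr_sumr !coefD !coefCM.
rewrite [X in _ * X + _](_ : _ = 0); last exact: (vanishing_nil _ cv G2).
rewrite [X in _ + (_ * X + _)](_ : _ = 0); last exact: (vanishing_nil _ cv E2).
rewrite [X in _ + (_ + _ * X)](_ : _ = 0); last exact: (vanishing_nil _ cv F2).
by rewrite !mulr0 !addr0.
Qed.

Definition lamt c (k : nat) (v : tens K a) : {poly K} :=
  'X^k * \sum_m c m * (v m)%:P.

Lemma lam_transpose c X th : exists c', forall V, lam c' V = lam c (xa polyC X th V).
Proof.
pose dl (m' m : midx a) : {poly K} := (m == m')%:R.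
exists (fun m' => lam c (xa polyC X th (dl m'))) => V.
have e W : W = fun m : midx a => \sum_m' W m' * dl m' m.
  apply: functional_extensionality_dep => m; rewrite (bigD1 m) //= big1 ?addr0.
    by rewrite /dl eqxx mulr1.
  by move=> m' ne; rewrite /dl eq_sym (negPf ne) mulr0.
rewrite /lam; under [in RHS]eq_bigr => m _.
  have -> : xa polyC X th V m = \sum_m' V m' * xa polyC X th (dl m') m.
    rewrite {1}(e V) /xa.
    under [RHS]eq_bigr do rewrite mulr_sumr.
    rewrite [RHS]exchange_big; apply: eq_bigr => i _ /=.
    under [RHS]eq_bigr do rewrite mulrCA mulr_sumr.
    rewrite -mulr_sumr exchange_big; congr (_ * _); apply: eq_bigr => q _ /=.
    by rewrite mulr_sumr; apply: eq_bigr => m' _; rewrite mulrCA.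
  rewrite mulr_sumr; over.
rewrite exchange_big; apply: eq_bigr => m' _ /=; rewrite mulr_suml; apply: eq_bigr => m _.
by rewrite -mulrA; congr (_ * _); rewrite mulrC.
Qed.

Lemma xa_tact X j (v : tens K a) m :
  xa polyC X (fun i => zt z i ^+ j) (fun m => (v m)%:P) m = 'X^j * (tact z X j v m)%:P.
Proof.
rewrite ffunE rmorph_sum mulr_sumr; apply: eq_bigr => i _.
rewrite /zt exprMn -rmorphXn /= polyCM mulrCA mulrA; congr (_ * _).
by rewrite rmorph_sum; apply: eq_bigr => q _; rewrite -polyCM.
Qed.

(** Induction on the word, moving its outermost current from the vector to the form: the transposed
    form still vanishes to order [d] by [vanishing_xa]. The lowest vector is the point of the
    standard chart with all coordinates zero. *)
Lemma vanishing_word d k v c r : vanishing c d -> word z k v -> (r < d)%N ->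
  (lamt c k v)`_r = 0.
Proof.
move=> cv wv rd; elim: wv c cv => {k v} [|X j k v tX _ IH] c cv.
  have := cv (nseq n 0) r (size_nseq n 0) rd.
  suff -> : lamt c 0 (lowest K a) = lam c (Vl (chart0 (nseq n 0))) by [].
  rewrite /lamt expr0 mul1r; apply: eq_bigr => m _; congr (_ * _).
  rewrite -vt_lowest /Vl /chartV; congr (vt _ _ m); apply: functional_extensionality_dep => i.
  rewrite /chartv.
  have : (rev_ord i < n)%N by exact: ltn_ord.
  move: (nat_of_ord (rev_ord i)) (fun j : nat => (zz z j)%:P * 'X) => j.
  elim: (n) j => // k IH [|j] zt' //= jk.
  rewrite /mapx /= rmorph0 -IH //; have [g00 g01 g10 g11] := gmE (false, 0 : {poly K}) (zt' j.+1 - zt' 0%N).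
  by apply: mx2P => x; rewrite [x]ord1 mulmx2E !base0E !base1E ?g00 ?g01 ?g10 ?g11 /=; ring.
have [c' c'E] := lam_transpose c X (fun i => zt z i ^+ j).
have cv' : vanishing c' d.
  move=> q r' sq r'd; rewrite c'E; apply: vanishing_xa cv tX _ r'd.
  by have [_ _ ->] := unzip_zip (size_nseq n false) sq.
apply: etrans (IH c' cv').
suff -> : lamt c (j + k) (tact z X j v) = lamt c' k v by [].
rewrite /lamt addnC exprD -mulrA; congr (_ * _).
have := c'E (fun m => (v m)%:P); rewrite /lam => ->.
by rewrite mulr_sumr; apply: eq_bigr => m _; rewrite xa_tact mulrCA.
Qed.

End Forms.

Section LinearForms.
Variables (K : numClosedFieldType) (n : nat) (a : 'I_n -> nat) (z : 'I_n -> K).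
Local Notation Vl := (@Vl K n a z).
Local Notation lam := (@lam K n a).
Local Notation tens := (tens K a).
Local Notation gtens := (gtens K a).
Implicit Types (c : midx a -> {poly K}) (X : 'M[K]_2).

(* The limit at s = 0. *)
Definition pt (l : seq (bool * K)) : gtens := Cls z (Vl l).

Lemma lamt_linear c k r : linear (fun v : tens => (lamt c k v)`_r : K^o).
Proof.
move=> t u v; rewrite /lamt !coefXnM; case: ifP => _.
  by rewrite /GRing.scale /= mulr0 addr0.
rewrite !coef_sum -[X in _ = X + _]/(t * _) mulr_sumr -big_split; apply: eq_bigr => m _ /=.
rewrite !coefMC !ffunE -[_ *: _]/(t * _); ring.
Qed.

Lemma lamtB c k (v w : tens) r : (lamt c k (v - w))`_r = (lamt c k v)`_r - (lamt c k w)`_r.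
Proof.
rewrite addrC -scaleN1r lamt_linear addrC.
by rewrite -[X in _ + X]/(-1 * _) mulN1r.
Qed.

Lemma lamtS c k v : lamt c k.+1 v = 'X * lamt c k v.
Proof. by rewrite /lamt exprS mulrA. Qed.

Lemma vanishing_Fil d k v c r : vanishing z c d -> v \in Fil a z k -> (r < d)%N ->
  (lamt c k v)`_r = 0.
Proof.
move=> cv vk rd.
pose f := GRing.isLinear.Build K tens K^o _ (fun v : tens => (lamt c k v)`_r) (lamt_linear c k r).
pose F : {linear tens -> K^o} := HB.pack (fun v : tens => (lamt c k v)`_r) f.
suff : v \in lker (linfun F) by rewrite memv_ker lfunE => /eqP.
apply: vspan_sub vk => w [e ek we]; rewrite memv_ker lfunE /=; apply/eqP.
have -> : lamt c k w = 'X^(k - e) * lamt c e w.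
  by rewrite /lamt mulrA -exprD subnK.
rewrite coefXnM; case: ltnP => // re; apply: vanishing_word cv we _.
by apply: leq_ltn_trans rd; exact: leq_subr.
Qed.

(** An element of [F_(k-1)] placed in degree [k] is [s] times an element of the Rees module, which
    raises the order by one. Hence the coefficient of [s^d] depends only on the class in
    [F_k / F_(k-1)]. *)
Lemma vanishing_Fil_pred d k v c r : vanishing z c d -> v \in Fil_pred a z k -> (r <= d)%N ->
  (lamt c k v)`_r = 0.
Proof.
case: k => [|k] cv /=.
  rewrite memv0 => /eqP -> _; rewrite /lamt big1 ?mulr0 ?coef0 // => m _.
  by rewrite ffunE mulr0.
move=> vk rd; rewrite lamtS coefXM; case: r rd => //= r rd.
exact: vanishing_Fil vk rd.
Qed.

(** A form vanishing on [F_(k-1)] has zero coefficients on the standard chart in degrees below [k],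
    and in the others because [size_Vl_chart0] bounds the degree. So it vanishes to every order, and
    then on [F_k]. *)
Lemma Fil_stable k v : (degbound a <= k)%N -> v \in Fil a z k -> v \in Fil a z k.-1.
Proof.
move=> dk vk; apply: contrapT => /negP /separate[c [c0 /negP]]; apply; apply/eqP.
have k0 : (0 < k)%N by apply: leq_trans dk.
have cv d : vanishing z (fun m => (c m)%:P) d.
  move=> q r sq _; rewrite lam_coef; have [rk|rk] := ltnP r k.
    by apply: c0; apply: Fil_mono (rees_chart0 a z sq r); rewrite -ltnS prednK.
  rewrite big1 // => m _; rewrite ffunE nth_default ?mulr0 //.
  by apply: leq_trans (size_Vl_chart0 z m sq) _; exact: leq_trans rk.
have := vanishing_Fil (cv k.+1) vk (ltnSn k).
rewrite /lamt coefXnM ltnn subnn coef_sum => e; rewrite -[RHS]e.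
by apply: eq_bigr => m _; rewrite coefCM coefC.
Qed.

Lemma lam_form c d : vanishing z c d ->
  exists xi : {linear gtens -> K^o}, forall l, size l = n -> xi (pt l) = (lam c (Vl l))`_d.
Proof.
move=> cv; pose f (m : gtens) : K^o := \sum_(k < degbound a) (lamt c k (m k))`_d.
have fl : linear f.
  move=> t u v; rewrite /f scaler_sumr -big_split; apply: eq_bigr => k _ /=.
  by rewrite !ffunE; exact: lamt_linear.
pose lf := GRing.isLinear.Build K gtens K^o _ f fl.
exists (HB.pack f lf : {linear gtens -> K^o}) => l sl /=.
have rV := rees_chart a z sl.
(* A common bound for [degbound a] and the degrees of all coordinates; the components beyond
   [degbound a] contribute nothing by [Fil_stable]. *)
pose S := (degbound a + \sum_m size (Vl l m))%N.
have -> : lam c (Vl l) = \sum_(k < S) lamt c k (coefV (Vl l) k).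
  rewrite /lam; under [RHS]eq_bigr do rewrite /lamt mulr_sumr.
  rewrite exchange_big; apply: eq_bigr => m _ /=.
  have sm : (size (Vl l m) <= S)%N.
    by rewrite /S (bigD1 m) //=; lia.
  rewrite -[in LHS](coefK (Vl l m)) (poly_def) mulr_sumr.
  rewrite (big_ord_widen S (fun k => c m * ((Vl l m)`_k *: 'X^k)) sm) big_mkcond /=.
  apply: eq_bigr => k _; rewrite ffunE; case: ltnP => ks.
    by rewrite mulrCA -mul_polyC; congr (_ * _); rewrite mulrC.
  by rewrite nth_default // mulr0 mulr0.
rewrite coef_sum /f.
rewrite (eq_bigr (fun k : 'I_(degbound a) => (lamt c k (cls a z k (coefV (Vl l) k)))`_d)) => [|k _]; last by rewrite ffunE.
rewrite (big_ord_widen S (fun k => (lamt c k (cls a z k (coefV (Vl l) k)))`_d)) ?leq_addr //.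
rewrite big_mkcond /=; apply: eq_bigr => k _; case: ltnP => kd.
  apply/esym/eqP; rewrite -subr_eq0; apply/eqP.
  by rewrite -lamtB; apply: (vanishing_Fil_pred cv (sub_cls (rV k))).
have k0 : (0 < k)%N by apply: leq_trans kd.
have P v : v \in Fil a z k.-1 -> v \in Fil_pred a z k by case: (nat_of_ord k) k0.
by rewrite (vanishing_Fil_pred cv (P _ (Fil_stable kd (rV k)))).
Qed.

End LinearForms.

(** * Recovering a chain from its vector *)

Section Frames.
Variable R : comNzRingType.
Implicit Types (l : seq (bool * R)) (zt : nat -> R).

(** The columns are a basis of the last lattice of the chain, written in the coordinates of the
    initial lattice. *)
Fixpoint Mx l zt : 'M[{poly R}]_2 :=
  if l is x :: l' then gX x (zt 0) *m Mx l' (zt \o S) else 1%:M.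

Lemma wv_Mx l zt j x0 : (j < size l)%N ->
  wv l zt j = ev (zt j) (Mx (take j l) zt) *m base (nth x0 l j).
Proof.
elim: l zt j => [|x l IH] zt [|j] //= jl; first by rewrite ev1 mul1mx.
by rewrite IH // evM ev_gX mulmxA.
Qed.

Lemma det_Mx l zt c : \det (ev c (Mx l zt)) = \prod_(i < size l) (c - zt i).
Proof.
elim: l zt => [|x l IH] zt /=; first by rewrite big_ord0 ev1 det1.
by rewrite evM det_mulmx IH ev_gX det_gm big_ord_recl.
Qed.

Lemma wedge_gm0 x (v : 'cV[R]_2) : wedge (gm x 0 *m v) (base x) = 0.
Proof.
rewrite /wedge !mulmx2E !base0E !base1E; have [-> -> -> ->] := gmE x 0.
by case: x.1; ring.
Qed.

(** Elements of a lattice beyond step [r] take at [zt r] values on the line chosen in step [r]. *)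
Lemma wedge_Mx_lt l zt j r (e : 'cV[R]_2) : (r < j)%N -> (r < size l)%N ->
  wedge (ev (zt r) (Mx (take j l) zt) *m e) (wv l zt r) = 0.
Proof.
elim: l zt j r => [|x l IH] zt [|j] [|r] //= rj rl.
  by rewrite evM ev_gX subrr -mulmxA wedge_gm0.
by rewrite evM ev_gX -mulmxA wedge_mul IH ?mulr0.
Qed.

Lemma wedge_Mx_eq l zt j (e : 'cV[R]_2) x0 : (j < size l)%N ->
  wedge (ev (zt j) (Mx (take j l) zt) *m e) (wv l zt j) =
  \prod_(r < j) (zt j - zt r) * wedge e (base (nth x0 l j)).
Proof.
move=> jl; rewrite (wv_Mx zt x0 jl) wedge_mul det_Mx size_take_min.
by rewrite (minn_idPl (ltnW jl)).
Qed.

Lemma newton (G : {poly R}) zt N : exists d : nat -> R, forall j, (j < N)%N ->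
  G.[zt j] = \sum_(k < N) d k * \prod_(r < k) (zt j - zt r).
Proof.
suff [d [Q E]] : exists (d : nat -> R) (Q : {poly R}),
    G = \sum_(k < N) d k *: \prod_(r < k) ('X - (zt r)%:P) + Q * \prod_(r < N) ('X - (zt r)%:P).
  exists d => j jN.
  have v0 : (\prod_(r < N) ('X - (zt r)%:P)).[zt j] = 0.
    by rewrite horner_prod (bigD1 (Ordinal jN)) //= !hornerE subrr mul0r.
  rewrite {1}E hornerD hornerM v0 mulr0 addr0 horner_sum.
  apply: eq_bigr => k _; rewrite hornerZ horner_prod; congr (_ * _).
  by apply: eq_bigr => r _; rewrite !hornerE.
elim: N => [|N [d [Q E]]].
  by exists (fun _ => 0), G; rewrite !big_ord0 add0r mulr1.
have [Q' E'] : exists Q', Q - (Q.[zt N])%:P = Q' * ('X - (zt N)%:P).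
  by apply/factor_theorem/eqP; rewrite !hornerE subrr.
exists (fun k => if k == N then Q.[zt N] else d k), Q'.
rewrite !big_ord_recr /= eqxx {1}E -addrA; congr (_ + _).
  by apply: eq_bigr => k _; rewrite ltn_eqF.
rewrite (mulrC (\prod_(r < N) _)) mulrA -E' -mul_polyC; ring.
Qed.

Definition evv (c : R) (g : 'cV[{poly R}]_2) : 'cV[R]_2 := map_mx (horner_eval c) g.

Definition Dmx N (g : nat -> 'cV[{poly R}]_2) zt (w : nat -> 'cV[R]_2) : 'M[R]_N :=
  \matrix_(p, j) wedge (evv (zt j) (g p)) (w j).

Definition vand zt N : R := \prod_(k < N) \prod_(r < k) (zt k - zt r).

(** Row [p] consists of the values at the nodes of the single polynomial [G p]. By Newton
    interpolation the matrix factors through the triangular matrix of Newton basis values, whose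
    determinant is [vand]. *)
Lemma Dmx_chart0 N g zt (P : {poly R}) w :
  (forall j, (j < N)%N -> w j = base (false, P.[zt j])) ->
  exists q, \det (Dmx N g zt w) = q * vand zt N.
Proof.
move=> wE; pose G p := g p 0 0 - g p 1 0 * P.
have [d dE] : exists d : nat -> nat -> R, forall p j, (j < N)%N ->
    (G p).[zt j] = \sum_(k < N) d p k * \prod_(r < k) (zt j - zt r).
  have /choice[d dE] : forall p, exists d : nat -> R, forall j, (j < N)%N ->
    (G p).[zt j] = \sum_(k < N) d k * \prod_(r < k) (zt j - zt r).
    by move=> p; exact: newton.
  by exists d.
pose T : 'M[R]_N := \matrix_(j, k) \prod_(r < k) (zt j - zt r).
have -> : Dmx N g zt w = (\matrix_(p < N, k < N) d p k) *m T^T.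
  apply/matrixP => p j; rewrite !mxE wE // /wedge base0E base1E /= !mxE /horner_eval.
  have := dE p j (ltn_ord j); rewrite /G !hornerE => ->.
  by apply: eq_bigr => k _; rewrite !mxE.
rewrite det_mulmx det_tr [\det T]det_trig; last first.
  apply/is_trig_mxP => j k jk; rewrite mxE (bigD1 (Ordinal jk)) //=.
  by rewrite subrr mul0r.
eexists; congr (_ * _); apply: eq_bigr => k _; exact: mxE.
Qed.

Lemma Dmx_last N g zt w :
  (forall r, (r < N)%N -> wedge (evv (zt r) (g N)) (w r) = 0) ->
  \det (Dmx N.+1 g zt w) = wedge (evv (zt N) (g N)) (w N) * \det (Dmx N g zt w).
Proof.
move=> h; rewrite (expand_det_row _ ord_max) (bigD1 ord_max) //= big1 ?addr0 => [|r rN].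
  rewrite mxE; congr (_ * _); rewrite /cofactor -signr_odd addnn odd_double expr0 mul1r.
  congr (\det _); apply/matrixP => p j; rewrite !mxE.
  by rewrite !lift_max.
rewrite mxE h ?mul0r //.
by have := ltn_ord r; rewrite ltnS leq_eqVlt -(inj_eq val_inj) in rN *; rewrite (negPf rN).
Qed.

Lemma Dmx_linear N g zt w : exists cof : nat -> R, forall h : 'cV[{poly R}]_2,
  \det (Dmx N.+1 (fun p => if p == N then h else g p) zt w) =
  \sum_(j < N.+1) wedge (evv (zt j) h) (w j) * cof j.
Proof.
exists (fun j => if insub j is Some j' then
   cofactor (Dmx N.+1 g zt w) ord_max j' else 0) => h.
rewrite (expand_det_row _ ord_max); apply: eq_bigr => j _.
rewrite mxE eqxx insubT // => jN; congr (_ * _); rewrite /cofactor.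
have -> : Sub (val j) jN = j by exact: val_inj.
congr (_ * \det _); apply/matrixP => p k; rewrite !mxE.
by rewrite lift_max ltn_eqF.
Qed.

End Frames.

(** * Multihomogeneous functions as linear forms on the tensor product *)

Section Multihomogeneous.
Variables (R : comNzRingType) (n : nat).
Local Notation fam := ('I_n -> 'cV[R]_2).

(* Functions of a family of vectors that are homogeneous polynomials of degree
   be i in the i-th vector. *)
Inductive mhom (be : 'I_n -> nat) : (fam -> R) -> Prop :=
| mhom_mono e : (forall i, (e i <= be i)%N) ->
    mhom be (fun u => \prod_i (u i 0 0 ^+ e i * u i 1 0 ^+ (be i - e i)))
| mhom_add F G : mhom be F -> mhom be G -> mhom be (fun u => F u + G u)
| mhom_scale c F : mhom be F -> mhom be (fun u => c * F u).

Lemma mhom_ext be be' F G : be =1 be' -> F =1 G -> mhom be F -> mhom be' G.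
Proof.
by move=> e1 e2; rewrite (functional_extensionality_dep e1) (functional_extensionality_dep e2).
Qed.

Lemma mhom0 be : mhom be (fun _ => 0).
Proof.
apply: (mhom_ext (frefl be)) (mhom_scale 0 (mhom_mono (e := fun _ => 0%N) _)) => //.
by move=> u; rewrite mul0r.
Qed.

Lemma mhom_sum (I : Type) (r : seq I) (P : pred I) be (F : I -> fam -> R) :
  (forall i, P i -> mhom be (F i)) -> mhom be (fun u => \sum_(i <- r | P i) F i u).
Proof.
move=> hF; elim: r => [|x r IH].
  by apply: mhom_ext (mhom0 be) => // u; rewrite big_nil.
case Px: (P x); last by apply: mhom_ext IH => // u; rewrite big_cons Px.
by apply: mhom_ext (mhom_add (hF _ Px) IH) => // u; rewrite big_cons Px.
Qed.

Lemma mhom_mul be be' F G : mhom be F -> mhom be' G ->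
  mhom (fun i => be i + be' i)%N (fun u => F u * G u).
Proof.
move=> hF hG; elim: hF => [e he|F1 F2 _ IH1 _ IH2|c F1 _ IH].
- elim: hG => [e' he'|G1 G2 _ IH1 _ IH2|c G1 _ IH].
  + have hee i : (e i + e' i <= be i + be' i)%N by apply: leq_add.
    apply: mhom_ext (mhom_mono hee) => // u; rewrite -big_split; apply: eq_bigr => i _ /=.
    have -> : (be i + be' i - (e i + e' i) = (be i - e i) + (be' i - e' i))%N.
      by have := he i; have := he' i; lia.
    by rewrite !exprD; ring.
  + by apply: mhom_ext (mhom_add IH1 IH2) => // u; rewrite mulrDr.
  + by apply: mhom_ext (mhom_scale c IH) => // u; rewrite mulrCA.
- by apply: mhom_ext (mhom_add IH1 IH2) => // u; rewrite mulrDl.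
- by apply: mhom_ext (mhom_scale c IH) => // u; rewrite mulrA.
Qed.

Lemma mhom_1 : mhom (fun _ => 0%N) (fun _ => 1).
Proof.
apply: mhom_ext (mhom_mono (be := fun _ => 0%N) (e := fun _ => 0%N) _) => //.
by move=> u; rewrite big1 // => i _; rewrite !expr0 mulr1.
Qed.

Lemma mhom_prod (I : Type) (r : seq I) (P : pred I) (be : I -> 'I_n -> nat) (F : I -> fam -> R) :
  (forall i, P i -> mhom (be i) (F i)) ->
  mhom (fun k => \sum_(i <- r | P i) be i k)%N (fun u => \prod_(i <- r | P i) F i u).
Proof.
move=> hF; elim: r => [|x r IH].
  by apply: mhom_ext mhom_1 => [k|u]; rewrite big_nil.
case Px: (P x); last by apply: mhom_ext IH => [k|u]; rewrite big_cons Px.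
by apply: mhom_ext (mhom_mul (hF _ Px) IH) => [k|u]; rewrite big_cons Px.
Qed.

Lemma mhom_exp be F d : mhom be F -> mhom (fun i => d * be i)%N (fun u => F u ^+ d).
Proof.
move=> hF; elim: d => [|d IH].
  by apply: mhom_ext mhom_1.
by apply: mhom_ext (mhom_mul hF IH) => [k|u]; rewrite ?exprS // mulSn.
Qed.

Lemma mhom_wedge (i : 'I_n) (v : 'cV[R]_2) :
  mhom (fun k => nat_of_bool (k == i)) (fun u => wedge v (u i)).
Proof.
have h b : mhom (fun k => nat_of_bool (k == i)) (fun u => u i (if b then 0 else 1) 0).
  have he k : (((k == i) && b : bool) <= (k == i))%N by case: (k == i); case: b.
  apply: mhom_ext (mhom_mono he) => // u; rewrite (bigD1 i) //= big1 ?mulr1 => [|k ki].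
    by rewrite eqxx; case: b {he}; rewrite /= ?expr0 ?expr1 ?mulr1 ?mul1r.
  by rewrite (negPf ki) !expr0 mulr1.
apply: mhom_ext (mhom_add (mhom_scale (v 0 0) (h false)) (mhom_scale (- v 1 0) (h true))) => // u.
by rewrite /wedge mulNr.
Qed.

Lemma mhom_det N (sg : 'I_N -> 'I_n) (A : 'I_N -> 'I_N -> 'cV[R]_2) :
  mhom (fun k => \sum_(j < N) (k == sg j))%N
       (fun u => \det (\matrix_(p, j) wedge (A p j) (u (sg j)))).
Proof.
apply: mhom_sum => s _; apply: mhom_scale.
have := mhom_prod (index_enum 'I_N) (P := predT)
   (fun p _ => mhom_wedge (sg ((s : {perm 'I_N}) p)) (A p ((s : {perm 'I_N}) p))).
apply: mhom_ext => [k|u].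
  by rewrite [RHS](reindex_inj (perm_inj (s := s))).
by apply: eq_bigr => p _; rewrite mxE.
Qed.

End Multihomogeneous.

(** A monomial of degree [a_i - 1] in the i-th vector for each [i] is, up to the factorials in
    [vec], one coordinate of [vt]. *)
Lemma mhom_vt (K : numClosedFieldType) n (a : 'I_n -> nat) (R : comNzRingType)
    (io : {rmorphism K -> R}) F : (forall i, (0 < a i)%N) ->
  mhom (fun i => (a i).-1) F ->
  exists c : midx a -> R, forall u, F u = \sum_m c m * vt io u m.
Proof.
move=> a0; elim=> [e he|F1 F2 _ [c1 e1] _ [c2 e2]|c F1 _ [c1 e1]].
- have hl i : (e i < a i)%N by have := he i; have := a0 i; lia.
  pose m0 : midx a := [ffun i => Ordinal (hl i)].
  exists (fun m => if m == m0 then \prod_i io (e i)`!%:R else 0) => u.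
  rewrite (bigD1 m0) //= eqxx [X in _ + X]big1 ?addr0 => [|m ne]; last by rewrite (negPf ne) mul0r.
  rewrite -big_split; apply: eq_bigr => i _ /=; rewrite /vec ffunE /=.
  rewrite [RHS]mulrC -[RHS]mulrA -rmorphM mulVf ?rmorph1 ?mulr1 //.
  by rewrite pnatr_eq0 -lt0n fact_gt0.
- exists (fun m => c1 m + c2 m) => u; rewrite e1 e2 -big_split.
  by apply: eq_bigr => m _; rewrite mulrDl.
- by exists (fun m => c * c1 m) => u; rewrite e1 mulr_sumr; apply: eq_bigr => m _; rewrite mulrA.
Qed.

Lemma map_Mx (R R' : comNzRingType) (f : {rmorphism R -> R'}) l zt :
  map_mx (map_poly f) (Mx l zt) = Mx (map (mapx f) l) (f \o zt).
Proof.
elim: l zt => [|x l IH] zt /=; first by rewrite map_mx1.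
by rewrite map_mxM map_gX IH.
Qed.

Lemma size_Mx (R : comNzRingType) (l : seq (bool * R)) zt i k :
  (size (Mx l zt i k) <= (size l).+1)%N.
Proof.
elim: l zt i k => [|x l IH] zt i k /=.
  by rewrite mxE; case: (i == k); rewrite ?size_poly1 ?size_poly0.
have sg u v : (size (gX x (zt 0%N) u v) <= 2)%N.
  rewrite !mxE; case: ifP => _; first case: ifP => _.
  - by rewrite (leq_trans (size_polyC_leq1 _)).
  - by rewrite size_poly1.
  by case: ifP; rewrite ?size_XsubC ?size_poly0.
have leM (p q : {poly R}) s : (size p <= 2)%N -> (size q <= s.+1)%N -> (size (p * q)%R <= s.+2)%N.
  by have := size_polyMleq p q; lia.
by rewrite mulmx2E (leq_trans (size_polyD _ _)) // geq_max !leM.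
Qed.

Section Levels.
Variables (n : nat) (a : 'I_n -> nat).

Definition aa (k : nat) : nat := oapp a 0%N (insub k).
(** The increments of [a], with 1 in place of a term before the first, so that they add up to
    [a_i - 1]. As the k-th determinant is linear in exactly the factors [i >= k], these
    multiplicities produce the right degrees. *)
Definition mu (k : nat) : nat := (aa k - (if k is k'.+1 then aa k' else 1))%N.

Lemma aaE (i : 'I_n) : aa i = a i.
Proof. by rewrite /aa valK. Qed.

Hypotheses (a_ge2 : forall i, (2 <= a i)%N).
Hypothesis (a_inc : forall i j : 'I_n, (i < j)%N -> (a i < a j)%N).

Lemma mu_gt0 (i : 'I_n) : (0 < mu i)%N.
Proof.
rewrite /mu subn_gt0 aaE; case: i => [[|k] kn] /=; first exact: a_ge2.
by have := aaE (Ordinal (ltnW kn)) => /= ->; apply: a_inc.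
Qed.

Lemma mu_sum (i : 'I_n) : (\sum_(k < n) mu k * (k <= i) = (a i).-1)%N.
Proof.
rewrite -(big_mkord predT (fun k => mu k * (k <= i)))%N (@big_cat_nat _ _ _ i.+1) //=.
rewrite [X in (_ + X)%N]big_nat_cond [X in (_ + X)%N]big1 ?addn0; last first.
  by move=> k /andP[/andP[ik _] _]; rewrite leqNgt ik muln0.
rewrite -aaE; have := ltn_ord i; move: (nat_of_ord i) => k kn.
rewrite big_nat_cond (eq_bigr mu) => [|j /andP[/andP[_ jk] _]]; last by rewrite -ltnS jk muln1.
rewrite -big_nat_cond; elim: k kn => [|k IH] kn.
  by rewrite big_nat1 /mu subn1.
rewrite big_nat_recr //= IH; last exact: ltnW.
have := mu_gt0 (Ordinal kn); rewrite /mu /= subn_gt0.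
have : (0 < aa k)%N by have := aaE (Ordinal (ltnW kn)) => /= ->; apply: leq_trans (a_ge2 _).
lia.
Qed.

End Levels.

Section Sections.
Variables (K : numClosedFieldType) (n : nat) (a : 'I_n -> nat) (z : 'I_n -> K).
Local Notation R := {poly K}.
Hypotheses (a_ge2 : forall i, (2 <= a i)%N).
Hypothesis (a_inc : forall i j : 'I_n, (i < j)%N -> (a i < a j)%N).
Hypothesis z_inj : injective z.
Local Notation Vl := (@Vl K n a z).
Local Notation fam := ('I_n -> 'cV[R]_2).

Let zeta (j : nat) : R := (zz z j)%:P * 'X.

Definition uw (u : fam) (j : nat) : 'cV[R]_2 := oapp u 0 (insub (n.-1 - j)%N).

Lemma uw_rev u (i : 'I_n) : uw u (rev_ord i) = u i.
Proof.
rewrite /uw; case: insubP => [j _ e|]; last by rewrite /= -ltnNge; have := ltn_ord i; lia.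
by congr u; apply: val_inj; rewrite e /=; have := ltn_ord i; lia.
Qed.

Lemma uw_chartv l j : (j < n)%N -> uw (chartv z polyC 'X l) j = wv l zeta j.
Proof.
move=> jn; have -> : j = rev_ord (rev_ord (Ordinal jn)) by rewrite rev_ordK.
by rewrite uw_rev.
Qed.

(** The columns are the steps below [n - i], that is, the tensor factors [k >= i] in reverse order,
    each occurring once. *)
Lemma mhom_Dmx (i : 'I_n) g :
  mhom (fun k : 'I_n => nat_of_bool (i <= k)%N) (fun u => \det (Dmx (n - i) g zeta (uw u))).
Proof.
pose sg (j : 'I_(n - i)) : 'I_n := rev_ord (widen_ord (leq_subr i n) j).
apply: mhom_ext (mhom_det sg (fun p j => evv (zeta j) (g p))) => [k|u].
  have [ik|ki] := leqP i k.
    have kl : (n - k.+1 < n - i)%N by have := ltn_ord k; lia.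
    rewrite (bigD1 (Ordinal kl)) //= big1 => [|j].
      rewrite addn0; apply/eqP; rewrite eqb1; apply/eqP; apply: val_inj.
      by rewrite /= /sg /=; have := ltn_ord k; lia.
    rewrite -val_eqE /= => jk; apply/eqP; rewrite eqb0; apply: contra jk => /eqP ->.
    by rewrite /sg /=; apply/eqP; have := ltn_ord j; have := ltn_ord i; lia.
  rewrite big1 // => j _; apply/eqP; rewrite eqb0; apply/eqP => kE.
  by move: ki; rewrite kE /sg /=; have := ltn_ord j; lia.
congr (\det _); apply/matrixP => p j; rewrite !mxE; congr (wedge _ _).
by rewrite -(uw_rev u) /sg rev_ordK.
Qed.

Lemma zz_neq j k : (j < k)%N -> (k < n)%N -> zz z k - zz z j != 0.
Proof.
move=> jk kn; have jn := ltn_trans jk kn.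
have -> : k = rev_ord (rev_ord (Ordinal kn)) by rewrite rev_ordK.
have -> : j = rev_ord (rev_ord (Ordinal jn)) by rewrite rev_ordK.
rewrite !zz_rev subr_eq0; apply/eqP => /z_inj/rev_ord_inj /(congr1 val) /= e.
by move: jk; rewrite e ltnn.
Qed.

Lemma vand_zeta N : (N <= n)%N ->
  exists2 c : K, c != 0 & vand zeta N = c%:P * 'X^(\sum_(k < N) k).
Proof.
move=> Nn; exists (vand (zz z) N).
  rewrite prodf_seq_neq0; apply/allP => k _ /=; rewrite prodf_seq_neq0; apply/allP => r _ /=.
  by apply: zz_neq => //; apply: leq_trans (ltn_ord k) Nn.
rewrite /vand rmorph_prod -prodrXr -big_split; apply: eq_bigr => k _ /=.
rewrite rmorph_prod -[X in 'X^X]card_ord -prodr_const -big_split; apply: eq_bigr => r _ /=.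
by rewrite /zeta -mulrBl rmorphB.
Qed.

Variable l0 : seq (bool * K).
Hypothesis sl0 : size l0 = n.
Let x0 : bool * K := (false, 0).
Let lf (l : seq (bool * K)) : seq (bool * R) := map (mapx polyC) l.

Definition cmpl (x : bool * K) : 'cV[K]_2 := \col_i ((i == 1) == x.1)%:R.

Lemma wedge_cmpl x : wedge (cmpl x) (base x) = (if x.1 then -1 else 1).
Proof. by rewrite /wedge base0E base1E !mxE; case: x.1 => /=; ring. Qed.

Let cst (e : 'cV[K]_2) : 'cV[{poly R}]_2 := map_mx polyC (map_mx polyC e).
(** Rows adapted to [l0]: the p-th one lies in the p-th lattice of [l0], and its coordinates there
    are off the line chosen in step [p]. *)
Let g0 (p : nat) := Mx (take p (lf l0)) zeta *m cst (cmpl (nth x0 l0 p)).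

Lemma evv_frame c (l : seq (bool * R)) e :
  evv c (Mx l zeta *m cst e) = ev c (Mx l zeta) *m map_mx polyC e.
Proof.
rewrite /evv map_mxM; congr (_ *m _); apply/matrixP => i j.
by rewrite !mxE /= /horner_eval hornerC.
Qed.

Lemma nth_lf l j : (j < size l)%N -> nth (mapx polyC x0) (lf l) j = mapx polyC (nth x0 l j).
Proof. by move=> jl; rewrite (nth_map x0). Qed.

Lemma wedge_polyC (u v : 'cV[K]_2) :
  wedge (map_mx polyC u) (map_mx polyC v) = (wedge u v)%:P.
Proof. by rewrite /wedge !mxE rmorphB !rmorphM. Qed.

Let W l := uw (chartv z polyC 'X (lf l)).

Lemma Dmx_frame l N g e : size l = n -> (N < n)%N ->
  g N = Mx (take N (lf l)) zeta *m cst e ->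
  \det (Dmx N.+1 g zeta (W l)) =
  (\prod_(r < N) (zeta N - zeta r) * (wedge e (base (nth x0 l N)))%:P) *
  \det (Dmx N g zeta (W l)).
Proof.
move=> sl Nn gN; have sN : (N < size (lf l))%N by rewrite size_map sl.
rewrite Dmx_last => [|r rN].
  rewrite gN evv_frame /W uw_chartv // (wedge_Mx_eq _ _ (mapx polyC x0)) //.
  by rewrite nth_lf ?sl // -map_base wedge_polyC.
have rn : (r < n)%N by apply: ltn_trans rN Nn.
by rewrite gN evv_frame /W uw_chartv // wedge_Mx_lt // size_map sl.
Qed.

(** At [l0] each new row vanishes at the earlier nodes, so the determinant is a product of diagonal
    entries. It has exactly the order in [s] that [Dmx_open] gives as a lower bound. *)
Lemma Dmx_l0 N : (N <= n)%N ->
  exists2 c : K, c != 0 & \det (Dmx N g0 zeta (W l0)) = c%:P * vand zeta N.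
Proof.
elim: N => [|N IH] Nn; first by exists 1; rewrite ?oner_neq0 // det_mx00 /vand big_ord0 mulr1.
have [c c0 cE] := IH (ltnW Nn).
exists (wedge (cmpl (nth x0 l0 N)) (base (nth x0 l0 N)) * c).
  by rewrite wedge_cmpl mulf_neq0 //; case: ifP; rewrite ?oppr_eq0 oner_neq0.
rewrite (Dmx_frame sl0 Nn (e := cmpl (nth x0 l0 N))) // cE /vand big_ord_recr /= polyCM.
ring.
Qed.

Lemma Dmx_open q N g : size q = n -> (N <= n)%N ->
  exists p, \det (Dmx N g zeta (W (zip (nseq n false) q))) = p * vand zeta N.
Proof.
move=> sq Nn; have [P PE] := wv_chart0 (map polyC q) zeta.
apply: (@Dmx_chart0 _ _ _ _ P) => j jN; have jn := leq_trans jN Nn.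
rewrite /W /lf uw_chartv // -zip_lift; have [-> -> _] := unzip_zip (size_nseq n false) sq.
by rewrite -{1}sq -{1}(size_map polyC q) PE ?size_map ?sq.
Qed.

Let D (i : 'I_n) (u : fam) := \det (Dmx (n - i) g0 zeta (uw u)).

(* A product of the determinants of the wedges g_p(zeta_r) /\ w_r, p, r < n - i,
   with multiplicities mu a i is homogeneous of degree a_i - 1 in each w_i, hence
   a linear form on the tensor product; by Newton interpolation it is divisible
   by a power of s, so that it induces a form on the fusion product.  Since a is
   strictly increasing, mu a i > 0, and varying the last row of one factor
   detects step j. *)
Lemma sections (j : 'I_n) :
  exists (xi : 'I_2 -> nat -> {linear gtens K a -> K^o}) (ka : seq (bool * K) -> K),
    ka l0 != 0 /\ forall l e, size l = n ->
      \sum_b \sum_(k < n)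
        (((Mx (take j l) (fun _ => 0) *m map_mx polyC e) b 0)`_k * xi b k (pt a z l) : K)
      = wedge e (base (nth x0 l j)) * ka l.
Proof.
(* The determinant of size [j.+1] has step [j] in its last row; it occurs in the product because
   [mu a i0 > 0]. *)
have [i0 ni0] : exists i0 : 'I_n, (n - i0 = j.+1)%N.
  by exists (rev_ord j); rewrite /=; have := ltn_ord j; lia.
pose gh (h : 'cV[{poly R}]_2) p := if p == j :> nat then h else g0 p.
pose rest u := D i0 u ^+ (mu a i0).-1 * \prod_(i < n | i != i0) D i u ^+ mu a i.
pose F h (u : fam) := \det (Dmx j.+1 (gh h) zeta (uw u)) * rest u.
pose d0 := (\sum_(i < n) (\sum_(k < n - i) k) * mu a i)%N.
have [vc vc0 vcE] : exists2 c : K, c != 0 & \prod_(i < n) vand zeta (n - i) ^+ mu a i = c%:P * 'X^d0.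
  have /choice[c cE] : forall i : 'I_n, exists c : K, c != 0 /\ vand zeta (n - i) = c%:P * 'X^(\sum_(k < n - i) k).
    by move=> i; have [c c0 cE] := vand_zeta (leq_subr i n); exists c.
  exists (\prod_(i < n) c i ^+ mu a i).
    by rewrite prodf_seq_neq0; apply/allP => i _ /=; rewrite expf_neq0 // (cE i).1.
  rewrite rmorph_prod -prodrXr -big_split; apply: eq_bigr => i _ /=.
  by rewrite (cE i).2 exprMn rmorphXn exprM.
have mu0 : mu a i0 = (mu a i0).-1.+1 by rewrite prednK // mu_gt0.
have Fhom h : mhom (fun i => (a i).-1) (F h).
  have hr := mhom_mul (mhom_exp (mu a i0).-1 (mhom_Dmx i0 g0))
    (mhom_prod (index_enum 'I_n) (P := fun i => i != i0)
       (fun i _ => mhom_exp (mu a i) (mhom_Dmx i g0))).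
  have := mhom_mul (mhom_Dmx i0 (gh h)) hr; apply: mhom_ext => [k|u].
    rewrite -(mu_sum a_ge2 a_inc k) [RHS](bigD1 i0) //= addnA; congr (_ + _)%N.
    by rewrite [X in _ = (X * _)%N]mu0 mulSn.
  by rewrite /F /rest /D; have -> : (n - i0)%N = j.+1 by exact: ni0.
have combine (A al : R) (v : fam) (be : 'I_n -> R) : A = al * vand zeta j.+1 ->
    (forall i, D i v = be i * vand zeta (n - i)) ->
    A * rest v = al * (be i0 ^+ (mu a i0).-1 * \prod_(i < n | i != i0) be i ^+ mu a i) * (vc%:P * 'X^d0).
  move=> -> hD; rewrite -vcE [X in _ = _ * X](bigD1 i0) //=.
  have -> : vand zeta (n - i0) ^+ mu a i0 = vand zeta j.+1 * vand zeta (n - i0) ^+ (mu a i0).-1.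
    by rewrite [in LHS]mu0 exprS ni0.
  rewrite /rest hD.
  rewrite (eq_bigr (fun i : 'I_n => be i ^+ mu a i * vand zeta (n - i) ^+ mu a i)) => [|i _].
    rewrite big_split /= exprMn; set P1 := \prod_(_ < n | _) _; set P2 := \prod_(_ < n | _) _.
    ring.
  by rewrite hD exprMn.
have /choice[cc ccE] : forall h, exists c : midx a -> R, forall u, F h u = \sum_m c m * vt polyC u m.
  by move=> ?; apply: mhom_vt (Fhom _) => i; apply: leq_trans (a_ge2 i).
have lamF h l : lam (cc h) (Vl l) = F h (chartv z polyC 'X (lf l)) by rewrite ccE.
have Fvan h : vanishing z (cc h) d0.
  move=> q r sq rd; rewrite lamF.
  have [al alE] := Dmx_open (gh h) sq (ltn_ord j).
  have /choice[be beE] : forall i : 'I_n, exists p, D i (chartv z polyC 'X (lf (zip (nseq n false) q))) = p * vand zeta (n - i).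
    by move=> i; exact: Dmx_open (leq_subr _ _).
  rewrite /F (combine _ _ _ _ alE beE) mulrA coefMXn rd //.
have /choice[xi0 xi0E] : forall h, exists xi : {linear gtens K a -> K^o},
    forall l, size l = n -> xi (pt a z l) = (lam (cc h) (Vl l))`_d0.
  by move=> ?; exact: lam_form.
(* [F] is linear in the row [h], so monomial columns suffice and the resulting forms do not depend
   on [l]. *)
pose del (b : 'I_2) (k : nat) : 'cV[{poly R}]_2 := \col_b' ((b' == b)%:R * 'X^k).
pose kat l := \prod_(r < j) (zeta j - zeta r) * \det (Dmx j g0 zeta (W l)) * rest (chartv z polyC 'X (lf l)).
exists (fun b k => xi0 (del b k)), (fun l => (kat l)`_d0); split.
  have /choice[be beE] : forall i : 'I_n, exists c : K, c != 0 /\ D i (chartv z polyC 'X (lf l0)) = c%:P * vand zeta (n - i).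
    by move=> i; have [c c0 cE] := Dmx_l0 (leq_subr i n); exists c.
  have [c c0 cE] := Dmx_l0 (ltnW (ltn_ord j)).
  have -> : kat l0 = (c * (be i0 ^+ (mu a i0).-1 * \prod_(i < n | i != i0) be i ^+ mu a i) * vc)%:P * 'X^d0.
    rewrite /kat (@combine _ c%:P _ (fun i => (be i)%:P)).
    - have E : (\prod_(i < n | i != i0) be i ^+ mu a i)%:P = \prod_(i < n | i != i0) (be i)%:P ^+ mu a i.
        by rewrite rmorph_prod; apply: eq_bigr => i _; rewrite rmorphXn.
      by rewrite !polyCM E polyC_exp !mulrA.
    - by rewrite cE /vand big_ord_recr /=; ring.
    - by move=> i; rewrite (beE i).2.
  rewrite coefMXn ltnn subnn coefC /= !mulf_neq0 ?expf_neq0 ?(beE _).1 //.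
  by rewrite prodf_seq_neq0; apply/allP => i _; apply/implyP => _; rewrite expf_neq0 // (beE i).1.
move=> l e sl; pose h := Mx (take j (lf l)) zeta *m cst e.
pose u := chartv z polyC 'X (lf l).
have Fh : F h u = (wedge e (base (nth x0 l j)))%:P * kat l.
  rewrite /F (@Dmx_frame l j (gh h) e) //; last by rewrite /gh eqxx.
  have -> : Dmx j (gh h) zeta (W l) = Dmx j g0 zeta (W l).
    by apply/matrixP => p k; rewrite !mxE /gh ltn_eqF.
  by rewrite /kat; ring.
have hsz b : (size (h b 0%R) <= n)%N.
  have sM c : (size (Mx (take j (lf l)) zeta b c) <= n)%N.
    apply: leq_trans (size_Mx _ _ _ _) _.
    by rewrite size_take_min size_map sl; have := ltn_ord j; lia.
  rewrite mulmx2E (leq_trans (size_polyD _ _)) // geq_max; apply/andP; split;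
    rewrite !mxE mulrC mul_polyC; apply: leq_trans (size_scale_leq _ _) _; exact: sM.
have Fsum : F h u = \sum_b \sum_(k < n) (h b 0)`_k * F (del b k) u.
  clearbody h; have [cof cofE] := Dmx_linear j g0 zeta (uw u).
  rewrite /F -/(gh _) cofE.
  under [RHS]eq_bigr => b _ do under eq_bigr => k _ do rewrite -/(gh _) cofE mulrA mulr_sumr.
  under [RHS]eq_bigr => b _ do rewrite -mulr_suml exchange_big.
  rewrite -mulr_suml /= exchange_big; congr (_ * _); apply: eq_bigr => r _ /=.
  under [RHS]eq_bigr => b _ do under eq_bigr => k _ do rewrite mulrA.
  under [RHS]eq_bigr => b _ do rewrite -mulr_suml.
  rewrite -mulr_suml; congr (_ * _).
  have hE b : (h b 0).[zeta r] = \sum_(k < n) (h b 0)`_k * zeta r ^+ k by rewrite (horner_coef_wide _ (hsz b)).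
  rewrite {1}/wedge !mxE /horner_eval !hE !mulr_suml !big_ord_recl big_ord0 addr0.
  have -> : lift ord0 ord0 = 1 :> 'I_2 by exact: val_inj.
  rewrite -sumrN; congr (_ + _); apply: eq_bigr => k _; rewrite /wedge !mxE /horner_eval /= !hornerE; ring.
rewrite -[RHS]coefCM -Fh Fsum coef_sum; apply: eq_bigr => b _.
rewrite coef_sum; apply: eq_bigr => k _.
(* The coefficients of [F (del b k)] of degree below [d0] vanish at every chain, so only the
   constant terms in [s] of the coefficients of [h] survive: the frame at [s = 0]. *)
rewrite xi0E // lamF [RHS]coefM big_ord_recl /= subn0 big1 ?addr0 => [|r _]; last first.
  rewrite /u -lamF (transfer (d := d0) (size_nseq n false)) ?mulr0 //.
  - by move=> q r' sq; exact: Fvan.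
  - by rewrite /bump /=; have := ltn_ord r; lia.
congr (_ * _).
have -> : Mx (take j l) (fun _ => 0) = map_mx (map_poly (horner_eval 0)) (Mx (take j (lf l)) zeta).
  rewrite map_Mx -map_take -map_comp; congr Mx; last first.
    by apply: functional_extensionality_dep => i; rewrite /= /horner_eval /zeta !hornerE ?mulr0.
  rewrite -[LHS]map_id; apply: eq_map => -[b' x]; rewrite /mapx /=; congr (_, _).
  by rewrite /horner_eval hornerC.
rewrite /h !mulmx2E !coefD.
by rewrite /cst !mxE !coefMC !coef_map /= /horner_eval !horner_coef0.
Qed.

End Sections.

(** * Properness and the closure of the orbit *)

Section Places.
Variables (K : numClosedFieldType) (F : fieldType) (io : {rmorphism K -> F}).

(** A [K]-subalgebra [B] of [F] with an ideal [m] of residue field [K]. Neither locality nor the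
    valuation property is imposed; [B] is enlarged only as far as the next coordinate demands. *)
Record place (B m : F -> Prop) : Prop := Place {
  place_io : forall c, B (io c);
  place_add : forall x y, B x -> B y -> B (x + y);
  place_mul : forall x y, B x -> B y -> B (x * y);
  place_mB : forall x, m x -> B x;
  place_madd : forall x y, m x -> m y -> m (x + y);
  place_mmul : forall x y, B x -> m y -> m (x * y);
  place_m1 : ~ m 1;
  place_res : forall x, B x -> exists c, m (x - io c) }.

Section OnePlace.
Variables (B m : F -> Prop).
Hypothesis pl : place B m.

Lemma place_m0 : m 0.
Proof.
have [c mc] := place_res pl (place_io pl 0).
by rewrite -(mul0r (io 0 - io c)) -(rmorph0 io); apply: (place_mmul pl) _ mc => //; exact: (place_io pl).
Qed.

Lemma place_mopp x : m x -> m (- x).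
Proof. by move=> mx; rewrite -mulN1r -(rmorphN1 io); apply: (place_mmul pl) => //; apply: (place_io pl). Qed.

Lemma place_msum (I : Type) (r : seq I) (P : pred I) (f : I -> F) :
  (forall i, P i -> m (f i)) -> m (\sum_(i <- r | P i) f i).
Proof.
move=> h; elim/big_rec: _ => [|i x Pi mx]; first exact: place_m0.
by apply: (place_madd pl) => //; apply: h.
Qed.

Definition residue (x : F) (c : K) : Prop := B x /\ m (x - io c).

Lemma residue_io c : residue (io c) c.
Proof. by split; [exact: (place_io pl) | rewrite subrr; exact: place_m0]. Qed.

Lemma residue_add x y c d : residue x c -> residue y d -> residue (x + y) (c + d).
Proof.
move=> [Bx mx] [By my]; split; first exact: (place_add pl).
by rewrite rmorphD opprD addrACA; apply: (place_madd pl).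
Qed.

Lemma residue_mul x y c d : residue x c -> residue y d -> residue (x * y) (c * d).
Proof.
move=> [Bx mx] [By my]; split; first exact: (place_mul pl).
have -> : x * y - io (c * d) = x * (y - io d) + io d * (x - io c) by rewrite rmorphM; ring.
by apply: (place_madd pl); apply: (place_mmul pl) => //; exact: (place_io pl).
Qed.

Lemma residue_uniq x c d : residue x c -> residue x d -> c = d.
Proof.
move=> [_ mc] [_ md]; apply/eqP; rewrite -subr_eq0; apply/negP => /negP cd.
apply: (place_m1 pl); rewrite -(rmorph1 io) -(mulVf cd) rmorphM.
apply: (place_mmul pl); first exact: (place_io pl).
have -> : io (c - d) = (x - io d) + - (x - io c) by rewrite rmorphB; ring.
by apply: (place_madd pl) => //; exact: place_mopp.
Qed.

Lemma residue_mmap n (q : 'I_n -> F) (c : 'I_n -> K) (p : {mpoly K[n]}) :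
  (forall i, residue (q i) (c i)) -> residue (mmap io q p) p.@[c].
Proof.
move=> qc; have rexp x d k : residue x d -> residue (x ^+ k) (d ^+ k).
  move=> xd; elim: k => [|k IH]; last by rewrite !exprS; exact: residue_mul.
  by rewrite !expr0 -(rmorph1 io); exact: residue_io.
rewrite /meval /mmap; elim/big_ind2: _ => [|x1 x2 y1 y2|mm _].
- by rewrite -(rmorph0 io); exact: residue_io.
- exact: residue_add.
apply: residue_mul; first exact: residue_io.
rewrite /mmap1; elim/big_ind2: _ => [|x1 x2 y1 y2|i _].
- by rewrite -(rmorph1 io); exact: residue_io.
- exact: residue_mul.
exact: rexp.
Qed.

(** The ideal generated by [m] in [B[u]]. *)
Definition mpow (u x : F) : Prop := exists p : {poly F}, (forall i, m p`_i) /\ x = p.[u].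

Lemma mpow_add u x y : mpow u x -> mpow u y -> mpow u (x + y).
Proof.
move=> [p [mp ->]] [q [mq ->]]; exists (p + q); rewrite hornerD; split=> // i.
by rewrite coefD; apply: (place_madd pl).
Qed.

Lemma mpow_mulB u x (p : {poly F}) : (forall i, B p`_i) -> mpow u x -> mpow u (p.[u] * x).
Proof.
move=> Bp [q [mq ->]]; exists (p * q); rewrite hornerM; split=> // i.
by rewrite coefM; apply: place_msum => j _; apply: (place_mmul pl).
Qed.

Lemma mpow_mulK u x (f : {poly K}) : mpow u x -> mpow u ((map_poly io f).[u] * x).
Proof. by apply: mpow_mulB => i; rewrite coef_map; exact: (place_io pl). Qed.

Lemma mpow_mul u x y : mpow u x -> mpow u y -> mpow u (x * y).
Proof. by move=> [p [mp ->]]; apply: mpow_mulB => i; apply: (place_mB pl). Qed.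

Lemma mpow_m u x : m x -> mpow u x.
Proof.
move=> mx; exists x%:P; rewrite hornerC; split=> // i; rewrite coefC.
by case: eqP => // _; exact: place_m0.
Qed.

(** The relation [p(u) = 1] is required only modulo [m]: this replaces the division by a unit
    [1 - q_0] of a local ring in Chevalley's argument. *)
Definition smallrel (u : F) (r : nat) : Prop :=
  exists p : {poly F}, [/\ (forall i, m p`_i), (size p <= r.+1)%N & m (p.[u] - 1)].

(* The key step of Chevalley's extension theorem: of two relations showing that
   m generates the unit ideal in B[u] and in B[1/u], the longer can be
   shortened. *)
Lemma smallrel_reduce u r s : u != 0 -> (0 < s <= r)%N ->
  smallrel u r -> smallrel u^-1 s -> smallrel u r.-1.
Proof.
move=> u0 /andP[s0 sr] [p [mp sp ep]] [q [mq sq eq]].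
(* [e] is 1 modulo [m], and [u ^+ s * e] is the value at [u] of a polynomial of degree below [s]
   with coefficients in [m]. *)
pose e := q.[u^-1] - q`_0.
have me : m (e - 1).
  have -> : e - 1 = (q.[u^-1] - 1) + - q`_0 by rewrite /e; ring.
  by apply: (place_madd pl) => //; exact: place_mopp.
have Be : B e.
  by rewrite -(subrK 1 e) -(rmorph1 io); apply: (place_add pl); [rewrite rmorph1; exact: (place_mB pl me)|exact: (place_io pl)].
pose Q := \poly_(i < s) q`_(s - i).
have QE : Q.[u] = u ^+ s * e.
  rewrite /e (horner_coef_wide _ sq) big_ord_recl /= expr0 mulr1 addrAC subrr add0r.
  rewrite horner_poly mulr_sumr (reindex_inj rev_ord_inj) /=; apply: eq_bigr => i _.
  rewrite /bump /= add1n subKn ?ltn_ord //.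
  rewrite mulrCA; congr (_ * _); rewrite exprVn.
  have := ltn_ord i; move: (nat_of_ord i) => k ks.
  by rewrite -[in RHS](subnK ks) exprD mulfK // expf_neq0.
(* Multiply the relation [p] by [e] and replace [e u^r] in its top term by [u^(r-s) Q(u)], which has
   lower degree. *)
pose P := e *: (p - p`_r *: 'X^r) + p`_r *: ('X^(r - s) * Q).
have PE : P.[u] = e * p.[u].
  have ur : u ^+ (r - s) * u ^+ s = u ^+ r by rewrite -exprD subnK.
  rewrite /P hornerD !hornerZ hornerD hornerN !hornerZ hornerM !horner_exp !hornerX QE -ur.
  by move: (u ^+ (r - s)) (u ^+ s) => x y; ring.
exists P; split=> [i||].
- rewrite /P coefD !coefZ coefB coefZ coefXn coefXnM; apply: (place_madd pl).
    apply: (place_mmul pl) => //; case: eqP => [->|_]; last by rewrite mulr0 subr0.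
    by rewrite mulr1 subrr; exact: place_m0.
  apply: (place_mmul pl); first exact: (place_mB pl).
  case: ifP => _; first exact: place_m0.
  by rewrite coef_poly; case: ifP => _; [exact: mq | exact: place_m0].
- rewrite prednK ?(leq_trans s0) //; apply/leq_sizeP => i ri.
  rewrite /P coefD !coefZ coefB coefZ coefXn coefXnM.
  have -> : e * (p`_i - p`_r * (i == r)%:R) = 0.
    have [->|ir] := eqVneq i r; first by rewrite mulr1 subrr mulr0.
    rewrite mulr0 subr0 nth_default ?mulr0 //.
    by apply: leq_trans sp _; rewrite ltn_neqAle eq_sym ir.
  rewrite add0r; case: ltnP => _; first by rewrite mulr0.
  by rewrite coef_poly; case: ltnP => [|_]; [lia | rewrite mulr0].
rewrite PE; have -> : e * p.[u] - 1 = e * (p.[u] - 1) + (e - 1) by ring.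
by apply: (place_madd pl) => //; apply: (place_mmul pl).
Qed.

Lemma smallrel0 u : ~ smallrel u 0.
Proof.
move=> [p [mp sp e]]; apply: (place_m1 pl).
have -> : 1 = p`_0 + - (p.[u] - 1).
  by rewrite (size1_polyC sp) hornerC coefC /=; ring.
by apply: (place_madd pl) => //; exact: place_mopp.
Qed.

Lemma smallrel_absurd u r s : u != 0 -> smallrel u r -> smallrel u^-1 s -> False.
Proof.
have [N] := ubnP (r + s); elim: N u r s => // N IH u r s rs u0 hr hs.
case: (posnP r) => [r0|r0]; first by apply: (@smallrel0 u); rewrite -r0.
case: (posnP s) => [s0|s0]; first by apply: (@smallrel0 u^-1); rewrite -s0.
have [sr|rs'] := leqP s r.
  apply: (IH u r.-1 s) => //; first by lia.
  by apply: smallrel_reduce hs; rewrite ?s0.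
apply: (IH u r s.-1) => //; first by lia.
by apply: (@smallrel_reduce _ _ r); rewrite ?invr_eq0 ?r0 ?invrK // ltnW.
Qed.

Lemma mpow1_smallrel u : mpow u 1 -> exists r, smallrel u r.
Proof.
move=> [p [mp e]]; exists (size p), p; split=> //.
by rewrite -e subrr; exact: place_m0.
Qed.

(** Since [B] is [K] plus [m], the quotient of [B[u]] by the ideal generated by [m] is [K[X] / J],
    nonzero by hypothesis. As [K] is algebraically closed, [J] has a common root [c], and [u] is
    given the residue [c]. *)
Lemma place_extend1 u : ~ mpow u 1 ->
  exists B' m', [/\ place B' m', (forall x, B x -> B' x), (forall x, m x -> m' x) & B' u].
Proof.
move=> n1; pose J (f : {poly K}) := mpow u (map_poly io f).[u].
have JD f g : J f -> J g -> J (f + g).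
  by rewrite /J rmorphD hornerD; exact: mpow_add.
have JM f g : J g -> J (f * g).
  by rewrite /J rmorphM hornerM; exact: mpow_mulK.
(* For [J = 0] any [c] will do; otherwise [c] is a root of a generator of [J], found by descent on
   the degree. *)
have [c Jc] : exists c, forall f, J f -> f.[c] = 0.
  have [[f0 [Jf0 f00]]|nJ] := pselect (exists f, J f /\ f != 0); last first.
    by exists 0 => f Jf; case: (eqVneq f 0) => [->|f0]; rewrite ?horner0 //; case: nJ; exists f.
  have [N] := ubnP (size f0); elim: N f0 Jf0 f00 => // N IH g Jg g0 sg.
  have [allg|] := pselect (forall f, J f -> g %| f); last first.
    move=> /existsNP[f /not_implyP[Jf /negP ngf]].
    have r0 : f %% g != 0 by move: ngf; rewrite /dvdp.
    apply: (IH (f %% g)) => //.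
      have -> : f %% g = f + (- (f %/ g)) * g by rewrite {2}(divp_eq f g); ring.
      by apply: JD => //; apply: JM.
    by apply: leq_trans (ltn_modpN0 f g0) _; rewrite -ltnS.
  have sg1 : size g != 1%N.
    apply/eqP => sg1; have /size_poly1P[k k0 gk] := introT eqP sg1.
    apply: n1; have := JM (k^-1)%:P g Jg.
    by rewrite gk -polyCM mulVf // /J map_polyC hornerC /= rmorph1.
  have /closed_rootP[c /rootP gc] := sg1.
  by exists c => f /allg /dvdpP[q ->]; rewrite hornerM gc mulr0.
pose B' x := exists f : {poly K}, mpow u (x - (map_poly io f).[u]).
pose m' x := exists f : {poly K}, mpow u (x - (map_poly io f).[u]) /\ f.[c] = 0.
exists B', m'; split.
- split.
  + move=> k; exists k%:P; rewrite map_polyC hornerC subrr; exact: mpow_m place_m0.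
  + move=> x y [f hf] [g hg]; exists (f + g); rewrite rmorphD hornerD opprD addrACA.
    exact: mpow_add.
  + move=> x y [f hf] [g hg]; exists (f * g); rewrite rmorphM hornerM.
    set a := _.[u] in hf *; set b := _.[u] in hg *.
    have -> : x * y - a * b = (x - a) * (y - b) + (b * (x - a) + a * (y - b)) by ring.
    apply: mpow_add; first exact: mpow_mul.
    by apply: mpow_add; apply: mpow_mulK.
  + by move=> x [f [hf _]]; exists f.
  + move=> x y [f [hf f0]] [g [hg g0]]; exists (f + g); split; last by rewrite hornerD f0 g0 addr0.
    by rewrite rmorphD hornerD opprD addrACA; exact: mpow_add.
  + move=> x y [f hf] [g [hg g0]]; exists (f * g); split; last by rewrite hornerM g0 mulr0.
    rewrite rmorphM hornerM.
    set a := _.[u] in hf *; set b := _.[u] in hg *.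
    have -> : x * y - a * b = (x - a) * (y - b) + (b * (x - a) + a * (y - b)) by ring.
    apply: mpow_add; first exact: mpow_mul.
    by apply: mpow_add; apply: mpow_mulK.
  + move=> [f [hf f0]]; have : J (1 - f) by rewrite /J rmorphB rmorph1 hornerD hornerN -polyC1 hornerC.
    by move=> /Jc; rewrite !hornerE f0 subr0 => /eqP; rewrite oner_eq0.
  + move=> x [f hf]; exists f.[c], (f - (f.[c])%:P); split; last by rewrite !hornerE subrr.
    rewrite rmorphB /= map_polyC hornerD hornerN hornerC.
    by rewrite opprB addrA subrK.
- move=> x /(place_res pl)[k mk]; exists k%:P; rewrite map_polyC hornerC; exact: mpow_m.
- by move=> x mx; exists 0; rewrite rmorph0 !horner0 subr0; split=> //; exact: mpow_m.
by exists 'X; rewrite map_polyX hornerX subrr; exact: mpow_m place_m0.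
Qed.

Lemma place_extend u : u != 0 ->
  exists B' m', [/\ place B' m', (forall x, B x -> B' x), (forall x, m x -> m' x) & B' u \/ B' u^-1].
Proof.
move=> u0; have [h|h] := pselect (mpow u 1); last first.
  by have [B' [m' [? ? ? ?]]] := place_extend1 h; exists B', m'; split=> //; left.
have [h'|h'] := pselect (mpow u^-1 1); last first.
  by have [B' [m' [? ? ? ?]]] := place_extend1 h'; exists B', m'; split=> //; right.
have [r hr] := mpow1_smallrel h; have [s hs] := mpow1_smallrel h'.
by case: (smallrel_absurd u0 hr hs).
Qed.

End OnePlace.

(* Every chain of lattices over F lies in a chart whose coordinates are
   integral at a suitable extension of a given place: this is the properness
   of the variety of chains. *)
Lemma chart_place B m h l : place B m -> \det h = 1 ->
  exists B' m' l' cs, [/\ place B' m', (forall x, B x -> B' x), (forall x, m x -> m' x) &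
    [/\ eqv h l l', size cs = size l' &
        forall i, (i < size l')%N -> residue B' m' (nth 0 (map snd l') i) (nth 0 cs i)]].
Proof.
elim: l h B m => [|x l IH] h B m pl dh.
  by exists B, m, [::], [::]; split=> //; split=> //; exact: eqv_nil.
suff [eps [B' [m' [pl' BB mm [v0 Bq]]]]] : exists (eps : bool) B' m',
    [/\ place B' m', (forall x, B x -> B' x), (forall x, m x -> m' x) &
     (ev 0 h *m base x) (if eps then 0 else 1) 0 != 0 /\
     B' ((ev 0 h *m base x) (if eps then 1 else 0) 0 / (ev 0 h *m base x) (if eps then 0 else 1) 0)].
  have [h' d' hl] := eqv_step l dh (col2_base v0).
  have [B2 [m2 [l' [cs [pl2 BB2 mm2 [e sc rc]]]]]] := IH h' B' m' pl' d'.
  have [c mc] := place_res pl' Bq.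
  set x' := (eps, _) in hl; exists B2, m2, (x' :: l'), (c :: cs); split=> //.
  - by move=> y /BB /BB2.
  - by move=> y /mm /mm2.
  split; first exact: hl e.
    by rewrite /= sc.
  case=> [|i] /= il; last exact: rc.
  by split; [apply: BB2 | apply: mm2].
set v := ev 0 h *m base x.
have [v0|v0] := eqVneq (v 0 0) 0.
  have v1 : v 1 0 != 0.
    by apply/eqP => v1; have := ev_base_neq0 x dh; rewrite -/v (col2_eq0 v0 v1) eqxx.
  exists false, B, m; split=> //; split=> //=.
  by rewrite v0 mul0r -(rmorph0 io); exact: (place_io pl).
have [v1|v1] := eqVneq (v 1 0) 0.
  exists true, B, m; split=> //; split=> //=.
  by rewrite v1 mul0r -(rmorph0 io); exact: (place_io pl).
(* Both coordinates are nonzero: extending the place makes one of their two ratios integral, and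
   this selects the chart. *)
have [B' [m' [pl' BB mm]]] := place_extend pl (mulf_neq0 v0 (invr_neq0 v1)).
by case=> hB; [exists false, B', m' | exists true, B', m'; rewrite invf_div in hB]; split.
Qed.

End Places.

(** * Coordinates of the vectors, and the action of the group on chains *)

Section ChartPolynomials.
Variables (K : numClosedFieldType) (n : nat) (a : 'I_n -> nat) (z : 'I_n -> K).
Local Notation pt := (@pt K n a z).
Local Notation gtens := (gtens K a).
Local Notation Vl := (@Vl K n a z).

Lemma coefV_coord d m V : (cls a z d (coefV V d) : tens K a) m =
  (lam (fun m' => (cls a z d ([ffun j => (j == m')%:R] : tens K a) m)%:P) V)`_d.
Proof.
rewrite lam_coef; pose f (v : {ffun midx a -> K^o}) : K^o := cls a z d v m.
have fl : linear f by move=> k x y; rewrite /f linearP !ffunE.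
pose lf := GRing.isLinear.Build K {ffun midx a -> K^o} K^o _ f fl.
exact: (ffun_functional (HB.pack f lf : {linear {ffun midx a -> K^o} -> K^o}) (coefV V d)).
Qed.

Lemma gtens_scale k (x : gtens) d m : ((k *: x) d : tens K a) m = k * (x d : tens K a) m.
Proof. by rewrite !ffunE. Qed.

Definition ccls (d : nat) (m m' : midx a) : {poly K} :=
  (cls a z d ([ffun j => (j == m')%:R] : tens K a) m)%:P.

(** [cls d] annihilates [F_r] for [r < d], so a coordinate of the class is a form divisible by
    [s^d], first on the standard chart and then on every chart. *)
Lemma ccls_vanish d m eps r : size eps = n -> (r < d)%N -> (lamu z (ccls d m) eps)`_r = 0.
Proof.
apply: (transfer_u (size_nseq n false)) => q r' sq rd.
have e := coefV_coord d m (fun m' => (coefV (Vl (zip (nseq n false) q)) r' m')%:P * 'X^d).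
have eV : coefV (fun m' => (coefV (Vl (zip (nseq n false) q)) r' m')%:P * 'X^d) d
    = coefV (Vl (zip (nseq n false) q)) r'.
  by apply/ffunP => m'; rewrite ffunE coefMXn ltnn subnn coefC.
rewrite lam_coef; move: e; rewrite eV cls_pred; last first.
  by apply: Fil_predE rd _; exact: rees_chart0.
rewrite ffunE lam_coef => e2; apply: etrans _ (esym e2); apply: eq_bigr => m' _; congr (_ * _).
by rewrite !ffunE coefMXn ltnn subnn coefC.
Qed.

(* The coordinates of pt on the chart eps. *)
Definition Gu (eps : seq bool) (d : nat) (m : midx a) : {mpoly K[n]} :=
  (lamu z (ccls d m) eps)`_d.

Lemma pt_coord l (d : 'I_(degbound a)) m : size l = n ->
  (pt l d : tens K a) m = (Gu (map fst l) d m).@[sv (map snd l)].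
Proof. by move=> sl; rewrite /Gu lamu_coef // ffunE coefV_coord. Qed.

(** Stated over an extension [F] of [K] so that it also applies to the generic point of the
    orbit. *)
Lemma Gu_eqv (F : fieldType) (io : {rmorphism K -> F}) l l' :
  eqv 1%:M l l' -> size l = n ->
  exists2 k : F, k != 0 & forall d m, (d < degbound a)%N ->
    mmap io (sv (map snd l)) (Gu (map fst l) d m) =
    k * mmap io (sv (map snd l')) (Gu (map fst l') d m).
Proof.
move=> e sl; have sl' : size l' = n by rewrite -(eqv_size e).
have [N NE] : exists N, N = degbound a by exists (degbound a).
have [Q [C [sQ eQ C0 CE]]] := compare a z io N (det1 _ _) e sl.
exists (tres C) => // d m dN.
have dN2 : (d < N.+2)%N by rewrite NE; do 2!apply: leqW.
set ioO : {rmorphism K -> trunc F N} := to_trunc F N \o (polyC \o io) in CE.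
pose Q0 := map (to_trunc F N \o polyC) (map snd l).
have E : uev n ioO (to_trunc F N 'X) Q0 (lamu z (ccls d m) (map fst l)) =
    C * uev n ioO (to_trunc F N 'X) Q (lamu z (ccls d m) (map fst l')).
  rewrite [LHS]rmorph_sum [X in C * X]rmorph_sum mulr_sumr; apply: eq_bigr => m' _.
  have mul Q' p V : uev n ioO (to_trunc F N 'X) Q' (map_poly (@mpolyC n K) p * V)
      = (map_poly ioO p).[to_trunc F N 'X] * uev n ioO (to_trunc F N 'X) Q' V.
    by rewrite -(@uev_map_mpolyC _ n _ ioO _ Q'); exact: rmorphM.
  rewrite [LHS]mul [X in C * X]mul [RHS]mulrCA; congr (_ * _).
  rewrite -CE /Q0 -(iu_to_trunc z io N m' sl) /chartV; congr (vt _ _ m').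
  apply: functional_extensionality_dep => i.
  by rewrite map_mx1 ev1 mul1mx.
have vE (L : seq (bool * F)) : size L = n -> forall r, (r < d)%N -> (lamu z (ccls d m) (map fst L))`_r = 0.
  by move=> sL r rd; apply: ccls_vanish => //; rewrite size_map.
have [_ A] := coef_uev_trunc io Q0 1 dN2 (vE l sl).
have [_ B] := coef_uev_trunc io Q C dN2 (vE l' sl').
move: A; rewrite mul1r [uev _ _ _ _ _]E B rmorph1 mul1r eQ => ->.
congr (mmap _ (sv _) _); rewrite /Q0 -map_comp -[LHS]map_id; apply: eq_map => x.
by rewrite [RHS]tres_to_trunc coefC.
Qed.

Lemma mmap_id p (v : 'I_n -> K) : mmap (idfun : {rmorphism K -> K}) v p = p.@[v].
Proof. by []. Qed.

Lemma pt_eqv l l' : eqv 1%:M l l' -> size l = n ->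
  exists2 k : K, k != 0 & pt l = k *: pt l'.
Proof.
move=> e sl; have sl' : size l' = n by rewrite -(eqv_size e).
have [k k0 kE] := Gu_eqv (idfun : {rmorphism K -> K}) e sl; exists k => //.
apply/ffunP => d; apply/ffunP => m; rewrite pt_coord // -mmap_id kE // mmap_id.
by rewrite gtens_scale pt_coord.
Qed.

Hypothesis a_gt0 : forall i, (0 < a i)%N.

Lemma nilexp_pt X (p : {poly %/ ('X^n : {poly K})}) l l' : X *m X = 0 ->
  size l = n -> eqv (1%:M + (p : {poly K}) *: map_mx polyC X) l l' ->
  exists2 k : K, k != 0 & nilexp (gact_currents z X p) (pt l) = k *: pt l'.
Proof.
move=> X2 sl e; have sl' : size l' = n by rewrite -(eqv_size e).
have cE i : curr z p i = (map_poly polyC (p : {poly K})).[zt z i].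
  have sp : (size (map_poly polyC (p : {poly K}) : {poly {poly K}}) <= n)%N.
    rewrite size_map_polyC; apply: leq_trans (size_npoly p) _.
    by rewrite mk_monic_Xn size_polyXn /=; have := ltn_ord i; lia.
  by rewrite (horner_coef_wide _ sp); apply: eq_bigr => j _; rewrite coef_map.
rewrite /pt nilexp_Cls //; last exact: rees_chart.
have -> : vt polyC (fun i => chartv z polyC 'X (map (mapx polyC) l) i +
      curr z p i *: (map_mx polyC X *m chartv z polyC 'X (map (mapx polyC) l) i))
    = moved z (1%:M + (p : {poly K}) *: map_mx polyC X) l :> (midx a -> _).
  rewrite moved_unipotent; congr vt; apply: functional_extensionality_dep => i.
  by rewrite cE.
have dh := det_nil (p : {poly K}) X2.
have [k k0 kE] := moved_compare a z (degbound a) dh e sl.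
exists k => //; apply/ffunP => d; apply/ffunP => m.
rewrite gtens_scale [in LHS]ffunE [in RHS]ffunE !coefV_coord.
have dN2 : (d < (degbound a).+2)%N by do 2!apply: leqW.
have vE r : (r < d)%N -> (lamu z (ccls d m) (map fst l'))`_r = 0.
  by move=> rd; apply: ccls_vanish => //; rewrite size_map.
by have [_ <-] := kE (ccls d m) d dN2 vE.
Qed.

Lemma fusion_pt l : fusion z (pt l).
Proof. by move=> d; rewrite ffunE; exact: cls_gr. Qed.

Lemma fusion_line l v : v \in <[pt l]>%VS -> fusion z v.
Proof.
move=> /vlineP[k ->] d; rewrite ffunE.
by apply: rpredZ; exact: fusion_pt.
Qed.

Lemma v_A_pt : v_A a z = pt (zip (nseq n false) (nseq n 0)).
Proof.
have VE : Vl (zip (nseq n false) (nseq n 0)) = vt polyC (fun _ => base (false, 0)).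
  rewrite /Vl /chartV; congr vt; apply: functional_extensionality_dep => i.
  rewrite /chartv; have : (rev_ord i < n)%N by exact: ltn_ord.
  move: (nat_of_ord (rev_ord i)) (fun j : nat => (zz z j)%:P * 'X) => j.
  elim: (n) j => // k IH [|j] zt' //= jk.
  rewrite /mapx /= rmorph0 IH //.
  have [g00 g01 g10 g11] := gmE (false, 0 : {poly K}) (zt' j.+1 - zt' 0%N).
  by apply: mx2P => x; rewrite [x]ord1 mulmx2E !base0E !base1E ?g00 ?g01 ?g10 ?g11 /=; ring.
apply/ffunP => d; rewrite !ffunE.
have -> : coefV (Vl (zip (nseq n false) (nseq n 0))) d = (d == 0%N :> nat)%:R *: lowest K a.
  rewrite VE; apply/ffunP => m; rewrite ffunE vt_lowest coefC [RHS]ffunE.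
  by case: eqP => _; [rewrite scale1r | rewrite scale0r].
by case: eqP => [->|_]; rewrite ?scale1r // scale0r linear0.
Qed.

(** At colliding nodes Newton coefficients become Taylor coefficients: [1 + P e] moves the zero
    chain to the one whose coordinates are the coefficients of [P]. Hence the orbit contains the
    whole standard chart. *)
Lemma eqv_unipotent (q : seq K) (P : {poly K}) : (forall i, (i < size q)%N -> P`_i = nth 0 q i) ->
  eqv (1%:M + P *: map_mx polyC (nilE K)) (zip (nseq (size q) false) (nseq (size q) 0))
      (zip (nseq (size q) false) q).
Proof.
elim: q P => [|x q IH] P Pq /=; first exact: eqv_nil.
have hE (p : {poly K}) : [/\ (1%:M + p *: map_mx polyC (nilE K)) 0 0 = 1,
   (1%:M + p *: map_mx polyC (nilE K)) 0 1 = p,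
   (1%:M + p *: map_mx polyC (nilE K)) 1 0 = 0 &
   (1%:M + p *: map_mx polyC (nilE K)) 1 1 = 1].
  by split; rewrite !mxE /=; ring.
pose P' := drop_poly 1 P.
have PE : P = x%:P + P' * 'X.
  rewrite -{1}(poly_take_drop 1 P) expr1; congr (_ + _).
  by apply/polyP => i; rewrite coef_take_poly coefC; case: i => //=; rewrite Pq.
have ev0 : ev 0 (1%:M + P *: map_mx polyC (nilE K)) *m base (false, 0) = 1 *: base (false, x).
  have evE i j : ev 0 (1%:M + P *: map_mx polyC (nilE K)) i j
     = ((1%:M + P *: map_mx polyC (nilE K)) i j).[0] by rewrite mxE.
  have [h00 h01 h10 h11] := hE P.
  rewrite scale1r; apply: mx2P => k; rewrite [k]ord1 mulmx2E !evE !base0E !base1E ?h00 ?h01 ?h10 ?h11 /=.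
    by rewrite PE !hornerE; ring.
  by rewrite !hornerE; ring.
apply: (@eqv_cons _ _ (1%:M + P' *: map_mx polyC (nilE K)) _ _ _ _ _ ev0); last first.
  by apply: IH => i iq; rewrite coef_drop_poly addn1 Pq.
have [h00 h01 h10 h11] := hE P; have [k00 k01 k10 k11] := hE P'.
have [g00 g01 g10 g11] := gmE (false, (0 : K)%:P) ('X - 0%:P).
have [f00 f01 f10 f11] := gmE (false, x%:P) ('X - 0%:P).
rewrite /gX; apply: mx2P; apply: ord2P; rewrite !mulmx2E ?h00 ?h01 ?h10 ?h11 ?k00 ?k01 ?k10 ?k11
  ?g00 ?g01 ?g10 ?g11 ?f00 ?f01 ?f10 ?f11 /= ?polyC0 ?PE; ring.
Qed.

Lemma in_qpoly_Poly (q : seq K) i : size q = n -> (i < n)%N ->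
  (in_qpoly ('X^n : {poly K}) (Poly q) : {poly K})`_i = nth 0 q i.
Proof.
move=> sq iq; rewrite in_qpoly_small ?coef_Poly // (leq_ltn_trans (size_Poly q)) //.
by rewrite mk_monic_Xn size_polyXn sq; case: (n) iq.
Qed.

Lemma vlineZ (V : vectType K) k (v : V) : k != 0 -> <[k *: v]>%VS = <[v]>%VS.
Proof.
move=> k0; apply/eqP; rewrite eqEsubv -!memvE memvZ ?memv_line //=.
by rewrite -{1}(scale1r v) -(mulVf k0) -scalerA memvZ ?memv_line.
Qed.

Lemma orbit_cell q : size q = n -> @orbit_A K n a z <[pt (zip (nseq n false) q)]>%VS.
Proof.
move=> sq; pose p : {poly %/ ('X^n : {poly K})} := in_qpoly ('X^n : {poly K}) (Poly q).
have pq i : (i < size q)%N -> (p : {poly K})`_i = nth 0 q i.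
  by rewrite sq; exact: in_qpoly_Poly.
have := eqv_unipotent pq; rewrite sq => e.
have [_ _ s0] := unzip_zip (size_nseq n false) (size_nseq n (0 : K)).
have [k k0 kE] := nilexp_pt (nilE2 K) s0 e.
exists (one_plus (nilE K) p *m 1%:M), (fun m => nilexp (gact_currents z (nilE K) p) (id m)).
split; last by rewrite /= v_A_pt kE vlineZ.
  rewrite mulmx1 /one_plus det2E !mxE /= !scale0r scale1r; ring.
exact: (@acts_exp K n a z (nilE K) p 1%:M id (nilE2 K) (@acts_one K n a z)).
Qed.

Lemma gact_currents_scale X (p : {poly %/ ('X^n : {poly K})}) k (m : gtens) :
  gact_currents z X p (k *: m) = k *: gact_currents z X p m.
Proof.
rewrite /gact_currents scaler_sumr; apply: eq_bigr => j _.
rewrite scalerA mulrC -scalerA; congr (_ *: _); apply/ffunP => d.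
rewrite [RHS]ffunE !ffunE scaler_sumr; apply: eq_bigr => s _.
by rewrite [(k *: m) s]ffunE !linearZ.
Qed.

Lemma nilexp_scale (T : gtens -> gtens) k m : (forall m, T (k *: m) = k *: T m) ->
  nilexp T (k *: m) = k *: nilexp T m.
Proof.
move=> Tk; rewrite /nilexp scaler_sumr; apply: eq_bigr => i _.
rewrite scalerA mulrC -scalerA; congr (_ *: _).
by elim: (val i) => //= j ->.
Qed.

Lemma orbit_chart L : @orbit_A K n a z L -> exists2 l, size l = n & L = <[pt l]>%VS.
Proof.
move=> [g [T [_ gT ->]]].
suff [l [k [sl k0 ->]]] : exists l k, [/\ size l = n, k != 0 & T (v_A a z) = k *: pt l].
  by exists l; rewrite ?vlineZ.
elim: gT => {g T} [|X p g T X2 _ [l [k [sl k0 E]]]].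
  exists (zip (nseq n false) (nseq n 0)), 1; rewrite size_zip !size_nseq minnn oner_neq0 scale1r.
  by rewrite v_A_pt.
have [l' e] := eqv_exists l (det_nil (p : {poly K}) X2).
have [k' k'0 E'] := nilexp_pt X2 sl e.
exists l', (k * k'); rewrite -(eqv_size e) mulf_neq0 //; split=> //.
rewrite E nilexp_scale ?E' ?scalerA // => m; exact: gact_currents_scale.
Qed.

End ChartPolynomials.

Local Open Scope classical_set_scope.

(** * Homogeneous polynomials and closed sets in projective space *)

Section Projective.
Variable K : numClosedFieldType.

Lemma homX m (i : 'I_m) : ('X_i : {mpoly K[m]}) \is 1.-homog.
Proof. by rewrite dhomogX; apply/eqP; exact: mdeg1. Qed.

Lemma mmap_comp (F : comNzRingType) (io : {rmorphism K -> F}) m n (v : 'I_n -> F)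
    (G : 'I_m -> {mpoly K[n]}) p :
  mmap io v (mmap (@mpolyC n K) G p) = mmap io (fun i => mmap io v (G i)) p.
Proof.
rewrite [X in mmap io v X]/mmap rmorph_sum; apply: eq_bigr => mm _.
rewrite rmorphM /= mmapC; congr (_ * _).
rewrite /mmap1 rmorph_prod; apply: eq_bigr => i _; exact: rmorphXn.
Qed.

Lemma mmap_homogZ (F : comNzRingType) (io : {rmorphism K -> F}) n d (p : {mpoly K[n]}) k (v : 'I_n -> F) :
  p \is d.-homog -> mmap io (fun i => k * v i) p = k ^+ d * mmap io v p.
Proof.
move=> /dhomogP hp; rewrite /mmap mulr_sumr !big_seq; apply: eq_bigr => m /hp dm.
have <- : mdeg m = d by exact: dm.
rewrite mulrCA; congr (_ * _); rewrite /mmap1 mdegE -prodrXr -big_split.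
by apply: eq_bigr => i _; exact: exprMn.
Qed.

Variable W : vectType K.
Implicit Types (X : set {vspace W}) (p : {mpoly K[\dim {:W}]}) (v : W).

Lemma peval_mmap p v :
  peval p v = mmap (idfun : {rmorphism K -> K}) (fun i => coord (vbasis {:W}) i v) p.
Proof. by []. Qed.

Lemma pevalD p q v : peval (p + q) v = peval p v + peval q v.
Proof. by rewrite !peval_mmap rmorphD. Qed.

Lemma pevalB p q v : peval (p - q) v = peval p v - peval q v.
Proof. by rewrite !peval_mmap rmorphB. Qed.

Lemma pevalM p q v : peval (p * q) v = peval p v * peval q v.
Proof. by rewrite !peval_mmap rmorphM. Qed.

Lemma pevalXn p k v : peval (p ^+ k) v = peval p v ^+ k.
Proof. by rewrite !peval_mmap rmorphXn. Qed.

Lemma peval_scale c p v : peval (c *: p) v = c * peval p v.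
Proof. by rewrite !peval_mmap mmapZ. Qed.

Lemma pevalX i v : peval 'X_i v = coord (vbasis {:W}) i v.
Proof. exact: mevalXU. Qed.

Lemma pevalZ d p k v : p \is d.-homog -> peval p (k *: v) = k ^+ d * peval p v.
Proof.
move=> hp; rewrite !peval_mmap -(mmap_homogZ _ _ _ hp).
by apply: meval_eq => i; rewrite linearZ.
Qed.

Lemma peval_line d p v w : p \is d.-homog -> peval p v = 0 -> w \in <[v]>%VS -> peval p w = 0.
Proof. by move=> hp pv /vlineP[k ->]; rewrite (pevalZ _ _ hp) pv mulr0. Qed.

Lemma zclosureE X L : (forall L', X L' -> proj_space L') ->
  zclosure X L <-> proj_space L /\
    forall d p, p \is d.-homog -> (forall L' v, X L' -> v \in L' -> peval p v = 0) ->
      forall v, v \in L -> peval p v = 0.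
Proof.
move=> XP; split=> [cL|[PL h] Z [[S hS ->] XZ]]; last first.
  split=> // p v Sp vL; have [d hd] := hS p Sp.
  by apply: h hd _ v vL => L' v' /XZ[_ +] v'L; apply.
pose S p := (exists d, p \is d.-homog) /\ (forall L' v, X L' -> v \in L' -> peval p v = 0).
pose Z := [set L : {vspace W} | proj_space L /\ forall p v, S p -> v \in L -> peval p v = 0].
have [] : Z L.
  apply: cL; split; first by exists S => // p [].
  move=> L' XL'; split; first exact: XP.
  by move=> p v [_ h] /(h _ _ XL').
move=> PL h; split=> // d p hd hX v; apply: h; split=> //; by exists d.
Qed.

Lemma proj_line v : v != 0 -> proj_space <[v]>%VS.
Proof. by move=> v0; rewrite /proj_space /= dim_vline v0. Qed.

Lemma proj_spaceE L v : proj_space L -> v \in L -> v != 0 -> L = <[v]>%VS.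
Proof.
move=> L1 vL v0; apply/esym/eqP; rewrite eqEdim -memvE vL /=.
by rewrite [\dim L]L1 dim_vline v0.
Qed.

Lemma proj_space_gen (L : {vspace W}) : proj_space L -> exists2 v, v != 0 & L = <[v]>%VS.
Proof.
move=> L1; have v0 : vpick L != 0.
  by rewrite vpick0; apply/eqP => L0; move: L1; rewrite /proj_space /= L0 dimv0.
by exists (vpick L) => //; exact: proj_spaceE L1 (memv_pick L) v0.
Qed.

Lemma coord_inj (u v : W) :
  (forall i, coord (vbasis {:W}) i u = coord (vbasis {:W}) i v) -> u = v.
Proof.
move=> h; rewrite (coord_vbasis (memvf v)) [LHS](coord_vbasis (memvf u)).
by apply: eq_bigr => i _; rewrite h.
Qed.

Lemma lform_exists (xi : {linear W -> K^o}) :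
  exists2 p : {mpoly K[\dim {:W}]}, p \is 1.-homog & forall v, peval p v = xi v.
Proof.
exists (\sum_(i < \dim {:W}) (xi (vbasis {:W})`_i : K) *: 'X_i).
  by apply: rpred_sum => i _; apply: dhomogZ; exact: homX.
move=> v; rewrite peval_mmap raddf_sum /=.
rewrite [in RHS](coord_vbasis (memvf v)) linear_sum; apply: eq_bigr => i _.
by rewrite linearZ mmapZ mmapX mmap1U mulrC.
Qed.

Lemma coord_neq0 (v : W) : v != 0 -> exists i, coord (vbasis {:W}) i v != 0.
Proof.
move=> v0; apply: contrapT => /forallNP h; case/eqP: v0.
apply: coord_inj => i; rewrite linear0.
by move/negP: (h i); rewrite negbK => /eqP.
Qed.

Lemma coord_line (u v : W) : u != 0 -> v != 0 ->
  (forall i j, coord (vbasis {:W}) i u * coord (vbasis {:W}) j v =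
               coord (vbasis {:W}) j u * coord (vbasis {:W}) i v) ->
  <[u]>%VS = <[v]>%VS.
Proof.
move=> u0 /coord_neq0[j vj] h.
have uE : u = (coord (vbasis {:W}) j u / coord (vbasis {:W}) j v) *: v.
  by apply: coord_inj => i; rewrite linearZ /= mulrAC -h mulfK.
rewrite uE vlineZ //; apply: contra_neq u0 => c0.
by rewrite uE c0 scale0r.
Qed.

End Projective.

Local Open Scope classical_set_scope.

Lemma wedge_dual (R : comNzRingType) (x : bool * R) :
  wedge (base (~~ x.1, 0)) (base x) = (-1) ^+ x.1.
Proof. by rewrite /wedge !base0E !base1E /=; case: x.1; rewrite /= ?expr0 ?expr1; ring. Qed.

Section Closure.
Variables (K : numClosedFieldType) (n : nat) (a : 'I_n -> nat) (z : 'I_n -> K).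
Local Notation pt := (@pt K n a z).
Local Notation gtens := (gtens K a).
Local Notation cd i := (coord (vbasis {:gtens}) i).
Implicit Types (l : seq (bool * K)).

Definition gdelta (d : 'I_(degbound a)) (m : midx a) : gtens :=
  [ffun d' => if d' == d then ([ffun m' => (m' == m)%:R] : tens K a) else 0].

Lemma gtens_expand (x : gtens) : x = \sum_d \sum_m (x d : tens K a) m *: gdelta d m.
Proof.
have sumE (I : finType) (f : I -> gtens) d m : ((\sum_i f i) d : tens K a) m = \sum_i (f i d : tens K a) m.
  by elim/big_rec2: _ => [|i y1 y2 _ <-]; rewrite !ffunE.
apply/ffunP => d; apply/ffunP => m; rewrite sumE (bigD1 d) //= [X in _ + X]big1 ?addr0 => [|d' dd].
  rewrite sumE (bigD1 m) //= big1 ?addr0 => [|m' mm]; rewrite gtens_scale /gdelta ffunE eqxx ffunE.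
    by rewrite eqxx mulr1.
  by case: (m =P m') mm => [->|_]; rewrite ?eqxx ?mulr0.
rewrite sumE big1 // => m' _; rewrite gtens_scale /gdelta ffunE.
by case: (d =P d') dd => [->|_]; rewrite ?eqxx // ffunE mulr0.
Qed.

(* The coordinates of pt on the chart eps, in the basis used by peval. *)
Definition Gc (eps : seq bool) i : {mpoly K[n]} :=
  \sum_d \sum_m (cd i (gdelta d m)) *: Gu z eps d m.

Lemma coord_pt l i : size l = n -> cd i (pt l) = (Gc (map fst l) i).@[sv (map snd l)].
Proof.
move=> sl; rewrite {1}(gtens_expand (pt l)) linear_sum /Gc raddf_sum; apply: eq_bigr => d _ /=.
rewrite linear_sum raddf_sum; apply: eq_bigr => m _ /=.
by rewrite linearZ /= mevalZ -pt_coord // mulrC.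
Qed.

Lemma coord_pt_zip eps q i : size eps = n -> size q = n ->
  cd i (pt (zip eps q)) = (Gc eps i).@[sv q].
Proof. by move=> se sq; have [e1 e2 sz] := unzip_zip se sq; rewrite coord_pt // e1 e2. Qed.

Lemma Gc_eqv (F : fieldType) (io : {rmorphism K -> F}) (l0 l0' : seq (bool * F)) :
  eqv 1%:M l0 l0' -> size l0 = n ->
  exists2 k : F, k != 0 & forall i,
    mmap io (sv (map snd l0)) (Gc (map fst l0) i) =
    k * mmap io (sv (map snd l0')) (Gc (map fst l0') i).
Proof.
move=> e sl; have [k k0 kE] := Gu_eqv a z io e sl; exists k => // i.
rewrite /Gc !raddf_sum mulr_sumr; apply: eq_bigr => d _ /=.
rewrite !raddf_sum mulr_sumr; apply: eq_bigr => m _ /=.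
by rewrite !mmapZ kE // mulrCA.
Qed.

Definition chart_poly (p : {mpoly K[\dim {:gtens}]}) eps : {mpoly K[n]} :=
  mmap (@mpolyC n K) (Gc eps) p.

Lemma chart_polyE p l : size l = n ->
  (chart_poly p (map fst l)).@[sv (map snd l)] = peval p (pt l).
Proof.
move=> sl; rewrite /chart_poly -mmap_id mmap_comp.
by apply: meval_eq => i; rewrite coord_pt.
Qed.

Lemma chart_poly_zip p eps q : size eps = n -> size q = n ->
  (chart_poly p eps).@[sv q] = peval p (pt (zip eps q)).
Proof.
by move=> se sq; have [e1 e2 sz] := unzip_zip se sq; have := chart_polyE p sz; rewrite e1 e2.
Qed.

(** As in [transfer]: charts overlap generically and [pt] changes there by a nonzero scalar, to
    which homogeneous vanishing is insensitive. *)
Lemma vanish_charts d p eps l : p \is d.-homog -> size eps = n ->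
  (forall q, size q = n -> peval p (pt (zip eps q)) = 0) -> size l = n -> peval p (pt l) = 0.
Proof.
move=> hp se h sl; rewrite -chart_polyE //.
suff -> : chart_poly p (map fst l) = 0 by rewrite meval0.
apply: (@generic_vanish _ n n) => //.
have sl1 : size (map fst l) = n by rewrite size_map.
apply: generic_sub (eqv_generic (det1 _ _) sl1 se) => q sq [q' [sq' e]].
have [_ _ sz] := unzip_zip sl1 sq; have [k k0 kE] := pt_eqv a z e sz.
by rewrite chart_poly_zip // kE (pevalZ _ _ hp) h // mulr0.
Qed.

Hypothesis (n_gt0 : (0 < n)%N) (a_ge2 : forall i, (2 <= a i)%N).
Hypothesis (a_inc : forall i j : 'I_n, (i < j)%N -> (a i < a j)%N) (z_inj : injective z).

Lemma a_gt0 i : (0 < a i)%N. Proof. exact: ltnW. Qed.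

(** The forms of [sections] built for [l0 = l] cannot all vanish at [pt l]. *)
Lemma pt_neq0 l : size l = n -> pt l != 0.
Proof.
move=> sl; have [xi [ka [ka0 kaE]]] := sections a_ge2 a_inc z_inj sl (Ordinal n_gt0).
apply/eqP => p0; have := kaE l (base (~~ (nth (false, 0) l 0).1, 0)) sl.
rewrite wedge_dual p0 big1 => [|b' _]; last by rewrite big1 // => k _; rewrite linear0 mulr0.
by move/eqP; rewrite eq_sym mulf_eq0 signr_eq0 (negPf ka0).
Qed.

Local Notation orbit_A := (@orbit_A K n a z).

Lemma orbit_proj L : orbit_A L -> proj_space L.
Proof. by move=> /(orbit_chart a_gt0)[l sl ->]; apply: proj_line; exact: pt_neq0. Qed.

Local Notation c0 := (nseq n false).

Lemma closure_pt l : size l = n -> zclosure orbit_A <[pt l]>%VS.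
Proof.
move=> sl; apply/(zclosureE _ orbit_proj); split; first exact/proj_line/pt_neq0.
move=> d p hp h v; apply: (peval_line hp); apply: (@vanish_charts d p c0) => // [|q sq].
  exact: size_nseq.
exact: (h _ _ (orbit_cell z a_gt0 sq) (memv_line _)).
Qed.

Lemma vanish_closure L d p : zclosure orbit_A L -> p \is d.-homog ->
  (forall q, size q = n -> peval p (pt (zip c0 q)) = 0) -> forall v, v \in L -> peval p v = 0.
Proof.
move=> /(zclosureE _ orbit_proj)[PL h] hp h0; apply: (h d p hp) => L' v /(orbit_chart a_gt0)[l sl ->].
by apply: (peval_line hp); apply: (vanish_charts hp (size_nseq _ _) h0 sl).
Qed.

Section Place.
Variables (x : gtens) (i0 : 'I_(\dim {:gtens})).
Hypothesis (x0 : cd i0 x != 0).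
Hypothesis van : forall d p, p \is d.-homog ->
  (forall q, size q = n -> peval p (pt (zip c0 q)) = 0) -> peval p x = 0.

Local Notation F := {fraction {mpoly K[n]}}.
Definition io : {rmorphism K -> F} := @FracField.tofrac {mpoly K[n]} \o @mpolyC n K.
(** The generic point of the standard chart, over the function field. *)
Definition generic_q : seq F := [seq FracField.tofrac 'X_i | i <- enum 'I_n].

Lemma mmap_generic (P : {mpoly K[n]}) : mmap io (sv generic_q) P = FracField.tofrac P.
Proof.
rewrite [in RHS](mpolyE P) rmorph_sum; apply: eq_bigr => m _.
rewrite -mul_mpolyC rmorphM; congr (_ * _).
rewrite -mmap1_id /mmap1 rmorph_prod; apply: eq_bigr => i _ /=.
by rewrite rmorphXn /sv /generic_q (nth_map i) ?size_enum_ord // nth_ord_enum.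
Qed.

Local Notation w := (fun i => mmap io (sv generic_q) (Gc c0 i)).
Local Notation dimg := (\dim {:gtens}).

Lemma van_generic d (p : {mpoly K[dimg]}) : p \is d.-homog -> mmap io w p = 0 -> peval p x = 0.
Proof.
move=> hp; rewrite -mmap_comp mmap_generic => /eqP; rewrite tofrac_eq0 => /eqP p0.
by apply: van hp _ => q sq; rewrite -chart_poly_zip ?size_nseq // /chart_poly p0 meval0.
Qed.

Lemma mmap_X (v : 'I_dimg -> F) i : mmap io v 'X_i = v i.
Proof. by rewrite mmapX mmap1U. Qed.

Lemma w0 : w i0 != 0.
Proof.
apply: contra_neq x0 => wi; rewrite -pevalX; apply: (van_generic (homX K i0)).
by rewrite mmap_X.
Qed.

Definition frac d (p : {mpoly K[dimg]}) : F := mmap io w p / w i0 ^+ d.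
(** The coordinate ring of the orbit closure where the coordinate [i0] is nonzero, inside the
    function field; [m0] is the maximal ideal of the point [x]. *)
Definition B0 (y : F) := exists d (p : {mpoly K[dimg]}), p \is d.-homog /\ y = frac d p.
Definition m0 (y : F) := exists d (p : {mpoly K[dimg]}), [/\ p \is d.-homog, y = frac d p & peval p x = 0].

Lemma homXn k : ('X_i0 ^+ k : {mpoly K[dimg]}) \is k.-homog.
Proof. by have := dhomogMn k (homX K i0); rewrite mul1n. Qed.

Lemma fracD d e p q : frac d p + frac e q = frac (d + e) (p * 'X_i0 ^+ e + q * 'X_i0 ^+ d).
Proof.
rewrite /frac rmorphD /= 2!rmorphM /= 2!rmorphXn /= mmap_X exprD.
by apply: addf_div; rewrite expf_neq0 // w0.
Qed.

Lemma fracM d e p q : frac d p * frac e q = frac (d + e) (p * q).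
Proof. by rewrite /frac rmorphM exprD mulf_div. Qed.

Lemma homD d e (p q : {mpoly K[dimg]}) : p \is d.-homog -> q \is e.-homog ->
  p * 'X_i0 ^+ e + q * 'X_i0 ^+ d \is (d + e)%N.-homog.
Proof.
move=> hp hq; apply: dhomogD; first exact: dhomogM (homXn e).
by rewrite addnC; exact: dhomogM (homXn d).
Qed.

Lemma peval0X k : peval ('X_i0 ^+ k) x = cd i0 x ^+ k.
Proof. by rewrite pevalXn pevalX. Qed.

Lemma fracB d (p : {mpoly K[dimg]}) c : p \is d.-homog -> peval p x = c * cd i0 x ^+ d -> m0 (frac d p - io c).
Proof.
move=> hp pc; exists d, (p - c *: 'X_i0 ^+ d); split.
- by rewrite rpredB // dhomogZ // homXn.
- by rewrite /frac rmorphB /= mmapZ rmorphXn /= mmap_X mulrBl mulfK // expf_neq0 // w0.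
- by rewrite pevalB peval_scale peval0X pc subrr.
Qed.

Lemma place0 : place io B0 m0.
Proof.
split=> [c|y1 y2|y1 y2|y|y1 y2|y1 y2||y].
- exists 0%N, (c%:MP); split; last by rewrite /frac expr0 divr1 mmapC.
  by rewrite -[c%:MP]mulr1 mul_mpolyC dhomogZ // dhomog1.
- move=> [d [p [hp ->]]] [e [q [hq ->]]]; rewrite fracD; eexists _, _; split; last by [].
  exact: homD.
- move=> [d [p [hp ->]]] [e [q [hq ->]]]; rewrite fracM; eexists _, _; split; last by [].
  exact: dhomogM.
- by move=> [d [p [hp -> _]]]; exists d, p.
- move=> [d [p [hp -> px]]] [e [q [hq -> qx]]]; rewrite fracD; eexists _, _; split; [|by []|].
    exact: homD.
  by rewrite pevalD !pevalM px qx !mul0r addr0.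
- move=> [d [p [hp ->]]] [e [q [hq -> qx]]]; rewrite fracM; eexists _, _; split; [|by []|].
    exact: dhomogM.
  by rewrite pevalM qx mulr0.
(* A relation putting 1 in [m0] holds at the generic point, hence at [x], where it forces the
   coordinate [i0] to vanish. *)
- move=> [d [p [hp e px]]].
  have : peval (p - 'X_i0 ^+ d) x = 0.
    apply: (@van_generic d); first by rewrite rpredB // homXn.
    rewrite rmorphB rmorphXn /= mmap_X; apply/eqP; rewrite subr_eq0; apply/eqP.
    by rewrite -[RHS]mul1r [X in X * _]e /frac divfK // expf_neq0 // w0.
  rewrite pevalB px peval0X sub0r => /eqP.
  by rewrite oppr_eq0 expf_eq0 (negPf x0) andbF.
- move=> [d [p [hp ->]]]; exists (peval p x / cd i0 x ^+ d); apply: fracB => //.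
  by rewrite divfK // expf_neq0.
Qed.

Lemma residue_w i : residue io B0 m0 (w i / w i0) (cd i x / cd i0 x).
Proof.
have E : w i / w i0 = frac 1 'X_i by rewrite /frac mmap_X.
split; first by exists 1%N, 'X_i; split=> //; exact: homX.
by rewrite E; apply: fracB; [exact: homX | rewrite pevalX divfK].
Qed.

(** The generic chain acquires a chart with integral coordinates after extending the place centred
    at [x]. The ratios of coordinates of [pt] then have two residues, those of [x] and those of the
    residue chain, which agree. *)
Lemma place_chart : exists2 l, size l = n & <[x]>%VS = <[pt l]>%VS.
Proof.
have sg : size generic_q = n by rewrite size_map size_enum_ord.
have [e1 e2 s0] := unzip_zip (size_nseq n false) sg.
have [B [m [l' [cs [pl BB mm [e scs res]]]]]] := chart_place (zip c0 generic_q) place0 (det1 _ _).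
have sl' : size l' = n by rewrite -(eqv_size e).
have [k k0 kE] := Gc_eqv io e s0; rewrite e1 e2 in kE.
have [_ _ s4] := unzip_zip (etrans (size_map fst l') sl') (etrans scs sl').
exists (zip (map fst l') cs) => //; set l := zip _ _.
pose w' i := mmap io (sv (map snd l')) (Gc (map fst l') i).
have resw' i : residue io B m (w' i) (cd i (pt l)).
  rewrite coord_pt_zip ?size_map ?scs //; apply: residue_mmap => // j.
  by apply: res; rewrite sl'.
have w'E i : w' i = w i / w i0 * w' i0.
  have w'0 : w' i0 != 0 by apply: contra_neq w0 => e0; rewrite kE -/(w' _) e0 mulr0.
  by rewrite !kE -!/(w' _) -mulf_div divff // mul1r divfK.
have cE i : cd i (pt l) = cd i x / cd i0 x * cd i0 (pt l).
  apply: (residue_uniq pl (resw' i)); rewrite w'E; apply: residue_mul => //.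
  by have [b1 b2] := residue_w i; split; [exact: BB | exact: mm].
have pE : pt l = (cd i0 (pt l) / cd i0 x) *: x.
  by apply: coord_inj => i; rewrite linearZ /= cE mulrC mulrA [RHS]mulrAC.
rewrite pE vlineZ //; apply/eqP => c0; move: (pt_neq0 s4).
by rewrite -/l pE c0 scale0r eqxx.
Qed.

End Place.

Lemma sh_charts L : sh a z L <-> exists2 l, size l = n & L = <[pt l]>%VS.
Proof.
split=> [[_ cL]|[l sl ->]]; last first.
  by split; [exact: fusion_line | exact: closure_pt].
have [PL _] := (zclosureE _ orbit_proj).1 cL.
have [x x0 LE] := proj_space_gen PL.
have [i0 xi0] := coord_neq0 x0.
have [|l sl lE] := @place_chart x i0 xi0; last by exists l; rewrite ?LE.
by move=> d p hp h; apply: (vanish_closure cL hp h); rewrite LE memv_line.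
Qed.

End Closure.

(** * Inverses of the charts *)

Local Open Scope classical_set_scope.

Lemma eqv_trans (F : fieldType) (h h' : 'M[{poly F}]_2) l l' l'' :
  eqv h l l' -> eqv h' l' l'' -> eqv (h' *m h) l l''.
Proof.
move=> e; elim: e h' l'' => [h0|h0 h1 c x x' l0 l0' e1 e2 _ IH] h' l'' e'.
  by inversion e'; exact: eqv_nil.
inversion e' as [|h2 h3 c' y y' m m' e3 e4 e5]; subst.
apply: (@eqv_cons _ _ (h3 *m h1) (c * c')); last exact: IH.
  by rewrite evM -mulmxA e1 -scalemxAr e3 scalerA.
by rewrite -mulmxA e2 mulmxA e4 mulmxA.
Qed.

Section Homogenization.
Variables (K : numClosedFieldType) (W : vectType K) (m d : nat).
Local Notation poly := {mpoly K[\dim {:W}]}.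
Variables (s : poly) (g : 'I_m -> poly).
Hypotheses (hs : s \is d.-homog) (hg : forall i, g i \is d.-homog).

(* s ^ D * P (g / s). *)
Definition homz (D : nat) (P : {mpoly K[m]}) : poly :=
  \sum_(mm <- msupp P) P@_mm *: (\prod_i g i ^+ mm i * s ^+ (D - mdeg mm)).

Lemma homz_homog D P : (msize P <= D.+1)%N -> homz D P \is (d * D)%N.-homog.
Proof.
move=> PD; rewrite /homz big_seq; apply: rpred_sum => mm mP.
have mD : (mdeg mm <= D)%N by rewrite -ltnS; apply: leq_trans (msize_mdeg_lt mP) PD.
apply: dhomogZ; have -> : (d * D = d * mdeg mm + d * (D - mdeg mm))%N by rewrite -mulnDr subnKC.
apply: dhomogM; last exact: dhomogMn.
rewrite mdegE big_distrr /=; elim/big_rec2: _ => [|i y p _ hp]; first exact: dhomog1.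
by apply: dhomogM hp; exact: dhomogMn.
Qed.

Lemma homz_eval D P v (x : 'I_m -> K) : (msize P <= D.+1)%N ->
  (forall i, peval s v * x i = peval (g i) v) ->
  peval (homz D P) v = peval s v ^+ D * P.@[x].
Proof.
move=> PD h; rewrite peval_mmap /homz raddf_sum /= mevalE mulr_sumr !big_seq.
apply: eq_bigr => mm mP.
have mD : (mdeg mm <= D)%N by rewrite -ltnS; apply: leq_trans (msize_mdeg_lt mP) PD.
rewrite mmapZ [RHS]mulrCA; congr (_ * _).
rewrite rmorphM rmorph_prod rmorphXn /= -peval_mmap -{2}(subnKC mD) exprD -mulrA mulrCA mulrC.
congr (_ * _); rewrite mdegE -prodrXr -big_split /=; apply: eq_bigr => i _.
by rewrite rmorphXn /= -peval_mmap -h exprMn.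
Qed.

End Homogenization.

Section LocalInverse.
Variables (K : numClosedFieldType) (n : nat) (a : 'I_n -> nat) (z : 'I_n -> K).
Local Notation pt := (@pt K n a z).
Local Notation gtens := (gtens K a).
Local Notation cd i := (coord (vbasis {:gtens}) i).
Local Notation poly := {mpoly K[\dim {:gtens}]}.
Hypothesis (n_gt0 : (0 < n)%N) (a_ge2 : forall i, (2 <= a i)%N).
Hypothesis (a_inc : forall i j : 'I_n, (i < j)%N -> (a i < a j)%N) (z_inj : injective z).

Section Chart.
Variables (eps : seq bool) (q0 : seq K).
Hypotheses (seps : size eps = n) (sq0 : size q0 = n).

(* f is regular near q0 as a function of the point pt, and homogeneous of
   degree m. *)
Definition ratio m (f : seq K -> K) : Prop := exists d (s g : poly),
  [/\ s \is d.-homog, g \is (d + m)%N.-homog, peval s (pt (zip eps q0)) != 0 &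
      forall q, size q = n -> peval s (pt (zip eps q)) * f q = peval g (pt (zip eps q))].

Lemma ratio_ext m f f' : (forall q, size q = n -> f q = f' q) -> ratio m f -> ratio m f'.
Proof.
move=> e [d [s [g [hs hg s0 h]]]]; exists d, s, g; split=> // q sq.
by rewrite -e // h.
Qed.

Lemma ratio_const c : ratio 0 (fun=> c).
Proof.
exists 0%N, 1, (c *: 1); split; rewrite ?dhomog1 ?addn0 ?dhomogZ ?dhomog1 //.
  by rewrite peval_mmap rmorph1 oner_eq0.
by move=> q _; rewrite peval_scale mulrC.
Qed.

Lemma ratioD m f f' : ratio m f -> ratio m f' -> ratio m (fun q => f q + f' q).
Proof.
move=> [d [s [g [hs hg s0 h]]]] [d' [s' [g' [hs' hg' s'0 h']]]].
exists (d + d')%N, (s * s'), (g * s' + g' * s); split.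
- exact: dhomogM.
- apply: dhomogD; first by have := dhomogM hg hs'; rewrite addnAC.
  by have := dhomogM hg' hs; rewrite addnAC (addnC d').
- by rewrite pevalM mulf_neq0.
- move=> q sq; rewrite pevalD !pevalM -h // -h' //; ring.
Qed.

Lemma ratioM m m' f f' : ratio m f -> ratio m' f' -> ratio (m + m') (fun q => f q * f' q).
Proof.
move=> [d [s [g [hs hg s0 h]]]] [d' [s' [g' [hs' hg' s'0 h']]]].
exists (d + d')%N, (s * s'), (g * g'); split.
- exact: dhomogM.
- by rewrite addnACA; exact: dhomogM.
- by rewrite pevalM mulf_neq0.
- move=> q sq; rewrite !pevalM -h // -h' //; ring.
Qed.

Lemma ratio0 m : ratio m (fun=> 0).
Proof.
exists 0%N, 1, 0; split; rewrite ?dhomog1 ?dhomog0 //.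
  by rewrite peval_mmap rmorph1 oner_eq0.
by move=> q _; rewrite mulr0 peval_mmap rmorph0.
Qed.

Lemma ratio_sum m (I : Type) (r : seq I) (P : pred I) (f : I -> seq K -> K) :
  (forall i, P i -> ratio m (f i)) -> ratio m (fun q => \sum_(i <- r | P i) f i q).
Proof.
move=> h; elim: r => [|i r IH].
  by apply: ratio_ext (ratio0 m) => q _; rewrite big_nil.
have [Pi|Pi] := boolP (P i).
  by apply: ratio_ext (ratioD (h i Pi) IH) => q _; rewrite big_cons Pi.
by apply: ratio_ext IH => q _; rewrite big_cons (negPf Pi).
Qed.

Lemma ratio_form (xi : {linear gtens -> K^o}) : ratio 1 (fun q => xi (pt (zip eps q))).
Proof.
have [p hp pE] := lform_exists xi; exists 0%N, 1, p; split; rewrite ?dhomog1 //.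
  by rewrite peval_mmap rmorph1 oner_eq0.
by move=> q _; rewrite pE peval_mmap rmorph1 mul1r.
Qed.

Lemma ratio_div m (f f' g : seq K -> K) : ratio m f' -> ratio m g -> f' q0 != 0 ->
  (forall q, size q = n -> f q * f' q = g q) -> ratio 0 f.
Proof.
move=> [d [s [p [hs hp s0 h]]]] [d' [s' [p' [hs' hp' s'0 h']]]] f0 e.
exists (d + m + d')%N, (p * s'), (s * p'); split.
- exact: dhomogM.
- by have := dhomogM hs hp'; rewrite addn0 addnA addnAC.
- by rewrite pevalM mulf_neq0 // -h // mulf_neq0.
- by move=> q sq; rewrite !pevalM -h // -h' // -e //; ring.
Qed.

Definition ratio_mx k (M : seq K -> 'M[{poly K}]_(2, k)) :=
  forall b c i, ratio 0 (fun q => (M q b c)`_i).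

Lemma ratio_mulmx k M (N : seq K -> 'M[{poly K}]_(2, k)) :
  ratio_mx M -> ratio_mx N -> ratio_mx (fun q => M q *m N q).
Proof.
move=> rM rN b c i.
apply: (@ratio_ext _ (fun q => \sum_j \sum_(t < i.+1) (M q b j)`_t * (N q j c)`_(i - t))).
  by move=> q _; rewrite mxE coef_sum; apply: eq_bigr => j _; rewrite coefM.
by apply: ratio_sum => j _; apply: ratio_sum => t _; exact: (@ratioM 0 0).
Qed.

Lemma ratio_poly_const k (N : 'M[{poly K}]_(2, k)) : ratio_mx (fun=> N).
Proof. by move=> b c i; exact: ratio_const. Qed.

Lemma ratio_gX e (f : seq K -> K) : ratio 0 f -> ratio_mx (fun q => gX (e, f q) 0).
Proof.
move=> rf b c i.
have rC : ratio 0 (fun q => ((f q)%:P)`_i).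
  case: i => [|i]; first by apply: ratio_ext rf => q _; rewrite coefC.
  by apply: ratio_ext (ratio_const 0) => q _; rewrite coefC.
have E q : [/\ gX (e, f q) 0 0 0 = if e then 1 else 'X - 0%:P,
    gX (e, f q) 0 0 1 = if e then 0 else (f q)%:P,
    gX (e, f q) 0 1 0 = if e then (f q)%:P else 0 &
    gX (e, f q) 0 1 1 = if e then 'X - 0%:P else 1] by exact: gmE.
move: b c; apply: ord2P; apply: ord2P.
- by apply: ratio_ext (ratio_const (if e then 1 else 'X - 0%:P)`_i) => q _; case: (E q) => ->.
- case: e E => E; last by apply: ratio_ext rC => q _; case: (E q) => _ ->.
  by apply: ratio_ext (ratio_const (0 : {poly K})`_i) => q _; case: (E q) => _ ->.
- case: e E => E; first by apply: ratio_ext rC => q _; case: (E q) => _ _ ->.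
  by apply: ratio_ext (ratio_const (0 : {poly K})`_i) => q _; case: (E q) => _ _ ->.
- by apply: ratio_ext (ratio_const (if e then 'X - 0%:P else 1)`_i) => q _; case: (E q) => _ _ _ ->.
Qed.

Lemma ratio_Mx (L : seq (bool * (seq K -> K))) : (forall i, (i < size L)%N ->
    ratio 0 (nth (false, fun=> 0) L i).2) ->
  ratio_mx (fun q => Mx (map (fun x => (x.1, x.2 q)) L) (fun=> 0)).
Proof.
elim: L => [|[e f] L IH] rL /=; first exact: ratio_poly_const.
apply: ratio_mulmx; first by apply: ratio_gX; exact: (rL 0%N).
by apply: IH => i iL; exact: (rL i.+1).
Qed.

(** By strong induction the frame of the first [j] steps is regular, so the sums in [sections] are
    regular of degree 1. They equal [ka] times the wedge with the j-th line; two choices of [e]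
    give, up to a common sign, [ka] and [ka] times the coordinate. *)
Lemma ratio_coord j : (j < n)%N -> ratio 0 (fun q => nth 0 q j).
Proof.
have [N] := ubnP j; elim: N j => // N IH j jN jn.
have [_ _ sl0] := unzip_zip seps sq0.
have [xi [ka [ka0 kaE]]] := sections a_ge2 a_inc z_inj sl0 (Ordinal jn).
have rE e : ratio 1 (fun q => wedge e (base (nth false eps j, nth 0 q j)) * ka (zip eps q)).
  pose L := [seq (nth false eps i, fun q : seq K => nth 0 q i) | i <- iota 0 j].
  have LE q : size q = n -> take j (zip eps q) = map (fun x => (x.1, x.2 q)) L.
    move=> sq; have [_ _ sz] := unzip_zip seps sq.
    have szj : size (take j (zip eps q)) = j by apply: size_takel; rewrite sz; exact: ltnW.
    apply: (@eq_from_nth _ (false, 0)) => [|i]; first by rewrite szj !size_map size_iota.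
    rewrite szj => ij; rewrite nth_take // nth_zip ?seps ?sq //.
    rewrite /L -map_comp (nth_map 0%N) ?size_iota // nth_iota //.
  apply: (@ratio_ext _ (fun q => \sum_b \sum_(k < n)
     ((Mx (map (fun x => (x.1, x.2 q)) L) (fun=> 0) *m map_mx polyC e) b 0)`_k * xi b k (pt (zip eps q)))).
    move=> q sq; rewrite -LE // -[nth false _ _]/(nth false eps (Ordinal jn)).
    rewrite kaE ?size_zip ?seps ?sq ?minnn //; congr (wedge _ (base _) * _).
    by rewrite nth_zip // seps sq.
  apply: ratio_sum => b _; apply: ratio_sum => k _.
  apply: (@ratioM 0 1); last exact: ratio_form.
  apply: ratio_mulmx; last exact: ratio_poly_const.
  apply: ratio_Mx => i; rewrite size_map size_iota => ij.
  rewrite (nth_map 0%N) ?size_iota // nth_iota //=; apply: IH; first by apply: leq_trans ij _; rewrite -ltnS.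
  exact: ltn_trans ij jn.
set e := nth false eps j in rE.
apply: (@ratio_div 1 _ _ _ (rE (base (~~ e, 0))) (rE (- base (e, 0)))).
  rewrite -[e]/((e, nth 0 q0 j).1) wedge_dual mulf_neq0 ?signr_eq0 //.
move=> q _; rewrite -{1}[e]/((e, nth 0 q j).1) wedge_dual mulrA; congr (_ * _).
rewrite /wedge ![(- base _) _ _]mxE !base0E !base1E /=; case: (e); rewrite /= ?expr0 ?expr1; ring.
Qed.

Lemma ratio_common m (f : nat -> seq K -> K) : (forall j, (j < m)%N -> ratio 0 (f j)) ->
  exists d (s : poly) (g : nat -> poly), [/\ s \is d.-homog, (forall j, (j < m)%N -> g j \is d.-homog),
    peval s (pt (zip eps q0)) != 0 &
    forall j q, (j < m)%N -> size q = n ->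
      peval s (pt (zip eps q)) * f j q = peval (g j) (pt (zip eps q))].
Proof.
elim: m => [|m IH] h.
  exists 0%N, 1, (fun=> 0); split; rewrite ?dhomog1 //.
  by rewrite peval_mmap rmorph1 oner_eq0.
have [d [s [g [hs hg s0 sE]]]] := IH (fun j jm => h j (ltnW jm)).
have [d' [s' [g' [hs' hg' s'0 s'E]]]] := h m (ltnSn m); rewrite addn0 in hg'.
exists (d + d')%N, (s * s'), (fun j => if (j == m)%N then s * g' else g j * s'); split.
- exact: dhomogM.
- move=> j; rewrite ltnS leq_eqVlt; case: eqP => [_ _|_ /= jm]; first exact: dhomogM.
  by apply: dhomogM; rewrite ?hg.
- by rewrite pevalM mulf_neq0.
- move=> j q; rewrite ltnS leq_eqVlt; case: eqP => [-> _ sq|_ /= jm sq].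
    by rewrite !pevalM -s'E // mulrA.
  by rewrite !pevalM -sE //; ring.
Qed.

(** The ratios [g / s] are found on the chart [eps]. That they reproduce the point is a homogeneous
    identity, which propagates to all charts by [vanish_charts]; hence the whole locus where [s] is
    nonzero lies in the chart [eps]. *)
Lemma local_inverse : exists d (s : poly) (g : 'I_n -> poly),
  [/\ s \is d.-homog, (forall j, g j \is d.-homog), peval s (pt (zip eps q0)) != 0 &
    forall l v (x : 'I_n -> K), size l = n -> v \in <[pt l]>%VS -> v != 0 -> peval s v != 0 ->
      (forall j, peval s v * x j = peval (g j) v) ->
      <[pt l]>%VS = <[pt (zip eps [seq x j | j <- enum 'I_n])]>%VS].
Proof.
have [d [s [g [hs hg s0 sE]]]] := ratio_common ratio_coord.
have hg' (j : 'I_n) : g j \is d.-homog by exact: hg.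
exists d, s, (fun j : 'I_n => g j); split=> // l v x sl vl v0 s_v xE.
pose D := (\sum_i msize (@Gc K n a z eps i))%N.
have mD i : (msize (@Gc K n a z eps i) <= D.+1)%N by rewrite /D (bigD1 i) //=; lia.
pose H i := homz s (fun j : 'I_n => g j) D (@Gc K n a z eps i).
have hH i : H i \is (d * D)%N.-homog by exact: homz_homog.
(* Cross products of the point and of its reconstruction: their vanishing says that the two are
   proportional. *)
have HX i i' : H i * 'X_i' - H i' * 'X_i \is (d * D + 1)%N.-homog.
  by apply: rpredB; apply: dhomogM (hH _) (homX K _).
have sx : size [seq x j | j <- enum 'I_n] = n by rewrite size_map size_enum_ord.
have [_ _ slx] := unzip_zip seps sx.
have HE i l' y : (forall j : 'I_n, peval s l' * y j = peval (g j) l') ->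
    peval (H i) l' = peval s l' ^+ D * (@Gc K n a z eps i).@[y] by move=> h; exact: homz_eval.
have HX0 i i' : peval (H i * 'X_i' - H i' * 'X_i) v = 0.
  apply: (peval_line (HX i i') _ vl); apply: (vanish_charts (HX i i') seps _ sl) => q sq.
  have E1 (j : 'I_n) : peval s (pt (zip eps q)) * sv q j = peval (g j) (pt (zip eps q)).
    exact: sE.
  rewrite pevalB !pevalM !pevalX (HE i _ _ E1) (HE i' _ _ E1) !coord_pt_zip //.
  by rewrite [X in X - _]mulrAC subrr.
have LE : <[pt l]>%VS = <[v]>%VS.
  have [c vE] := vlineP _ _ vl; rewrite vE vlineZ //.
  by apply: contra_neq v0 => c0; rewrite vE c0 scale0r.
rewrite LE; apply/esym/coord_line => [||i i']; first exact: pt_neq0.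
  by [].
have := HX0 i i'; rewrite pevalB !pevalM !pevalX (HE i _ _ xE) (HE i' _ _ xE).
have xX j : (@Gc K n a z eps j).@[x] = cd j (pt (zip eps [seq x j | j <- enum 'I_n])).
  rewrite coord_pt_zip //; apply: meval_eq => j'.
  by rewrite /sv (nth_map j') ?size_enum_ord // nth_ord_enum.
rewrite !xX -!mulrA -mulrBr => /eqP; rewrite mulf_eq0 expf_eq0 (negPf s_v) andbF /= subr_eq0.
by move/eqP.
Qed.

End Chart.

(** [l] is replaced by equivalent chains agreeing with [l'] for more and more steps. When [j] steps
    agree, the forms of [sections] for [l'] take proportional values on both vectors, so the lines
    of step [j] coincide and the chart of that step can be changed. *)
Lemma separation l l' : size l = n -> size l' = n ->
  <[pt l]>%VS = <[pt l']>%VS -> eqv 1%:M l l'.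
Proof.
move=> sl sl' e.
have [c pE] : exists c, pt l' = c *: pt l by apply/vlineP; rewrite e memv_line.
suff main j : (j <= n)%N -> exists2 m, eqv 1%:M l m & take j m = take j l'.
  have [m em tm] := main n (leqnn n).
  have sm : size m = n by rewrite -(eqv_size em).
  by have -> : l' = m by rewrite -(take_size l') -(take_size m) sl' sm.
elim: j => [|j IH] jn; first by exists l; [exact: eqv_refl | rewrite !take0].
have [m em tm] := IH (ltnW jn).
have sm : size m = n by rewrite -(eqv_size em).
have [k k0 kE] := pt_eqv a z em sl.
have [xi [ka [ka0 kaE]]] := sections a_ge2 a_inc z_inj sl' (Ordinal jn).
pose x := nth (false, 0) l' j; pose y := nth (false, 0) m j.
pose C := c * k * ka m / ka l'.
have wE u : wedge u (base x) = C * wedge u (base y).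
  have /= E1 := kaE l' u sl'; have /= E2 := kaE m u sm.
  have E : wedge u (base x) * ka l' = c * k * (wedge u (base y) * ka m).
    rewrite -E1 -E2 tm mulr_sumr; apply: eq_bigr => b _.
    rewrite mulr_sumr; apply: eq_bigr => t _.
    by rewrite pE kE scalerA linearZ /= [RHS]mulrCA.
  by rewrite -[LHS](mulfK ka0) E /C; ring.
have bE : base x = C *: base y.
  apply: mx2P => t; rewrite [t]ord1 scalemxE.
    have := wE (base (false, 0)); rewrite /wedge (base0E (false, 0)) (base1E (false, 0)) /=.
    by rewrite !mul0r !mul1r !sub0r mulrN => /oppr_inj.
  have := wE (base (true, 0)); rewrite /wedge (base0E (true, 0)) (base1E (true, 0)) /=.
  by rewrite !mul0r !mul1r !subr0.
have C0 : C != 0.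
  by apply: contra_neq (base_neq0 x) => C0; rewrite bE C0 scale0r.
have yE : ev 0 1%:M *m base y = C^-1 *: base x.
  by rewrite ev1 mul1mx bE scalerA mulVf // scale1r.
have [h' d' hE] := eqv_step (drop j.+1 m) (det1 _ _) yE.
have [l4 e4] := eqv_exists (drop j.+1 m) d'.
have mE : m = take j m ++ y :: drop j.+1 m.
  by rewrite -drop_nth ?sm // cat_take_drop.
exists (take j m ++ x :: l4).
  have := eqv_refl_prefix (take j m) (hE _ _ e4); rewrite -mE => /(eqv_trans em).
  by rewrite mul1mx.
have stj : size (take j m) = j by apply: size_takel; rewrite sm ltnW.
rewrite take_cat stj ltnNge leqnSn /= subSnn /= take0 (take_nth (false, 0)) ?sl' //.
by rewrite -cats1 tm.
Qed.

End LocalInverse.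

(** * The bundle *)

Local Open Scope classical_set_scope.

Section PolynomialFunctions.
Variables (K : numClosedFieldType) (m : nat).
Implicit Types (f : ('I_m -> K) -> K).

Definition polyfun f : Prop := exists G : {mpoly K[m]}, forall x, f x = G.@[x].

Lemma polyfun_ext f f' : f =1 f' -> polyfun f -> polyfun f'.
Proof. by move=> e [G GE]; exists G => x; rewrite -e. Qed.

Lemma polyfun_const c : polyfun (fun=> c).
Proof. by exists c%:MP => x; rewrite mevalC. Qed.

Lemma polyfun_var i : polyfun (fun x => x i).
Proof. by exists 'X_i => x; rewrite mevalXU. Qed.

Lemma polyfunM f f' : polyfun f -> polyfun f' -> polyfun (fun x => f x * f' x).
Proof. by move=> [G GE] [G' GE']; exists (G * G') => x; rewrite -mmap_id rmorphM /= !mmap_id GE GE'. Qed.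

Lemma polyfun_sum (I : finType) (f : I -> ('I_m -> K) -> K) :
  (forall i, polyfun (f i)) -> polyfun (fun x => \sum_i f i x).
Proof.
move=> /choice[G GE]; exists (\sum_i G i) => x; rewrite raddf_sum.
by apply: eq_bigr => i _; exact: GE.
Qed.

Lemma polyfun_comp n (G : {mpoly K[n]}) (r : ('I_m -> K) -> 'I_n -> K) :
  (forall i, polyfun (fun x => r x i)) -> polyfun (fun x => G.@[r x]).
Proof.
move=> /choice[H HE]; exists (mmap (@mpolyC m K) H G) => x.
by rewrite -[RHS]mmap_id mmap_comp; apply: meval_eq => i; exact: HE.
Qed.

Lemma polyfun_nth k (j : 'I_k -> 'I_m) i :
  polyfun (fun x => nth 0 [seq x (j t) | t <- enum 'I_k] i).
Proof.
have [ik|ik] := ltnP i k.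
  apply: polyfun_ext (polyfun_var (j (Ordinal ik))) => x.
  rewrite (nth_map (Ordinal ik)) ?size_enum_ord //; congr (x (j _)).
  by apply: val_inj; rewrite /= nth_enum_ord.
apply: polyfun_ext (polyfun_const 0) => x.
by rewrite nth_default // size_map size_enum_ord.
Qed.

End PolynomialFunctions.

(** * A criterion for morphisms, and products through the Segre map *)

Section Morphisms.
Variable K : numClosedFieldType.

Lemma subst_homog m n d (p : {mpoly K[n]}) (H : 'I_n -> {mpoly K[m]}) :
  (forall i, H i \is 1.-homog) -> p \is d.-homog -> mmap (@mpolyC m K) H p \is d.-homog.
Proof.
move=> hH /dhomogP hp; rewrite /mmap big_seq; apply: rpred_sum => mm /hp dm.
rewrite mul_mpolyC; apply: dhomogZ; have <- : mdeg mm = d by exact: dm.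
rewrite /mmap1 mdegE; elim/big_rec2: _ => [|i y q _ hq]; first exact: dhomog1.
by apply: dhomogM hq; rewrite -[X in X.-homog]mul1n; exact: dhomogMn.
Qed.

Definition nonzero_locus (W : vectType K) (s : {mpoly K[\dim {:W}]}) (X : set {vspace W}) :=
  X `\` [set L | proj_space L /\ forall v, v \in L -> peval s v = 0].

Lemma nonzero_locus_open (W : vectType K) d (s : {mpoly K[\dim {:W}]}) (X : set {vspace W}) :
  s \is d.-homog -> zopen_in X (nonzero_locus s X).
Proof.
move=> hs; eexists; last by [].
exists [set s]; first by move=> p ->; exists d.
by apply/seteqP; split=> L [PL h]; split=> //; [move=> p v ->; exact: h | move=> v; exact: h].
Qed.

Lemma nonzero_locusP (W : vectType K) d (s : {mpoly K[\dim {:W}]}) (X : set {vspace W}) (L : {vspace W}) (v : W) :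
  s \is d.-homog -> (forall L, X L -> proj_space L) ->
  v \in L -> v != 0 -> X L -> nonzero_locus s X L <-> peval s v != 0.
Proof.
move=> hs XP vL v0 XL; split=> [[_ h]|sv]; last first.
  by split=> // -[_ /(_ v vL) e]; rewrite e eqxx in sv.
apply/negP => /eqP e; apply: h; split; first exact: XP.
move=> u; rewrite (proj_spaceE (XP _ XL) vL v0) => uv; exact: peval_line hs e uv.
Qed.

(** Morphisms are given near a point as polynomial maps [w] in local coordinates [x = g / s];
    homogenizing by a power of [s] turns them into the required homogeneous polynomials of one
    degree. *)
Lemma morphism_crit (W W' : vectType K) (X : set {vspace W}) (Y : set {vspace W'}) f :
  (forall L, X L -> proj_space L) -> (forall L, X L -> Y (f L)) ->
  (forall L0, X L0 -> exists d m (s : {mpoly K[\dim {:W}]}) (g : 'I_m -> {mpoly K[\dim {:W}]})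
      (w : ('I_m -> K) -> W'),
    [/\ s \is d.-homog, (forall j, g j \is d.-homog),
        (forall i, polyfun (fun x => coord (vbasis {:W'}) i (w x))),
        (exists v, [/\ v \in L0, v != 0 & peval s v != 0]) &
        forall L v x, X L -> v \in L -> v != 0 -> peval s v != 0 ->
          (forall j, peval s v * x j = peval (g j) v) -> w x != 0 /\ f L = <[w x]>%VS]) ->
  morphism X Y f.
Proof.
move=> XP XY h; split=> // L0 XL0.
have [d [m [s [g [w [hs hg /choice[G GE] [v0 [v0L v00 sv0]] wE]]]]]] := h L0 XL0.
exists (nonzero_locus s X); split; first exact: nonzero_locus_open hs.
  exact/(nonzero_locusP hs XP v0L v00 XL0).
pose D := (\sum_i msize (G i))%N.
have mD i : (msize (G i) <= D.+1)%N by rewrite /D (bigD1 i) //=; lia.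
exists (d * D)%N, (fun i => homz s g D (G i)); split=> [i|L v UL vL v_neq0].
  exact: homz_homog.
have XL := UL.1; have sv := (nonzero_locusP hs XP vL v_neq0 XL).1 UL.
pose x j := peval (g j) v / peval s v.
have xE j : peval s v * x j = peval (g j) v by rewrite mulrC divfK.
have [w0 fE] := wE L v x XL vL v_neq0 sv xE.
have -> : Defs.pmap (fun i => homz s g D (G i)) v = peval s v ^+ D *: w x.
  rewrite /Defs.pmap [in RHS](coord_vbasis (memvf (w x))) scaler_sumr; apply: eq_bigr => i _.
  by rewrite scalerA GE (homz_eval (mD i) xE).
by rewrite scaler_eq0 expf_eq0 (negPf sv) andbF (negPf w0) vlineZ // expf_neq0.
Qed.

End Morphisms.

Section Segre.
Variables (K : numClosedFieldType) (W1 W2 : vectType K).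
Local Notation cd1 := (coord (vbasis {:W1})).
Local Notation cd2 := (coord (vbasis {:W2})).

Definition tensor (u : W1) (v : W2) : 'M[K]_(\dim {:W1}, \dim {:W2}) :=
  \matrix_(i, j) (cd1 i u * cd2 j v).

Lemma tensor_neq0 u v : u != 0 -> v != 0 -> tensor u v != 0.
Proof.
move=> /coord_neq0[i ui] /coord_neq0[j vj]; apply/eqP => /matrixP/(_ i j)/eqP.
by rewrite !mxE mulf_eq0 (negPf ui) (negPf vj).
Qed.

Local Notation segre := (@segre K W1 W2).

Lemma segre_line u v : u != 0 -> v != 0 -> segre <[u]>%VS <[v]>%VS = <[tensor u v]>%VS.
Proof.
have pick (W : vectType K) (x : W) : x != 0 -> exists2 k, k != 0 & vpick <[x]>%VS = k *: x.
  move=> x0; have /vlineP[k kE] := memv_pick <[x]>%VS; exists k => //.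
  apply: contra_neq x0 => k0; apply/eqP; move/eqP: kE; rewrite k0 scale0r vpick0.
  by rewrite -subv0 -memvE memv0.
move=> /pick[k k0 kE] /pick[k' k'0 k'E]; rewrite /Defs.segre kE k'E -(@vlineZ _ _ (k * k') (tensor u v)) ?mulf_neq0 //.
congr (<[_]>%VS); apply/matrixP => i j; rewrite !mxE !linearZ /=.
by rewrite /GRing.scale /=; ring.
Qed.

Lemma segre_inj u v u' v' : u != 0 -> v != 0 -> u' != 0 -> v' != 0 ->
  segre <[u]>%VS <[v]>%VS = segre <[u']>%VS <[v']>%VS -> <[u]>%VS = <[u']>%VS /\ <[v]>%VS = <[v']>%VS.
Proof.
move=> u0 v0 u'0 v'0; rewrite !segre_line // => e.
have [k kE] : exists k, tensor u v = k *: tensor u' v' by apply/vlineP; rewrite -e memv_line.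
have E i j : cd1 i u * cd2 j v = k * (cd1 i u' * cd2 j v').
  by have /matrixP/(_ i j) := kE; rewrite !mxE.
have [i0 ui] := coord_neq0 u0; have [j0 vj] := coord_neq0 v0.
split; apply: coord_line => // i j.
  apply: (mulIf vj); rewrite mulrAC E [RHS]mulrAC E; ring.
apply: (mulfI ui); rewrite !mulrA !E; ring.
Qed.

Lemma polyfun_tensor m (u : ('I_m -> K) -> W1) (v : ('I_m -> K) -> W2) :
  (forall i, polyfun (fun x => cd1 i (u x))) -> (forall j, polyfun (fun x => cd2 j (v x))) ->
  forall t, polyfun (fun x => coord (vbasis {:'M[K]_(\dim {:W1}, \dim {:W2})}) t (tensor (u x) (v x))).
Proof.
move=> hu hv t; pose c i j := coord (vbasis {:'M[K]_(\dim {:W1}, \dim {:W2})}) t (delta_mx i j).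
apply: (@polyfun_ext _ _ (fun x => \sum_i \sum_j cd1 i (u x) * cd2 j (v x) * c i j)).
  move=> x; rewrite [in RHS](matrix_sum_delta (tensor (u x) (v x))) linear_sum; apply: eq_bigr => i _.
  by rewrite linear_sum; apply: eq_bigr => j _; rewrite linearZ /= mxE.
apply: polyfun_sum => i; apply: polyfun_sum => j.
by apply: polyfunM (polyfun_const _ _); exact: polyfunM.
Qed.

End Segre.

Local Open Scope classical_set_scope.

Lemma take_zip (S T : Type) k (s : seq S) (t : seq T) :
  take k (zip s t) = zip (take k s) (take k t).
Proof. by elim: k s t => [|k IH] [|x s] [|y t] //=; rewrite IH. Qed.

Section ChartLines.
Variables (K : numClosedFieldType) (n : nat) (a : 'I_n -> nat) (z : 'I_n -> K).
Local Notation pt := (@pt K n a z).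
Hypotheses (n_gt0 : (0 < n)%N) (a_ok : admissible a) (z_inj : injective z).

Lemma ptN0 l : size l = n -> pt l != 0.
Proof. exact: (pt_neq0 n_gt0 a_ok.1 a_ok.2 z_inj). Qed.

Lemma shP L : sh a z L <-> exists2 l, size l = n & L = <[pt l]>%VS.
Proof. exact: (sh_charts n_gt0 a_ok.1 a_ok.2 z_inj). Qed.

Lemma sh_proj L : sh a z L -> proj_space L.
Proof. by move=> /shP[l sl ->]; apply: proj_line; exact: ptN0. Qed.

Lemma pt_line_eqv l l' : size l = n -> eqv 1%:M l l' -> <[pt l]>%VS = <[pt l']>%VS.
Proof. by move=> sl /(pt_eqv a z)/(_ sl)[k k0 ->]; rewrite vlineZ. Qed.

Lemma polyfun_pt m eps (Y : ('I_m -> K) -> seq K) i : size eps = n ->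
  (forall x, size (Y x) = n) -> (forall j, polyfun (fun x => nth 0 (Y x) j)) ->
  polyfun (fun x => coord (vbasis {:gtens K a}) i (pt (zip eps (Y x)))).
Proof.
move=> se sY pY; apply: (@polyfun_ext _ _ (fun x => (@Gc K n a z eps i).@[sv (Y x)])).
  by move=> x; rewrite coord_pt_zip.
by apply: polyfun_comp => j; exact: pY.
Qed.

Definition chart_of (L : {vspace gtens K a}) : seq (bool * K) :=
  xget [::] [set l | size l = n /\ L = <[pt l]>%VS].

Lemma chart_ofP l : size l = n ->
  size (chart_of <[pt l]>%VS) = n /\ eqv 1%:M l (chart_of <[pt l]>%VS).
Proof.
move=> sl; have [sc e] : [set l' | size l' = n /\ <[pt l]>%VS = <[pt l']>%VS] (chart_of <[pt l]>%VS).
  by apply: (@xgetPex _ [::]); exists l.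
by split=> //; exact: (separation a_ok.1 a_ok.2 z_inj).
Qed.

Lemma inverse_at l0 : size l0 = n -> exists d s g,
  [/\ s \is d.-homog, (forall j : 'I_n, g j \is d.-homog), peval s (pt l0) != 0 &
    forall l v (x : 'I_n -> K), size l = n -> v \in <[pt l]>%VS -> v != 0 -> peval s v != 0 ->
      (forall j, peval s v * x j = peval (g j) v) ->
      <[pt l]>%VS = <[pt (zip (map fst l0) [seq x j | j <- enum 'I_n])]>%VS].
Proof.
move=> sl0.
have := @local_inverse K n a z n_gt0 a_ok.1 a_ok.2 z_inj (map fst l0) (map snd l0).
rewrite !size_map => /(_ sl0 sl0); have -> // : zip (map fst l0) (map snd l0) = l0.
exact: zip_unzip.
Qed.

End ChartLines.

Section Bundle.
Variables (K : numClosedFieldType) (n k m : nat).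
Hypotheses (k_gt0 : (0 < k)%N) (m_gt0 : (0 < m)%N) (nE : (n = k + m)%N).
Variables (a : 'I_n -> nat) (z : 'I_n -> K) (b : 'I_k -> nat) (y : 'I_k -> K)
  (c : 'I_m -> nat) (w : 'I_m -> K).
Hypotheses (a_ok : admissible a) (z_inj : injective z) (b_ok : admissible b)
  (y_inj : injective y) (c_ok : admissible c) (w_inj : injective w).
Local Notation pA := (@pt K n a z).
Local Notation pB := (@pt K k b y).
Local Notation pC := (@pt K m c w).
Local Notation segre := (@segre K (gtens K b) (gtens K c)).

Lemma n_gt0 : (0 < n)%N. Proof. by rewrite nE ltn_addr. Qed.

Definition proj (L : {vspace gtens K a}) : {vspace gtens K b} :=
  <[pB (take k (chart_of z L))]>%VS.

Lemma size_take_k l : size l = n -> size (take k l : seq (bool * K)) = k.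
Proof. by move=> sl; rewrite size_takel // sl nE leq_addr. Qed.

Lemma projE l : size l = n -> proj <[pA l]>%VS = <[pB (take k l)]>%VS.
Proof.
move=> sl; have [sc e] := chart_ofP a_ok z_inj sl.
by apply/esym/pt_line_eqv; [exact: size_take_k | exact: eqv_take].
Qed.

Lemma proj_morphism : morphism (sh a z) (sh b y) proj.
Proof.
apply: morphism_crit; first exact: sh_proj n_gt0 a_ok z_inj.
  move=> L /(shP n_gt0 a_ok z_inj)[l sl ->]; rewrite projE //.
  by apply/(shP k_gt0 b_ok y_inj); exists (take k l) => //; exact: size_take_k.
move=> L0 /(shP n_gt0 a_ok z_inj)[l0 sl0 ->].
have [d [s [g [hs hg s0 sE]]]] := inverse_at n_gt0 a_ok z_inj sl0.
pose Y (x : 'I_n -> K) := take k [seq x j | j <- enum 'I_n].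
have sY x : size (Y x) = k by rewrite size_takel // size_map size_enum_ord nE leq_addr.
have seps : size (take k (map fst l0)) = k by rewrite size_takel // size_map sl0 nE leq_addr.
exists d, n, s, g, (fun x => pB (zip (take k (map fst l0)) (Y x))); split=> //.
- move=> i; apply: polyfun_pt => // j.
  have [jk|jk] := ltnP j k.
    apply: (@polyfun_ext K n (fun x => nth 0 [seq x (id t) | t <- enum 'I_n] j)).
      by move=> x; rewrite /Y nth_take.
    exact: polyfun_nth.
  apply: (@polyfun_ext K n (fun=> 0)); last exact: polyfun_const.
  by move=> x; rewrite nth_default // sY.
- by exists (pA l0); rewrite memv_line; split=> //; exact: ptN0 n_gt0 a_ok z_inj _ sl0.
move=> L v x /(shP n_gt0 a_ok z_inj)[l sl ->] vl v0 sv xE.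
have [_ _ sz] := unzip_zip seps (sY x).
split; first exact: (ptN0 k_gt0 b_ok y_inj).
have sx : size [seq x j | j <- enum 'I_n] = n by rewrite size_map size_enum_ord.
have slx : size (zip (map fst l0) [seq x j | j <- enum 'I_n]) = n.
  by rewrite size_zip sx size_map sl0 minnn.
by rewrite (sE l v x) // (projE slx) take_zip.
Qed.


Section Trivialization.
Variables (eps1 : seq bool) (seps1 : size eps1 = k).
Variables (dB : nat) (sB : {mpoly K[\dim {:gtens K b}]}) (gB : 'I_k -> {mpoly K[\dim {:gtens K b}]}).
Hypotheses (hsB : sB \is dB.-homog) (hgB : forall j, gB j \is dB.-homog).
Hypothesis invB : forall l v (x : 'I_k -> K), size l = k -> v \in <[pB l]>%VS -> v != 0 ->
  peval sB v != 0 -> (forall j, peval sB v * x j = peval (gB j) v) ->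
  <[pB l]>%VS = <[pB (zip eps1 [seq x j | j <- enum 'I_k])]>%VS.

Let U := nonzero_locus sB (sh b y).
Let X := sh a z `&` proj @^-1` U.

Lemma size_chart1 (q : seq K) : size q = k -> size (zip eps1 q) = k.
Proof. by move=> /(unzip_zip seps1)[]. Qed.

Lemma size_chart (q : seq K) (l2 : seq (bool * K)) : size q = k -> size l2 = m -> size (zip eps1 q ++ l2) = n.
Proof. by move=> sq sl2; rewrite size_cat size_chart1 // sl2 nE. Qed.

Lemma proj_chart q l2 : size q = k -> size l2 = m ->
  proj <[pA (zip eps1 q ++ l2)]>%VS = <[pB (zip eps1 q)]>%VS.
Proof.
move=> sq sl2; rewrite projE ?size_chart // take_size_cat // size_chart1 //.
Qed.

Lemma U_chart L : U L -> exists2 q, size q = k & L = <[pB (zip eps1 q)]>%VS.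
Proof.
move=> UL; have /(shP k_gt0 b_ok y_inj)[l sl lE] := UL.1.
have sv : peval sB (pB l) != 0.
  apply/(nonzero_locusP hsB (sh_proj k_gt0 b_ok y_inj) _ _ UL.1) => //.
    by rewrite lE memv_line.
  exact: (ptN0 k_gt0 b_ok y_inj).
exists [seq peval (gB j) (pB l) / peval sB (pB l) | j <- enum 'I_k].
  by rewrite size_map size_enum_ord.
rewrite lE; apply: (invB sl (memv_line _) _ sv) => [|j]; last by rewrite mulrC divfK.
exact: (ptN0 k_gt0 b_ok y_inj).
Qed.

(** A point over [U] may have been charted differently, but an equivalence of the first [k] steps
    extends to the whole chain by [eqv_extend]. *)
Lemma X_chart L : X L -> exists q l2, [/\ size q = k, size l2 = m & L = <[pA (zip eps1 q ++ l2)]>%VS].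
Proof.
move=> [/(shP n_gt0 a_ok z_inj)[l sl ->]]; rewrite /preimage /= projE // => /U_chart[q sq qE].
have e : eqv 1%:M (take k l) (zip eps1 q).
  by apply: (separation b_ok.1 b_ok.2 y_inj) => //; [exact: size_take_k | exact: size_chart1].
have [l2 e2] := eqv_extend (det1 _ _) e.
exists q, l2; split=> //; last exact: pt_line_eqv.
have := eqv_size e2; rewrite sl size_cat size_chart1 // nE => /eqP.
by rewrite eqn_add2l => /eqP.
Qed.

Lemma chart_X q l2 : size q = k -> size l2 = m -> U <[pB (zip eps1 q)]>%VS ->
  X <[pA (zip eps1 q ++ l2)]>%VS.
Proof.
move=> sq sl2 Uq; split; last by rewrite /preimage /= proj_chart.
by apply/(shP n_gt0 a_ok z_inj); exists (zip eps1 q ++ l2) => //; exact: size_chart.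
Qed.

(** Cuts a chain after step [k], the first steps being in the fixed chart [eps1]; the default value
    of [xget] is never met on [X]. *)
Definition triv (L : {vspace gtens K a}) :=
  let p := xget ([::], [::]) [set p : seq K * seq (bool * K) |
    [/\ size p.1 = k, size p.2 = m & L = <[pA (zip eps1 p.1 ++ p.2)]>%VS]] in
  segre <[pB (zip eps1 p.1)]>%VS <[pC p.2]>%VS.

Lemma trivE q l2 : size q = k -> size l2 = m ->
  triv <[pA (zip eps1 q ++ l2)]>%VS = segre <[pB (zip eps1 q)]>%VS <[pC l2]>%VS.
Proof.
move=> sq sl2; rewrite /triv; set S := [set p | _].
have [s1 s2 e] : S (xget ([::], [::]) S) by apply: (@xgetPex _ ([::], [::])); exists (q, l2).
move: (xget _ _) s1 s2 e => p s1 s2 e.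
have := separation a_ok.1 a_ok.2 z_inj (size_chart sq sl2) (size_chart s1 s2) e.
have fstE (r : seq K) : size r = k -> map fst (zip eps1 r) = eps1.
  by move=> /(unzip_zip seps1)[].
move/eqv_chart_inj; rewrite !fstE // => /(_ erefl)[<- e2].
by rewrite (pt_line_eqv c w sl2 e2).
Qed.

Definition untriv (P : {vspace 'M[K]_(\dim {:gtens K b}, \dim {:gtens K c})}) :=
  let p := xget ([::], [::]) [set p : seq K * seq (bool * K) |
    [/\ size p.1 = k, size p.2 = m & P = segre <[pB (zip eps1 p.1)]>%VS <[pC p.2]>%VS]] in
  <[pA (zip eps1 p.1 ++ p.2)]>%VS.

Lemma untrivE q l2 : size q = k -> size l2 = m ->
  untriv (segre <[pB (zip eps1 q)]>%VS <[pC l2]>%VS) = <[pA (zip eps1 q ++ l2)]>%VS.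
Proof.
move=> sq sl2; rewrite /untriv; set S := [set p | _].
have [s1 s2 e] : S (xget ([::], [::]) S) by apply: (@xgetPex _ ([::], [::])); exists (q, l2).
move: (xget _ _) s1 s2 e => p s1 s2 e.
have [e1 e2] := segre_inj (ptN0 k_gt0 b_ok y_inj (size_chart1 sq)) (ptN0 m_gt0 c_ok w_inj sl2)
  (ptN0 k_gt0 b_ok y_inj (size_chart1 s1)) (ptN0 m_gt0 c_ok w_inj s2) e.
have fstE (r : seq K) : size r = k -> map fst (zip eps1 r) = eps1.
  by move=> /(unzip_zip seps1)[].
have -> : zip eps1 q = zip eps1 p.1.
  have := separation b_ok.1 b_ok.2 y_inj (size_chart1 sq) (size_chart1 s1) e1.
  rewrite -[X in eqv _ X]cats0 -[X in eqv _ _ X]cats0 => /eqv_chart_inj.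
  by rewrite !fstE // => /(_ erefl)[].
apply/esym/pt_line_eqv; first exact: size_chart.
exact/eqv_refl_prefix/(separation c_ok.1 c_ok.2 w_inj).
Qed.

Lemma triv_morphism : morphism X (pprod U (sh c w)) triv.
Proof.
apply: morphism_crit => [L [/(sh_proj n_gt0 a_ok z_inj)] //|L XL|L0 /X_chart[q0 [l2 [sq0 sl2 ->]]]].
  have [q [l2 [sq sl2 LE]]] := X_chart XL; rewrite LE trivE //.
  exists (<[pB (zip eps1 q)]>%VS, <[pC l2]>%VS) => //; split=> /=.
    by rewrite -(proj_chart sq sl2) -LE; exact: XL.2.
  by apply/(shP m_gt0 c_ok w_inj); exists l2.
have sl0 := size_chart sq0 sl2.
have [d [s [g [hs hg s0 sE]]]] := inverse_at n_gt0 a_ok z_inj sl0.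
pose V (x : 'I_n -> K) := [seq x j | j <- enum 'I_n].
have sV x : size (V x) = n by rewrite size_map size_enum_ord.
have sY x : size (take k (V x)) = k by rewrite size_takel // sV nE leq_addr.
have sY' x : size (drop k (V x)) = m by rewrite size_drop sV nE addKn.
have se2 : size (map fst l2) = m by rewrite size_map.
have VE x : zip (map fst (zip eps1 q0 ++ l2)) (V x) =
    zip eps1 (take k (V x)) ++ zip (map fst l2) (drop k (V x)).
  have [e1 _ _] := unzip_zip seps1 sq0.
  by rewrite map_cat e1 -{1}(cat_take_drop k (V x)) zip_cat // seps1 sY.
have pV j : polyfun (fun x : 'I_n -> K => nth 0 (V x) j).
  exact: (@polyfun_nth K n n (fun t => t) j).
exists d, n, s, g, (fun x => tensor (pB (zip eps1 (take k (V x)))) (pC (zip (map fst l2) (drop k (V x))))).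
split=> //.
- apply: polyfun_tensor => i; apply: polyfun_pt => // j.
    have [jk|jk] := ltnP j k.
      by apply: polyfun_ext (pV j) => x; rewrite nth_take.
    apply: (@polyfun_ext K n (fun=> 0)); last exact: polyfun_const.
    by move=> x; rewrite nth_default // sY.
  by apply: polyfun_ext (pV (k + j)%N) => x; rewrite nth_drop.
- exists (pA (zip eps1 q0 ++ l2)); rewrite memv_line; split=> //.
  exact: (ptN0 n_gt0 a_ok z_inj).
move=> L v x /X_chart[q [l2' [sq sl2' ->]]] vl v0 sv xE.
have pB0 : pB (zip eps1 (take k (V x))) != 0 by apply: (ptN0 k_gt0 b_ok y_inj); exact: size_chart1.
have [_ _ sz2] := unzip_zip se2 (sY' x).
have pC0 := ptN0 m_gt0 c_ok w_inj sz2.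
split; first exact: tensor_neq0.
by rewrite (sE _ v x) ?size_chart // -/(V x) VE trivE // segre_line.
Qed.

Lemma untriv_morphism : morphism (pprod U (sh c w)) X untriv.
Proof.
have pprodP P : pprod U (sh c w) P -> exists q l2, [/\ size q = k, size l2 = m,
    U <[pB (zip eps1 q)]>%VS & P = segre <[pB (zip eps1 q)]>%VS <[pC l2]>%VS].
  move=> [[L1 L2] [/= UL /(shP m_gt0 c_ok w_inj)[l2 sl2 ->]] <-].
  by have [q sq qE] := U_chart UL; exists q, l2; rewrite -qE.
have pB0 q : size q = k -> pB (zip eps1 q) != 0.
  by move=> sq; apply: (ptN0 k_gt0 b_ok y_inj); exact: size_chart1.
have pC0 l2 := @ptN0 _ _ _ _ m_gt0 c_ok w_inj l2.
apply: morphism_crit => [P /pprodP[q [l2 [sq sl2 _ ->]]]|P /pprodP[q [l2 [sq sl2 Uq ->]]]|P0].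
- by rewrite segre_line ?pB0 ?pC0 //; apply/proj_line/tensor_neq0; [exact: pB0 | exact: pC0].
- by rewrite untrivE //; exact: chart_X.
move=> /pprodP[q0 [l20 [sq0 sl20 Uq0 ->]]].
have [dC [sC [gC [hsC hgC sC0 invC]]]] := inverse_at m_gt0 c_ok w_inj sl20.
(* Near this point the column [j0] of a tensor is a nonzero multiple of the first factor, and the
   row [i0] of the second. Substituting them lets polynomials on the factors be evaluated on the
   Segre product. *)
have [i0 ui0] := coord_neq0 (pB0 _ sq0); have [j0 vj0] := coord_neq0 (pC0 _ sl20).
pose Mt := 'M[K]_(\dim {:gtens K b}, \dim {:gtens K c}).
have ent i j : exists p : {mpoly K[\dim {:Mt}]}, p \is 1.-homog /\ forall N : Mt, peval p N = N i j.
  pose f (N : Mt) : K^o := N i j.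
  have fl : linear f by move=> t M N; rewrite /f !mxE.
  pose lf := GRing.isLinear.Build K Mt K^o _ f fl.
  by have [p hp pE] := lform_exists (HB.pack f lf : {linear Mt -> K^o}); exists p.
have [H1 H1E] := choice (fun i => ent i j0); have [H2 H2E] := choice (fun j => ent i0 j).
pose col p := mmap (@mpolyC (\dim {:Mt}) K) H1 p; pose row p := mmap (@mpolyC (\dim {:Mt}) K) H2 p.
have colE p t u v : peval (col p) (t *: tensor u v) = peval p ((t * coord (vbasis {:gtens K c}) j0 v) *: u).
  rewrite peval_mmap mmap_comp; apply: meval_eq => i.
  by rewrite -peval_mmap (H1E i).2 linearZ !mxE /GRing.scale /=; ring.
have rowE p t u v : peval (row p) (t *: tensor u v) = peval p ((t * coord (vbasis {:gtens K b}) i0 u) *: v).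
  rewrite peval_mmap mmap_comp; apply: meval_eq => i.
  by rewrite -peval_mmap (H2E i).2 linearZ !mxE /GRing.scale /=; ring.
have hcol p d : p \is d.-homog -> col p \is d.-homog.
  by apply: subst_homog => i; exact: (H1E i).1.
have hrow p d : p \is d.-homog -> row p \is d.-homog.
  by apply: subst_homog => i; exact: (H2E i).1.
(* Each numerator is multiplied by the denominator of the other factor, so that all have degree
   [dB + dC] over the common denominator. *)
pose g (j : 'I_(k + m)) := match split j with
  | inl i => col (gB i) * row sC | inr i => col sB * row (gC i) end.
pose Y1 (x : 'I_(k + m) -> K) := [seq x (lshift m i) | i <- enum 'I_k].
pose Y2 (x : 'I_(k + m) -> K) := [seq x (rshift k i) | i <- enum 'I_m].
have sY1 x : size (Y1 x) = k by rewrite size_map size_enum_ord.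
have sY2 x : size (Y2 x) = m by rewrite size_map size_enum_ord.
have se2 : size (map fst l20) = m by rewrite size_map.
exists (dB + dC)%N, (k + m)%N, (col sB * row sC), g, (fun x => pA (zip (eps1 ++ map fst l20) (Y1 x ++ Y2 x))).
split.
- by apply: dhomogM; [exact: hcol | exact: hrow].
- by move=> j; rewrite /g; case: split => i; apply: dhomogM; rewrite ?hcol ?hrow.
- move=> i; apply: polyfun_pt => [|x|j]; first by rewrite size_cat seps1 se2 nE.
    by rewrite size_cat sY1 sY2 nE.
  have [jk|jk] := ltnP j k.
    by apply: polyfun_ext (@polyfun_nth K (k + m) k (@lshift k m) j) => x; rewrite nth_cat sY1 jk.
  by apply: polyfun_ext (@polyfun_nth K (k + m) m (@rshift k m) (j - k)%N) => x; rewrite nth_cat sY1 ltnNge jk.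
- exists (tensor (pB (zip eps1 q0)) (pC l20)); split; first by rewrite segre_line ?memv_line ?pB0 ?pC0.
    by apply: tensor_neq0; [exact: pB0 | exact: pC0].
  rewrite -[tensor _ _]scale1r pevalM colE rowE !mul1r (pevalZ _ _ hsB) (pevalZ _ _ hsC).
  rewrite !mulf_neq0 ?expf_neq0 //.
  by apply/(nonzero_locusP hsB (sh_proj k_gt0 b_ok y_inj) (memv_line _) (pB0 _ sq0) Uq0.1).
move=> P v x /pprodP[q [l2 [sq sl2 Uq ->]]]; rewrite segre_line ?pB0 ?pC0 // => /vlineP[t ->] _.
set u1 := pB _; set u2 := pC _.
set t1 := t * coord (vbasis {:gtens K c}) j0 u2; set t2 := t * coord (vbasis {:gtens K b}) i0 u1.
rewrite pevalM colE rowE -/t1 -/t2 (pevalZ _ _ hsB) (pevalZ _ _ hsC) !mulf_eq0 !negb_or.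
move=> /andP[/andP[t1d s1] /andP[t2d s2]] xE.
have x1 i : peval sB u1 * x (lshift m i) = peval (gB i) u1.
  have := xE (lshift m i); rewrite /g -[lshift m i]/(unsplit (inl i)) unsplitK !pevalM !colE !rowE -/t1 -/t2.
  rewrite (pevalZ _ _ hsC) (pevalZ _ _ (hgB i)) => e.
  apply: (mulfI t1d); apply: (mulIf (mulf_neq0 t2d s2)); rewrite -e; ring.
have x2 i : peval sC u2 * x (rshift k i) = peval (gC i) u2.
  have := xE (rshift k i); rewrite /g -[rshift k i]/(unsplit (inr i)) unsplitK !pevalM !colE !rowE -/t1 -/t2.
  rewrite (pevalZ _ _ hsB) (pevalZ _ _ (hgC i)) => e.
  apply: (mulfI t2d); apply: (mulfI (mulf_neq0 t1d s1)); rewrite -e; ring.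
have zE : zip (eps1 ++ map fst l20) (Y1 x ++ Y2 x) = zip eps1 (Y1 x) ++ zip (map fst l20) (Y2 x).
  by rewrite zip_cat // seps1 sY1.
have [_ _ sz2] := unzip_zip se2 (sY2 x).
rewrite zE; split; first by apply: (ptN0 n_gt0 a_ok z_inj); exact: size_chart.
rewrite -segre_line ?pB0 ?pC0 //.
rewrite (invB (size_chart1 sq) (memv_line _) (pB0 _ sq) s1 x1).
rewrite (invC _ _ (fun i => x (rshift k i)) sl2 (memv_line _) (pC0 _ sl2) s2 x2).
exact: (untrivE (sY1 x) sz2).
Qed.

End Trivialization.

Lemma proj_bundle : is_bundle (sh a z) (sh b y) (sh c w) proj.
Proof.
split=> [|L0 shL0]; first exact: proj_morphism.
have /(shP k_gt0 b_ok y_inj)[l1 sl1 L0E] := shL0.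
have [d [s [g [hs hg s0 inv]]]] := inverse_at k_gt0 b_ok y_inj sl1.
have se : size (map fst l1) = k by rewrite size_map.
exists (nonzero_locus s (sh b y)); split; first exact: nonzero_locus_open hs.
  have vL : pB l1 \in L0 by rewrite L0E memv_line.
  by apply/(nonzero_locusP hs (sh_proj k_gt0 b_ok y_inj) vL (ptN0 k_gt0 b_ok y_inj sl1) shL0).
have Xc L := X_chart se hs inv (L := L).
exists (triv (map fst l1)); split; last first.
  move=> L shL UL; have [q [l2 [sq sl2 ->]]] := Xc L (conj shL UL).
  exists <[pC l2]>%VS; first by apply/(shP m_gt0 c_ok w_inj); exists l2.
  by rewrite trivE // proj_chart.
split; first exact: (triv_morphism se hs inv).
exists (untriv (map fst l1)); split; first exact: (untriv_morphism se hs hg inv).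
  by move=> L /Xc[q [l2 [sq sl2 ->]]]; rewrite trivE // untrivE.
move=> _ [[L1 L2] [/= UL /(shP m_gt0 c_ok w_inj)[l2 sl2 ->]] <-].
by have [q sq ->] := U_chart hs inv UL; rewrite untrivE // trivE.
Qed.

End Bundle.

Theorem corollary1p3 (R : realType) (n k : nat)
    (k_ge1 : (1 <= k)%N) (k_lt_n : (k < n)%N)
    (a : 'I_n -> nat) (z : 'I_n -> R[i])
    (b : 'I_k -> nat) (y : 'I_k -> R[i])
    (c : 'I_(n - k) -> nat) (w : 'I_(n - k) -> R[i])
    (a_ok : admissible a) (z_inj : injective z)
    (b_ok : admissible b) (y_inj : injective y)
    (c_ok : admissible c) (w_inj : injective w) :
  exists pi, is_bundle (sh a z) (sh b y) (sh c w) pi.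
Proof.
have m_gt0 : (0 < n - k)%N by rewrite subn_gt0.
have nE : n = (k + (n - k))%N by rewrite subnKC // ltnW.
by eexists; exact: (proj_bundle k_ge1 m_gt0 nE a_ok z_inj b_ok y_inj c_ok w_inj).
Qed.
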